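(* (1) Let $f\colon X\to Y$ be a morphism between finite spaces. If $\mathcal M^\bullet$ is a complex of $\mathcal O_Y$-modules with quasi-coherent cohomology, then $\mathbb Lf^*\mathcal M^\bullet$ is a complex of $\mathcal O_X$-modules with quasi-coherent cohomology. Hence one has a functor $\mathbb Lf^*\colon D_{qc}(Y)\to D_{qc}(X)$. (2) Let $\mathcal M^\bullet,\mathcal N^\bullet$ be two complexes of $\mathcal O$-modules on a finite space $X$. If $\mathcal M^\bullet$ and $\mathcal N^\bullet$ have quasi-coherent cohomology, so does $\mathcal M^\bullet\overset{\mathbb L}\otimes\mathcal N^\bullet$. So one has a functor $\overset{\mathbb L}\otimes\colon D_{qc}(X)\times D_{qc}(X)\to D_{qc}(X)$. (3) Let $X$ and $Y$ be two finite spaces and let $\mathcal K\in D_{qc}(X\times Y)$. Then the integral functor $\Phi_{\mathcal K}\colon D(X)\to D(Y)$ maps $D_{qc}(X)$ into $D_{qc}(Y)$.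
   Context: All rings are commutative with unit. A ringed finite space is a ringed space $(X,\mathcal O)$ with $X$ a finite topological space; morphisms are morphisms of ringed spaces. For $p\in X$, $U_p$ is the smallest open subset containing $p$; $p\le q$ means $q\in U_p$. The stalk is $\mathcal O_p=\mathcal O(U_p)$, with restriction morphisms $\mathcal O_p\to\mathcal O_q$ for $p\le q$. A finite space is a ringed finite space all of whose restriction morphisms are flat. An $\mathcal O$-module is quasi-coherent if it is locally a cokernel of a morphism between free modules of arbitrary rank. All spaces and morphisms are over a fixed commutative base ring $k$ (i.e. over the one-point ringed space $( *,k)$; $k=\mathbb Z$ imposes no restriction). $X\times Y=X\times_kY$ is the product topological space with $\mathcal O_{(x,y)}=\mathcal O_x\otimes_k\mathcal O_y$. $D(X)$ is the unbounded derived category of complexes of $\mathcal O_X$-modules and $D_{qc}(X)$ its full subcategory of complexes with quasi-coherent cohomology. With $\pi_X\colon X\times Y\to X$ and $\pi_Y\colon X\times Y\to Y$ the projections, the integral functor of kernel $\mathcal K\in D(X\times Y)$ is $\Phi_{\mathcal K}(\mathcal M)=\mathbb R\pi_{Y*}(\mathcal K\overset{\mathbb L}\otimes\mathbb L\pi_X^*\mathcal M)$. *)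

(* Defs.v *)
From HB Require Import structures.
From mathcomp Require Import all_boot all_order all_algebra.
From mathcomp Require Import boolp classical_sets functions cardinality topology.

Set Implicit Arguments.
Unset Strict Implicit.
Unset Printing Implicit Defensive.

Import GRing.Theory.

Local Open Scope classical_set_scope.
Local Open Scope ring_scope.
Local Open Scope quotient_scope.

Section MkLinear.
Variables (R : comPzRingType) (U V : lmodType R) (f : U -> V) (fL : linear f).
Definition mklin_fun of linear f := f.
HB.instance Definition _ :=
  GRing.isLinear.Build R U V *:%R (mklin_fun fL) fL.
Definition mklin : {linear U -> V} := mklin_fun fL.
End MkLinear.

Definition rscal (R S : comPzRingType) (phi : {rmorphism R -> S})
  (N : lmodType S) : Type := N.

Section RestrictionOfScalars.
Variables (R S : comPzRingType) (phi : {rmorphism R -> S}) (N : lmodType S).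
Local Notation T := (rscal phi N).
HB.instance Definition _ := GRing.Zmodule.copy T N.
Definition rscal_scale (a : R) (x : T) : T := phi a *: (x : N).
Fact rscal_scaleA a b v : rscal_scale a (rscal_scale b v) = rscal_scale (a * b) v.
Proof. by rewrite /rscal_scale rmorphM scalerA. Qed.
Fact rscal_scale1 : left_id 1 rscal_scale.
Proof. by move=> v; rewrite /rscal_scale rmorph1 scale1r. Qed.
Fact rscal_scaleDr : right_distributive rscal_scale +%R.
Proof. by move=> a u v; rewrite /rscal_scale scalerDr. Qed.
Fact rscal_scaleDl v : {morph rscal_scale^~ v : a b / a + b}.
Proof. by move=> a b; rewrite /rscal_scale rmorphD scalerDl. Qed.
HB.instance Definition _ := GRing.Zmodule_isLmodule.Build R T
  rscal_scaleA rscal_scale1 rscal_scaleDr rscal_scaleDl.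
End RestrictionOfScalars.

Section Submodule.
Variables (R : comPzRingType) (V : lmodType R).

Record submodule := Submodule {
  smem :> V -> Prop;
  smem0 : smem 0;
  smemP : forall a u v, smem u -> smem v -> smem (a *: u + v) }.

Variable W : submodule.
Definition spred : pred V := fun x => `[< W x >].
Fact spred_closed : submod_closed spred.
Proof.
split; first exact/asboolP/smem0.
by move=> a u v /asboolP Wu /asboolP Wv; apply/asboolP/smemP.
Qed.
HB.instance Definition _ := GRing.isSubmodClosed.Build R V spred spred_closed.

Record subm := Subm { subm_val :> V; subm_valP : spred subm_val }.
HB.instance Definition _ := [isSub for subm_val].
HB.instance Definition _ := [Choice of subm by <:].
HB.instance Definition _ := [SubChoice_isSubLmodule of subm by <:].

Lemma submP (x : subm) : W x.
Proof. exact/asboolP/(subm_valP x). Qed.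
Definition mksubm (x : V) (Wx : W x) : subm := Subm (introT (asboolP _) Wx).

Definition quotm_eqv (u v : V) := `[< W (u - v) >].
Fact quotm_eqv_equiv : equiv_class_of quotm_eqv.
Proof.
have WN u : W u -> W (- u).
  by move=> Wu; rewrite -[- u]addr0 -scaleN1r; apply: smemP => //; apply: smem0.
have WD u v : W u -> W v -> W (u + v).
  by move=> Wu Wv; rewrite -[u]scale1r; apply: smemP.
split=> [u|u v|v u w]; first by apply/asboolP; rewrite subrr; apply: smem0.
  by apply/asboolP/asboolP => /WN; rewrite opprB.
move=> /asboolP h1 /asboolP h2; apply/asboolP.
by have := WD _ _ h1 h2; rewrite addrA subrK.
Qed.
Canonical quotm_eqv_rel := EquivRelPack quotm_eqv_equiv.
Definition quotm := {eq_quot quotm_eqv}.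
HB.instance Definition _ : EqQuotient V quotm_eqv quotm := EqQuotient.on quotm.
HB.instance Definition _ := Choice.on quotm.

Lemma quotmP (u v : V) : (\pi_quotm u = \pi_quotm v) <-> W (u - v).
Proof. by split=> [/eqmodP/asboolP|h]; [|apply/eqmodP/asboolP]. Qed.

Lemma quotm_repr (u : V) : W (repr (\pi_quotm u) - u).
Proof. by apply/quotmP; rewrite reprK. Qed.

Lemma quotm_ind (P : quotm -> Prop) :
  (forall u : V, P (\pi_quotm u)) -> forall x, P x.
Proof. by move=> h x; rewrite -[x]reprK. Qed.

Definition quotm_zero : quotm := \pi_quotm 0.
Definition quotm_opp (x : quotm) : quotm := \pi_quotm (- repr x).
Definition quotm_add (x y : quotm) : quotm := \pi_quotm (repr x + repr y).
Definition quotm_scale (a : R) (x : quotm) : quotm := \pi_quotm (a *: repr x).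

Fact pi_quotm_lin a (u v : V) :
  \pi_quotm (a *: u + v) = quotm_add (quotm_scale a (\pi_quotm u)) (\pi_quotm v).
Proof.
apply/quotmP.
set u' := repr (\pi_quotm u); set w := repr (\pi_quotm v).
set z := repr (\pi_quotm (a *: u')).
have hu : W (u' - u) by apply: quotm_repr.
have hw : W (w - v) by apply: quotm_repr.
have hz : W (z - a *: u') by apply: quotm_repr.
have hN x : W x -> W (- x).
  by move=> Wx; rewrite -[- x]addr0 -scaleN1r; apply: smemP => //; apply: smem0.
have -> : a *: u + v - (z + w) =
    a *: (- (u' - u)) + (1 *: (- (z - a *: u')) + - (w - v)).
  by rewrite scale1r !opprB scalerBr !addrA subrK opprD !addrA;
     do 2!rewrite [RHS]addrAC; congr (_ + _); rewrite addrAC.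
apply: smemP; first exact: hN.
by apply: smemP; apply: hN.
Qed.

Fact pi_quotm_add u v : \pi_quotm (u + v) = quotm_add (\pi_quotm u) (\pi_quotm v).
Proof.
rewrite -[u]scale1r pi_quotm_lin scale1r; congr (quotm_add _ _).
by rewrite /quotm_scale scale1r reprK.
Qed.
Fact pi_quotm_scale a u : \pi_quotm (a *: u) = quotm_scale a (\pi_quotm u).
Proof.
rewrite -[a *: u]addr0 pi_quotm_lin -[X in quotm_add X _]reprK -pi_quotm_add.
by rewrite addr0 reprK.
Qed.
Fact quotm_addA : associative quotm_add.
Proof.
elim/quotm_ind=> u; elim/quotm_ind=> v; elim/quotm_ind=> w.
by rewrite -!pi_quotm_add addrA.
Qed.
Fact quotm_addC : commutative quotm_add.
Proof. by move=> x y; rewrite /quotm_add addrC. Qed.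
Fact quotm_add0 : left_id quotm_zero quotm_add.
Proof. by elim/quotm_ind=> u; rewrite -pi_quotm_add add0r. Qed.
Fact quotm_addN : left_inverse quotm_zero quotm_opp quotm_add.
Proof. by move=> x; rewrite -[x in quotm_add _ x]reprK -pi_quotm_add addNr. Qed.
HB.instance Definition _ := GRing.isZmodule.Build quotm
  quotm_addA quotm_addC quotm_add0 quotm_addN.

Fact quotm_scaleA a b v : quotm_scale a (quotm_scale b v) = quotm_scale (a * b) v.
Proof. by elim/quotm_ind: v => v; rewrite -!pi_quotm_scale scalerA. Qed.
Fact quotm_scale1 : left_id 1 quotm_scale.
Proof. by move=> v; rewrite /quotm_scale scale1r reprK. Qed.
Fact quotm_scaleDr : right_distributive quotm_scale +%R.
Proof.
move=> a; elim/quotm_ind=> u; elim/quotm_ind=> v.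
rewrite -[LHS]/(quotm_scale a (quotm_add (\pi_quotm u) (\pi_quotm v))).
by rewrite -pi_quotm_add -!pi_quotm_scale scalerDr pi_quotm_add.
Qed.
Fact quotm_scaleDl v : {morph quotm_scale^~ v : a b / a + b}.
Proof.
move=> a b; elim/quotm_ind: v => v.
by rewrite -!pi_quotm_scale scalerDl pi_quotm_add.
Qed.
HB.instance Definition _ := GRing.Zmodule_isLmodule.Build R quotm
  quotm_scaleA quotm_scale1 quotm_scaleDr quotm_scaleDl.

Lemma pi_quotm_linear : linear (\pi_quotm : V -> quotm).
Proof. exact: pi_quotm_lin. Qed.

End Submodule.

Section ProductModule.
Variables (R : comPzRingType) (I : Type) (V : I -> lmodType R).
Definition prodm : Type := forall i, V i.
HB.instance Definition _ := gen_eqMixin prodm.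
HB.instance Definition _ := gen_choiceMixin prodm.
Definition prodm_zero : prodm := fun i => 0.
Definition prodm_opp (x : prodm) : prodm := fun i => - x i.
Definition prodm_add (x y : prodm) : prodm := fun i => x i + y i.
Definition prodm_scale a (x : prodm) : prodm := fun i => a *: x i.
Fact prodm_addA : associative prodm_add.
Proof. by move=> x y z; apply: functional_extensionality_dep => i; rewrite /prodm_add addrA. Qed.
Fact prodm_addC : commutative prodm_add.
Proof. by move=> x y; apply: functional_extensionality_dep => i; rewrite /prodm_add addrC. Qed.
Fact prodm_add0 : left_id prodm_zero prodm_add.
Proof. by move=> x; apply: functional_extensionality_dep => i; rewrite /prodm_add add0r. Qed.
Fact prodm_addN : left_inverse prodm_zero prodm_opp prodm_add.
Proof. by move=> x; apply: functional_extensionality_dep => i; rewrite /prodm_add addNr. Qed.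
HB.instance Definition _ := GRing.isZmodule.Build prodm
  prodm_addA prodm_addC prodm_add0 prodm_addN.
Fact prodm_scaleA a b v : prodm_scale a (prodm_scale b v) = prodm_scale (a * b) v.
Proof. by apply: functional_extensionality_dep => i; rewrite /prodm_scale scalerA. Qed.
Fact prodm_scale1 : left_id 1 prodm_scale.
Proof. by move=> v; apply: functional_extensionality_dep => i; rewrite /prodm_scale scale1r. Qed.
Fact prodm_scaleDr : right_distributive prodm_scale +%R.
Proof. by move=> a u v; apply: functional_extensionality_dep => i; rewrite /prodm_scale scalerDr. Qed.
Fact prodm_scaleDl v : {morph prodm_scale^~ v : a b / a + b}.
Proof. by move=> a b; apply: functional_extensionality_dep => i; rewrite /prodm_scale scalerDl. Qed.
HB.instance Definition _ := GRing.Zmodule_isLmodule.Build R prodm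
  prodm_scaleA prodm_scale1 prodm_scaleDr prodm_scaleDl.
End ProductModule.

Section DirectSum.
Variables (R : comPzRingType) (I : Type) (V : I -> lmodType R).

Definition finsupp_mem (P : I -> Prop) (t : prodm V) :=
  finite_set [set i | t i <> 0] /\ forall i, t i <> 0 -> P i.

Fact finsupp_mem0 P : finsupp_mem P 0.
Proof.
split=> //; rewrite (_ : [set i | _] = classical_sets.set0) //.
by apply/seteqP; split=> i //=.
Qed.
Fact finsupp_memP P a u v :
  finsupp_mem P u -> finsupp_mem P v -> finsupp_mem P (a *: u + v).
Proof.
move=> [fu hu] [fv hv].
have key i : (a *: u + v) i <> 0 -> u i <> 0 \/ v i <> 0.
  move=> h; have [u0|] := pselect (u i = 0); [right=> v0; apply: h|by left].
  by rewrite -[LHS]/(a *: u i + v i) u0 v0 scaler0 addr0.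
split=> [|i /key[/hu|/hv]//].
by apply: (@sub_finite_set _ _ ([set i | u i <> 0] `|` [set i | v i <> 0]));
   rewrite ?finite_setU // => i /key.
Qed.
Definition dsum_submod (P : I -> Prop) : submodule (prodm V) :=
  Submodule (finsupp_mem0 P) (@finsupp_memP P).
Definition dsum (P : I -> Prop) : lmodType R := subm (dsum_submod P).
End DirectSum.

(* tens phi M N is M (x)_R N, where N is an S-module seen as an R-module
   through phi : R -> S; it is an S-module through N. Its elements are formal
   sums of pairs (m, n), two of them being equal when no balanced map
   separates them. *)
Section Tensor.
Variables (R S : comPzRingType) (phi : {rmorphism R -> S}).
Variables (M : lmodType R) (N : lmodType S).

Record balanced (G : zmodType) (b : M -> N -> G) : Prop := Balanced {
  balDl : forall m m' n, b (m + m') n = b m n + b m' n;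
  balDr : forall m n n', b m (n + n') = b m n + b m n';
  balZ : forall a m n, b (a *: m) n = b m (phi a *: n) }.

Definition tsum (G : zmodType) (b : M -> N -> G) (s : seq (M * N)) : G :=
  \sum_(x <- s) b x.1 x.2.

Definition tens_eqv (s t : seq (M * N)) :=
  `[< forall (G : zmodType) (b : M -> N -> G), balanced b -> tsum b s = tsum b t >].
Fact tens_eqv_equiv : equiv_class_of tens_eqv.
Proof.
split=> [u|u v|v u w]; first exact/asboolP.
  by apply/asboolP/asboolP => h G b hb; rewrite h.
by move=> /asboolP h1 /asboolP h2; apply/asboolP => G b hb; rewrite h1 ?h2.
Qed.
Canonical tens_eqv_rel := EquivRelPack tens_eqv_equiv.
Definition tens := {eq_quot tens_eqv}.
Local Notation T := tens.
HB.instance Definition _ : EqQuotient _ tens_eqv T := EqQuotient.on T.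
HB.instance Definition _ := Choice.on T.

Definition tlift (G : zmodType) (b : M -> N -> G) (x : T) : G := tsum b (repr x).

Lemma tlift_pi (G : zmodType) (b : M -> N -> G) s :
  balanced b -> tlift b (\pi_T s) = tsum b s.
Proof.
move=> hb; have : \pi_T (repr (\pi_T s)) = \pi_T s by rewrite reprK.
by move=> /eqmodP/asboolP; apply.
Qed.

Lemma tens_eq (x y : T) :
  (forall (G : zmodType) (b : M -> N -> G), balanced b -> tlift b x = tlift b y) ->
  x = y.
Proof.
by move=> h; rewrite -[x]reprK -[y]reprK; apply/eqmodP/asboolP => G b /h.
Qed.

Definition tens_zero : T := \pi_T [::].
Definition tens_opp (x : T) : T := \pi_T [seq (- y.1, y.2) | y <- repr x].
Definition tens_add (x y : T) : T := \pi_T (repr x ++ repr y).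
Definition tens_scale c (x : T) : T := \pi_T [seq (y.1, c *: y.2) | y <- repr x].

Section LiftOps.
Variables (G : zmodType) (b : M -> N -> G).
Hypothesis hb : balanced b.

Fact bal0l n : b 0 n = 0.
Proof. by apply: (addrI (b 0 n)); rewrite -(balDl hb) !addr0. Qed.
Fact balNl m n : b (- m) n = - b m n.
Proof. by apply: (addrI (b m n)); rewrite -(balDl hb) !subrr bal0l. Qed.
Fact bal_scale c : balanced (fun m n => b m (c *: n)).
Proof.
split=> *; first exact: (balDl hb).
  by rewrite scalerDr (balDr hb).
by rewrite (balZ hb) !scalerA mulrC.
Qed.
Fact tlift_zero : tlift b tens_zero = 0.
Proof. by rewrite tlift_pi // /tsum big_nil. Qed.
Fact tlift_add x y : tlift b (tens_add x y) = tlift b x + tlift b y.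
Proof. by rewrite tlift_pi // /tsum big_cat. Qed.
Fact tlift_opp x : tlift b (tens_opp x) = - tlift b x.
Proof.
rewrite tlift_pi // /tsum big_map -sumrN; apply: eq_bigr => y _ /=.
exact: balNl.
Qed.
Fact tlift_scale c x : tlift b (tens_scale c x) = tlift (fun m n => b m (c *: n)) x.
Proof. by rewrite tlift_pi // /tsum big_map. Qed.
End LiftOps.

Fact tens_addA : associative tens_add.
Proof. by move=> x y z; apply: tens_eq => G b hb; rewrite !tlift_add // addrA. Qed.
Fact tens_addC : commutative tens_add.
Proof. by move=> x y; apply: tens_eq => G b hb; rewrite !tlift_add // addrC. Qed.
Fact tens_add0 : left_id tens_zero tens_add.
Proof. by move=> x; apply: tens_eq => G b hb; rewrite tlift_add // tlift_zero // add0r. Qed.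
Fact tens_addN : left_inverse tens_zero tens_opp tens_add.
Proof.
move=> x; apply: tens_eq => G b hb.
by rewrite tlift_add // tlift_opp // tlift_zero // addNr.
Qed.
HB.instance Definition _ := GRing.isZmodule.Build T
  tens_addA tens_addC tens_add0 tens_addN.

Fact tens_scaleA a c v : tens_scale a (tens_scale c v) = tens_scale (a * c) v.
Proof.
apply: tens_eq => G b hb; rewrite !tlift_scale //; last exact: bal_scale.
by rewrite /tlift; apply: eq_bigr => y _; rewrite scalerA.
Qed.
Fact tens_scale1 : left_id 1 tens_scale.
Proof.
move=> x; apply: tens_eq => G b hb; rewrite tlift_scale //.
by apply: eq_bigr => y _; rewrite scale1r.
Qed.
Fact tens_scaleDr : right_distributive tens_scale +%R.
Proof.
move=> a u v; apply: tens_eq => G b hb.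
by rewrite tlift_scale // !tlift_add ?tlift_scale //; apply: bal_scale.
Qed.
Fact tens_scaleDl v : {morph tens_scale^~ v : a b / a + b}.
Proof.
move=> a c; apply: tens_eq => G b hb.
rewrite tlift_add // !tlift_scale // -big_split; apply: eq_bigr => y _ /=.
by rewrite scalerDl (balDr hb).
Qed.
HB.instance Definition _ := GRing.Zmodule_isLmodule.Build S T
  tens_scaleA tens_scale1 tens_scaleDr tens_scaleDl.

Definition tpure (m : M) (n : N) : T := \pi_T [:: (m, n)].

Lemma tlift_pure (G : zmodType) (b : M -> N -> G) m n :
  balanced b -> tlift b (tpure m n) = b m n.
Proof. by move=> hb; rewrite tlift_pi // /tsum big_seq1. Qed.

Lemma tpure_balanced : balanced tpure.
Proof.
by split=> *; apply: tens_eq => G b hb;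
  rewrite ?tlift_add ?tlift_pure ?(balDl hb) ?(balDr hb) ?(balZ hb).
Qed.

Lemma tliftD (G : zmodType) (b : M -> N -> G) : balanced b ->
  {morph tlift b : x y / x + y}.
Proof. by move=> hb x y; apply: tlift_add. Qed.

Lemma tlift_sum (G : zmodType) (b : M -> N -> G) I (r : seq I) (F : I -> T) :
  balanced b -> tlift b (\sum_(i <- r) F i) = \sum_(i <- r) tlift b (F i).
Proof. by move=> hb; apply: big_morph; [apply: tliftD|apply: tlift_zero]. Qed.

Lemma tensE (x : T) : x = tlift tpure x.
Proof.
apply: tens_eq => G b hb; rewrite -[tlift tpure x]/(\sum_(y <- repr x) tpure y.1 y.2) tlift_sum //.
by apply: eq_bigr => y _; rewrite tlift_pure.
Qed.

Lemma tens_scale_pure c m n : c *: tpure m n = tpure m (c *: n).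
Proof.
apply: tens_eq => G b hb; rewrite tlift_scale // !tlift_pure //.
exact: bal_scale.
Qed.

Lemma tens_ind (P : T -> Prop) :
  (forall m n, P (tpure m n)) -> P 0 -> (forall x y, P x -> P y -> P (x + y)) ->
  forall x, P x.
Proof. by move=> h1 h0 hD x; rewrite [x]tensE; apply: big_ind. Qed.

End Tensor.

Definition semilinear (R R' : comPzRingType) (alpha : {rmorphism R -> R'})
    (U : lmodType R) (V : lmodType R') (u : U -> V) :=
  linear_for (alpha \; *:%R) u.

Section Semilinear.
Variables (R R' : comPzRingType) (alpha : {rmorphism R -> R'}).
Variables (U : lmodType R) (V : lmodType R') (u : U -> V).
Hypothesis hu : semilinear alpha u.
Lemma semilinD : {morph u : x y / x + y}.
Proof. by move=> x y; rewrite -[x in LHS]scale1r hu /= rmorph1 scale1r. Qed.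
Lemma semilin0 : u 0 = 0.
Proof. by apply: (addrI (u 0)); rewrite -semilinD !addr0. Qed.
Lemma semilinZ a x : u (a *: x) = alpha a *: u x.
Proof. by rewrite -[a *: x]addr0 hu semilin0 addr0. Qed.
Lemma semilinB x y : u (x - y) = u x - u y.
Proof. by rewrite addrC -scaleN1r hu /= rmorphN1 scaleN1r addrC. Qed.
End Semilinear.

Section TensorMap.
Variables (R S R' S' : comPzRingType).
Variables (phi : {rmorphism R -> S}) (phi' : {rmorphism R' -> S'}).
Variables (alpha : {rmorphism R -> R'}) (beta : {rmorphism S -> S'}).
Variables (M : lmodType R) (N : lmodType S) (M' : lmodType R') (N' : lmodType S').
Variables (u : M -> M') (v : N -> N').

Definition tmap : tens phi M N -> tens phi' M' N' :=
  tlift (fun m n => tpure phi' (u m) (v n)).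

Hypothesis sq : forall a, beta (phi a) = phi' (alpha a).
Hypothesis hu : semilinear alpha u.
Hypothesis hv : semilinear beta v.

Lemma tmap_balanced : balanced phi (fun m n => tpure phi' (u m) (v n)).
Proof.
have hb := tpure_balanced phi' M' N'.
split=> *; rewrite ?(semilinD hu) ?(semilinD hv) ?(balDl hb) ?(balDr hb) //.
by rewrite (semilinZ hu) (semilinZ hv) (balZ hb) sq.
Qed.

Lemma tmap_pure m n : tmap (tpure phi m n) = tpure phi' (u m) (v n).
Proof. exact: tlift_pure tmap_balanced. Qed.

Lemma tmapD : {morph tmap : x y / x + y}.
Proof. exact: tliftD tmap_balanced. Qed.

Lemma tmap0 : tmap 0 = 0.
Proof. exact: tlift_zero tmap_balanced. Qed.

Lemma tmap_semilinear : semilinear beta tmap.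
Proof.
move=> c x y; rewrite tmapD /=; congr (_ + _).
elim/tens_ind: x => [m n||x x' hx hx'].
- by rewrite tens_scale_pure !tmap_pure (semilinZ hv) tens_scale_pure.
- by rewrite scaler0 tmap0 scaler0.
- by rewrite scalerDr !tmapD hx hx' scalerDr.
Qed.
End TensorMap.
Arguments tmap {R S R' S'} phi phi' {M N M' N'} u v _.

Section TensorLinearMap.
Variables (R S : comPzRingType) (phi : {rmorphism R -> S}).
Variables (M M' : lmodType R) (N N' : lmodType S).
Variables (u : {linear M -> M'}) (v : {linear N -> N'}).
Fact tmapl_linear : linear (tmap phi phi u v).
Proof.
apply: (@tmap_semilinear _ _ _ _ phi phi idfun idfun) => // a x y; exact: linearP.
Qed.
Definition tmapl : {linear tens phi M N -> tens phi M' N'} := mklin tmapl_linear.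
End TensorLinearMap.
Arguments tmapl {R S} phi {M M' N N'} u v.

Definition flat (R S : comPzRingType) (phi : {rmorphism R -> S}) :=
  forall (M M' : lmodType R) (u : {linear M -> M'}),
    injective u -> injective (tmapl phi u (idfun : {linear S^o -> S^o})).

Definition tensalg (k A B : comPzRingType) (alpha : {rmorphism k -> A})
  (beta : {rmorphism k -> B}) : Type := tens beta (rscal alpha A^o) B^o.

Section TensorAlgebra.
Variables (k A B : comPzRingType).
Variables (alpha : {rmorphism k -> A}) (beta : {rmorphism k -> B}).
Local Notation T := (tensalg alpha beta).
HB.instance Definition _ := GRing.Lmodule.on T.

Local Notation MA := (rscal alpha A^o).
Local Notation MB := (B^o).

Definition tapure (a : A) (b : B) : T := tpure beta (a : MA) (b : MB).

Fact tapureDl a a' b : tapure (a + a') b = tapure a b + tapure a' b.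
Proof. exact: (balDl (tpure_balanced beta MA MB)). Qed.
Fact tapureDr a b b' : tapure a (b + b') = tapure a b + tapure a b'.
Proof. exact: (balDr (tpure_balanced beta MA MB)). Qed.
Fact tapureZ c a b : tapure (alpha c * a) b = tapure a (beta c * b).
Proof. exact: (balZ (tpure_balanced beta MA MB)). Qed.
Fact tensalg_ind (P : T -> Prop) :
  (forall a b, P (tapure a b)) -> P 0 -> (forall x y, P x -> P y -> P (x + y)) ->
  forall x, P x.
Proof. by move=> h1 h0 hD; apply: (@tens_ind _ _ beta MA MB). Qed.

Definition ta_mul1 (a : A) (b : B) (y : T) : T :=
  tlift (fun (a' : MA) (b' : MB) => tapure (a * (a' : A)) (b * (b' : B))) y.
Definition tensalg_mul (x y : T) : T :=
  tlift (fun (a : MA) (b : MB) => ta_mul1 a b y) x.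
Definition tensalg_one : T := tapure 1 1.

Fact ta_mul1_bal a b : balanced beta
  (fun (a' : MA) (b' : MB) => tapure (a * (a' : A)) (b * (b' : B))).
Proof.
split=> [m m' n|m n n'|c m n]; first by rewrite -tapureDl -mulrDr.
  by rewrite -tapureDr -mulrDr.
rewrite -[c *: m]/(alpha c * (m : A)) -[beta c *: n]/(beta c * (n : B)).
by rewrite mulrCA tapureZ mulrCA.
Qed.
Fact ta_mul1D a b : {morph ta_mul1 a b : x y / x + y}.
Proof. exact: tliftD (ta_mul1_bal a b). Qed.
Fact ta_mul10 a b : ta_mul1 a b 0 = 0.
Proof. exact: tlift_zero (ta_mul1_bal a b). Qed.
Fact ta_mul1E a b a' b' : ta_mul1 a b (tapure a' b') = tapure (a * a') (b * b').
Proof. exact: tlift_pure (ta_mul1_bal a b). Qed.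
Fact tensalg_mul_bal y : balanced beta (fun (a : MA) (b : MB) => ta_mul1 a b y).
Proof.
elim/tensalg_ind: y => [a b||x y hx hy].
- split=> [m m' n|m n n'|c m n]; rewrite !ta_mul1E.
  + by rewrite -tapureDl -mulrDl.
  + by rewrite -tapureDr -mulrDl.
  + rewrite -[c *: m]/(alpha c * (m : A)) -[beta c *: n]/(beta c * (n : B)).
    by rewrite -!mulrA tapureZ.
- by split=> *; rewrite !ta_mul10 ?addr0.
- split=> *; rewrite !ta_mul1D.
  + by rewrite (balDl hx) (balDl hy) addrACA.
  + by rewrite (balDr hx) (balDr hy) addrACA.
  + by rewrite (balZ hx) (balZ hy).
Qed.
Fact tensalg_mulDl : left_distributive tensalg_mul +%R.
Proof. by move=> x x' y; apply: tliftD (tensalg_mul_bal y) _ _. Qed.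
Fact tensalg_mul0 y : tensalg_mul 0 y = 0.
Proof. exact: tlift_zero (tensalg_mul_bal y). Qed.
Fact tensalg_mul1E a b y : tensalg_mul (tapure a b) y = ta_mul1 a b y.
Proof. exact: tlift_pure (tensalg_mul_bal y). Qed.
Fact tensalg_mulE a b a' b' :
  tensalg_mul (tapure a b) (tapure a' b') = tapure (a * a') (b * b').
Proof. by rewrite tensalg_mul1E ta_mul1E. Qed.
Fact tensalg_mulDr : right_distributive tensalg_mul +%R.
Proof.
move=> x y y'; elim/tensalg_ind: x => [a b||x x' hx hx'].
- by rewrite !tensalg_mul1E ta_mul1D.
- by rewrite !tensalg_mul0 addr0.
- by rewrite !tensalg_mulDl hx hx' addrACA.
Qed.
Fact tensalg_mulr0 x : tensalg_mul x 0 = 0.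
Proof. by apply: (addrI (tensalg_mul x 0)); rewrite -tensalg_mulDr !addr0. Qed.
Fact tensalg_mulC : commutative tensalg_mul.
Proof.
move=> x y; elim/tensalg_ind: x => [a b||x x' hx hx'].
- elim/tensalg_ind: y => [a' b'||y y' hy hy'].
  + by rewrite !tensalg_mulE mulrC [b * _]mulrC.
  + by rewrite tensalg_mulr0 tensalg_mul0.
  + by rewrite tensalg_mulDr tensalg_mulDl hy hy'.
- by rewrite tensalg_mulr0 tensalg_mul0.
- by rewrite tensalg_mulDr tensalg_mulDl hx hx'.
Qed.
Fact tensalg_mulA : associative tensalg_mul.
Proof.
move=> x y z; elim/tensalg_ind: x => [a b||x x' hx hx'].
- elim/tensalg_ind: y => [a' b'||y y' hy hy'].
  + elim/tensalg_ind: z => [a2 b2||z z' hz hz'].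
    * by rewrite !tensalg_mulE !mulrA.
    * by rewrite !tensalg_mulr0.
    * by rewrite !tensalg_mulDr hz hz'.
  + by rewrite tensalg_mul0 tensalg_mulr0 tensalg_mul0.
  + by rewrite tensalg_mulDl !tensalg_mulDr tensalg_mulDl hy hy'.
- by rewrite !tensalg_mul0.
- by rewrite !tensalg_mulDl hx hx'.
Qed.
Fact tensalg_mul1r : left_id tensalg_one tensalg_mul.
Proof.
move=> x; elim/tensalg_ind: x => [a b||x x' hx hx'].
- by rewrite tensalg_mulE !mul1r.
- by rewrite tensalg_mulr0.
- by rewrite tensalg_mulDr hx hx'.
Qed.
HB.instance Definition _ := GRing.Zmodule_isComPzRing.Build T
  tensalg_mulA tensalg_mulC tensalg_mul1r tensalg_mulDl.

Lemma tapureM a b a' b' : tapure (a * a') (b * b') = tapure a b * tapure a' b'.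
Proof. by rewrite -tensalg_mulE. Qed.

Definition tainl (a : A) : T := tapure a 1.
Fact tainl_zmod : zmod_morphism tainl.
Proof.
have hN a : tapure (- a) 1 = - tapure a 1.
  exact: (balNl (tpure_balanced beta MA MB)).
by move=> a a'; rewrite /tainl tapureDl hN.
Qed.
Fact tainl_monoid : monoid_morphism tainl.
Proof. by split=> // a a'; rewrite /tainl -tapureM mulr1. Qed.
HB.instance Definition _ := GRing.isZmodMorphism.Build A T tainl tainl_zmod.
HB.instance Definition _ := GRing.isMonoidMorphism.Build A T tainl tainl_monoid.

Definition tainr (b : B) : T := tapure 1 b.
Fact tainr_zmod : zmod_morphism tainr.
Proof.
move=> b b'; rewrite /tainr tapureDr; congr (_ + _).
by apply: (addrI (tapure 1 b')); rewrite -tapureDr !subrr -[RHS](mul0r (tapure 1 1))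
   -[0 : B](mul0r 1) -[1 in LHS](mul1r 1) tapureM; congr (_ * _);
   apply: (addrI (tapure 1 0)); rewrite -tapureDr !addr0.
Qed.
Fact tainr_monoid : monoid_morphism tainr.
Proof. by split=> // a a'; rewrite /tainr -tapureM mulr1. Qed.
HB.instance Definition _ := GRing.isZmodMorphism.Build B T tainr tainr_zmod.
HB.instance Definition _ := GRing.isMonoidMorphism.Build B T tainr tainr_monoid.

Lemma tainlr c : tainl (alpha c) = tainr (beta c).
Proof. by rewrite /tainl /tainr -[alpha c]mulr1 tapureZ mulr1. Qed.

End TensorAlgebra.
Arguments tapure {k A B} alpha beta a b.
Arguments tainl {k A B} alpha beta a.
Arguments tainr {k A B} alpha beta b.

Section TensorAlgebraMap.
Variables (k A B A' B' : comPzRingType).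
Variables (alpha : {rmorphism k -> A}) (beta : {rmorphism k -> B}).
Variables (alpha' : {rmorphism k -> A'}) (beta' : {rmorphism k -> B'}).
Variables (u : {rmorphism A -> A'}) (v : {rmorphism B -> B'}).
Hypotheses (hu : forall c, u (alpha c) = alpha' c).
Hypotheses (hv : forall c, v (beta c) = beta' c).

Definition tamap_fun of (forall c, u (alpha c) = alpha' c)
    & (forall c, v (beta c) = beta' c) : tensalg alpha beta -> tensalg alpha' beta' :=
  tlift (fun (a : rscal alpha A^o) (b : B^o) => tapure alpha' beta' (u a) (v b)).
Local Notation f := (tamap_fun hu hv).

Fact tamap_bal : balanced beta
  (fun (a : rscal alpha A^o) (b : B^o) => tapure alpha' beta' (u a) (v b)).
Proof.
split=> [m m' n|m n n'|c m n].
- by rewrite -tapureDl -rmorphD.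
- by rewrite -tapureDr -rmorphD.
- rewrite -[c *: m]/(alpha c * (m : A)) -[beta c *: n]/(beta c * (n : B)).
  by rewrite !rmorphM hu hv tapureZ.
Qed.
Fact tamapE a b : f (tapure alpha beta a b) = tapure alpha' beta' (u a) (v b).
Proof. exact: tlift_pure tamap_bal. Qed.
Fact tamapD : {morph f : x y / x + y}.
Proof. exact: tliftD tamap_bal. Qed.
Fact tamap0 : f 0 = 0.
Proof. exact: tlift_zero tamap_bal. Qed.
Fact tamap_zmod : zmod_morphism f.
Proof. by move=> x y; apply: (addIr (f y)); rewrite -tamapD !subrK. Qed.
Fact tamap_monoid : monoid_morphism f.
Proof.
split=> [|x y]; first by rewrite tamapE !rmorph1.
elim/tensalg_ind: x => [a b||x x' hx hx'].
- elim/tensalg_ind: y => [a' b'||y y' hy hy'].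
  + by rewrite -tapureM !tamapE -tapureM !rmorphM.
  + by rewrite mulr0 tamap0 mulr0.
  + by rewrite mulrDr !tamapD hy hy' mulrDr.
- by rewrite mul0r tamap0 mul0r.
- by rewrite mulrDl !tamapD hx hx' mulrDl.
Qed.
HB.instance Definition _ := GRing.isZmodMorphism.Build _ _ f tamap_zmod.
HB.instance Definition _ := GRing.isMonoidMorphism.Build _ _ f tamap_monoid.
Definition tamap : {rmorphism tensalg alpha beta -> tensalg alpha' beta'} := f.
End TensorAlgebraMap.

Section Homology.
Variables (R : comPzRingType) (A B C : lmodType R).
Variables (d1 : {linear A -> B}) (d2 : {linear B -> C}).

Definition hker_mem (x : B) := d2 x = 0.
Fact hker0 : hker_mem 0. Proof. exact: linear0. Qed.
Fact hkerP a u v : hker_mem u -> hker_mem v -> hker_mem (a *: u + v).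
Proof. by rewrite /hker_mem linearP => -> ->; rewrite scaler0 addr0. Qed.
Definition hker : submodule B := Submodule hker0 hkerP.

Definition him_mem (z : subm hker) := exists a, d1 a = z :> B.
Fact him0 : him_mem 0. Proof. by exists 0; rewrite linear0. Qed.
Fact himP a u v : him_mem u -> him_mem v -> him_mem (a *: u + v).
Proof. by move=> [x hx] [y hy]; exists (a *: x + y); rewrite linearP hx hy. Qed.
Definition him : submodule (subm hker) := Submodule him0 himP.

Definition homol : lmodType R := quotm him.
Definition hclass (z : subm hker) : homol := \pi_(quotm him) z.

Lemma hclass_eq z z' : hclass z = hclass z' <-> exists a, d1 a = z - z' :> B.
Proof. exact: quotmP. Qed.
Lemma hclass_linear : linear hclass.
Proof. exact: pi_quotm_linear. Qed.
Lemma homol_ind (P : homol -> Prop) : (forall z, P (hclass z)) -> forall x, P x.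
Proof. exact: quotm_ind. Qed.
End Homology.

Section HomologyMap.
Variables (R R' : comPzRingType) (alpha : {rmorphism R -> R'}).
Variables (A B C : lmodType R) (d1 : {linear A -> B}) (d2 : {linear B -> C}).
Variables (A' B' C' : lmodType R').
Variables (d1' : {linear A' -> B'}) (d2' : {linear B' -> C'}).
Variables (u1 : A -> A') (u : B -> B') (u2 : C -> C').

Definition hmap (x : homol d1 d2) : homol d1' d2' :=
  hclass d1' (insubd (0 : subm (hker d2')) (u (val (repr x)))).

Hypothesis hu : semilinear alpha u.
Hypothesis hu2 : semilinear alpha u2.
Hypothesis sq1 : forall x, d1' (u1 x) = u (d1 x).
Hypothesis sq2 : forall x, d2' (u x) = u2 (d2 x).

Fact hmap_ker (z : subm (hker d2)) :
  val (insubd (0 : subm (hker d2')) (u (val z))) = u (val z).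
Proof.
rewrite insubdK //; apply/asboolP; rewrite /= /hker_mem sq2.
by rewrite (submP z) (semilin0 hu2).
Qed.

Lemma hmapE (z : subm (hker d2)) (z' : subm (hker d2')) :
  z' = u z :> B' -> hmap (hclass d1 z) = hclass d1' z'.
Proof.
move=> hz; apply/hclass_eq.
have [a ha] : exists a, d1 a = repr (hclass d1 z) - z :> B.
  exact: (@quotm_repr _ _ (him d1 d2) z).
exists (u1 a); rewrite sq1 ha -[RHS]/(val _ - val z').
by rewrite hmap_ker -[val z']/(subm_val z') hz -(semilinB hu).
Qed.

Lemma hmap_semilinear : semilinear alpha hmap.
Proof.
move=> a x y; elim/homol_ind: x => z; elim/homol_ind: y => w.
pose k (z : subm (hker d2)) := insubd (0 : subm (hker d2')) (u (val z)).
have hk z0 : hmap (hclass d1 z0) = hclass d1' (k z0).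
  by apply: hmapE; apply: hmap_ker.
rewrite -hclass_linear (@hmapE _ (alpha a *: k z + k w)).
  by rewrite hclass_linear !hk.
rewrite -[LHS]/(alpha a *: val (k z) + val (k w)) !hmap_ker.
by rewrite -[RHS]/(u (a *: val z + val w)) hu.
Qed.
End HomologyMap.
Arguments hmap {R R' A B C} d1 d2 {A' B' C'} d1' d2' u x.

Record category := Category {
  obj :> Type;
  Hom : obj -> obj -> Type;
  Heq : forall a b, Hom a b -> Hom a b -> Prop;
  idc : forall a, Hom a a;
  compc : forall a b c, Hom b c -> Hom a b -> Hom a c;
  Heq_refl : forall a b (f : Hom a b), Heq f f;
  Heq_sym : forall a b (f g : Hom a b), Heq f g -> Heq g f;
  Heq_trans : forall a b (f g h : Hom a b), Heq f g -> Heq g h -> Heq f h;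
  compc_eq : forall a b c (g g' : Hom b c) (f f' : Hom a b),
    Heq g g' -> Heq f f' -> Heq (compc g f) (compc g' f');
  compcA : forall a b c d (h : Hom c d) (g : Hom b c) (f : Hom a b),
    Heq (compc h (compc g f)) (compc (compc h g) f);
  comp1c : forall a b (f : Hom a b), Heq (compc (idc b) f) f;
  compc1 : forall a b (f : Hom a b), Heq (compc f (idc a)) f }.

Arguments Hom {_} a b.
Arguments Heq {_ a b} f g.
Arguments idc {_} a.
Arguments compc {_ a b c} g f.

Record functor (C D : category) := Functor {
  fobj :> C -> D;
  fmap : forall a b : C, Hom a b -> Hom (fobj a) (fobj b);
  fmap_eq : forall (a b : C) (f g : Hom a b), Heq f g -> Heq (fmap f) (fmap g);
  fmap_id : forall a : C, Heq (fmap (idc a)) (idc (fobj a));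
  fmap_comp : forall (a b c : C) (g : Hom b c) (f : Hom a b),
    Heq (fmap (compc g f)) (compc (fmap g) (fmap f)) }.
Arguments fmap {C D} _ {a b} f.

Definition is_iso (C : category) (a b : C) (f : Hom a b) :=
  exists g : Hom b a, Heq (compc g f) (idc a) /\ Heq (compc f g) (idc b).

Record nattrans (C D : category) (F G : functor C D) := NatTrans {
  nt :> forall a : C, Hom (F a) (G a);
  nt_nat : forall (a b : C) (f : Hom a b),
    Heq (compc (nt b) (fmap F f)) (compc (fmap G f) (nt a)) }.

Definition nat_isomorphic (C D : category) (F G : functor C D) :=
  exists eta : nattrans F G, forall a, is_iso (eta a).

Section FunctorComp.
Variables (C D E : category) (G : functor D E) (F : functor C D).
Fact fcomp_eq (a b : C) (f g : Hom a b) :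
  Heq f g -> Heq (fmap G (fmap F f)) (fmap G (fmap F g)).
Proof. by move=> h; apply/fmap_eq/fmap_eq. Qed.
Fact fcomp_id (a : C) : Heq (fmap G (fmap F (idc a))) (idc (G (F a))).
Proof. exact: Heq_trans (fmap_eq _ (fmap_id _ _)) (fmap_id _ _). Qed.
Fact fcomp_comp (a b c : C) (g : Hom b c) (f : Hom a b) :
  Heq (fmap G (fmap F (compc g f)))
      (compc (fmap G (fmap F g)) (fmap G (fmap F f))).
Proof. exact: Heq_trans (fmap_eq _ (fmap_comp _ _ _)) (fmap_comp _ _ _). Qed.
Definition fcompose : functor C E := Functor fcomp_eq fcomp_id fcomp_comp.
End FunctorComp.

Section ProductCategory.
Variables (C D : category).
Definition prod_hom (a b : C * D) : Type := (Hom a.1 b.1 * Hom a.2 b.2)%type.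
Definition prod_heq (a b : C * D) (f g : prod_hom a b) :=
  Heq f.1 g.1 /\ Heq f.2 g.2.
Definition prodcat : category.
refine (@Category (C * D)%type prod_hom prod_heq
  (fun a => (idc a.1, idc a.2))
  (fun a b c g f => (compc g.1 f.1, compc g.2 f.2)) _ _ _ _ _ _ _).
- by move=> a b f; split; apply: Heq_refl.
- by move=> a b f g [? ?]; split; apply: Heq_sym.
- by move=> a b f g h [? ?] [? ?]; split; [apply: (Heq_trans (g := g.1))|apply: (Heq_trans (g := g.2))].
- by move=> a b c g g' f f' [? ?] [? ?]; split; apply: compc_eq.
- by move=> *; split; apply: compcA.
- by move=> *; split; apply: comp1c.
- by move=> *; split; apply: compc1.
Defined.
End ProductCategory.

Section ProductFunctor.
Variables (C D C' D' : category) (F : functor C C') (G : functor D D').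
Definition prodfun : functor (prodcat C D) (prodcat C' D').
refine (@Functor (prodcat C D) (prodcat C' D') (fun a => (F a.1, G a.2))
  (fun a b f => (fmap F f.1, fmap G f.2)) _ _ _).
- by move=> a b f g [? ?]; split; apply: fmap_eq.
- by move=> a; split; apply: fmap_id.
- by move=> *; split; apply: fmap_comp.
Defined.
End ProductFunctor.

Section PartialFunctor.
Variables (C D E : category) (F : functor (prodcat C D) E) (c : C).
Definition partial : functor D E.
refine (@Functor D E (fun d => F (c, d))
  (fun a b f => fmap F ((idc c, f) : Hom ((c, a) : prodcat C D) (c, b))) _ _ _).
- by move=> a b f g h; apply: fmap_eq; split=> //; apply: Heq_refl.
- by move=> a; apply: fmap_id.
- move=> a b d g f; apply: Heq_trans (fmap_comp _ _ _); apply: fmap_eq.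
  by split; [apply/Heq_sym/comp1c|apply: Heq_refl].
Defined.
End PartialFunctor.

Section FullSubcategory.
Variables (C : category) (P : C -> Prop).
Definition fullcat : category.
refine (@Category {a : C | P a} (fun a b => Hom (sval a) (sval b))
  (fun a b f g => Heq f g) (fun a => idc (sval a))
  (fun a b c g f => compc g f) _ _ _ _ _ _ _).
- by move=> *; apply: Heq_refl.
- by move=> *; apply: Heq_sym.
- by move=> a b f g h; apply: Heq_trans.
- by move=> *; apply: compc_eq.
- by move=> *; apply: compcA.
- by move=> *; apply: comp1c.
- by move=> *; apply: compc1.
Defined.
Definition full_incl : functor fullcat C.
refine (@Functor fullcat C (fun a => sval a) (fun a b f => f) _ _ _) => //.
- by move=> *; apply: Heq_refl.
- by move=> *; apply: Heq_refl.
Defined.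
End FullSubcategory.

(* F I factors through J; for I and J inclusions of full subcategories, F maps
   A' into B'. *)
Definition restricts (A A' B B' : category) (I : functor A' A)
    (J : functor B' B) (F : functor A B) :=
  exists G : functor A' B', nat_isomorphic (fcompose J G) (fcompose F I).

(* The localization C[W^-1] (Gabriel-Zisman): morphisms are words in the
   morphisms of C and formal inverses of the elements of W. *)
Section Localization.
Variables (C : category) (W : forall a b : C, Hom a b -> Prop).

Inductive word : C -> C -> Type :=
| word_id a : word a a
| word_of a b (f : Hom a b) : word a b
| word_inv a b (s : Hom a b) (Ws : W s) : word b a
| word_comp a b c (g : word b c) (f : word a b) : word a c.

Inductive word_eq : forall a b, word a b -> word a b -> Prop :=
| we_refl a b (f : word a b) : word_eq f f
| we_sym a b (f g : word a b) : word_eq f g -> word_eq g f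
| we_trans a b (f g h : word a b) : word_eq f g -> word_eq g h -> word_eq f h
| we_comp a b c (g g' : word b c) (f f' : word a b) :
    word_eq g g' -> word_eq f f' -> word_eq (word_comp g f) (word_comp g' f')
| we_assoc a b c d (h : word c d) (g : word b c) (f : word a b) :
    word_eq (word_comp h (word_comp g f)) (word_comp (word_comp h g) f)
| we_idl a b (f : word a b) : word_eq (word_comp (word_id b) f) f
| we_idr a b (f : word a b) : word_eq (word_comp f (word_id a)) f
| we_of_eq a b (f g : Hom a b) : Heq f g -> word_eq (word_of f) (word_of g)
| we_of_id a : word_eq (word_of (idc a)) (word_id a)
| we_of_comp a b c (g : Hom b c) (f : Hom a b) :
    word_eq (word_of (compc g f)) (word_comp (word_of g) (word_of f))
| we_invl a b (s : Hom a b) (Ws : W s) :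
    word_eq (word_comp (word_inv Ws) (word_of s)) (word_id a)
| we_invr a b (s : Hom a b) (Ws : W s) :
    word_eq (word_comp (word_of s) (word_inv Ws)) (word_id b).

Definition localization : category :=
  @Category (obj C) word word_eq word_id word_comp
    we_refl we_sym we_trans we_comp we_assoc we_idl we_idr.

Definition loc_functor : functor C localization :=
  @Functor C localization (fun a => a) (fun a b f => word_of f)
    we_of_eq we_of_id we_of_comp.
End Localization.

(* Let Q : C -> E be a localization functor and F : C -> D. A left derived
   functor of F, computed by the objects of C satisfying adapted: a functor L
   on E with a natural map L Q => F which is an isomorphism on those objects;
   so L(Q c) = F(p) for every resolution p -> c (a morphism inverted by Q) with
   p adapted. Dually on the right. *)
Record left_derived (C E D : category) (Q : functor C E) (F : functor C D)
    (adapted : C -> Prop) := LeftDerived {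
  ld_functor :> functor E D;
  ld_map : nattrans (fcompose ld_functor Q) F;
  ld_iso : forall c, adapted c -> is_iso (ld_map c) }.

Record right_derived (C E D : category) (Q : functor C E) (F : functor C D)
    (adapted : C -> Prop) := RightDerived {
  rd_functor :> functor E D;
  rd_map : nattrans F (fcompose rd_functor Q);
  rd_iso : forall c, adapted c -> is_iso (rd_map c) }.

(* q lies in the smallest open subset containing p *)
Definition spec (X : topologicalType) (p q : X) : Prop :=
  forall U : set X, open U -> U p -> U q.

Definition minopen (X : topologicalType) (p : X) : set X := [set q | spec p q].

Lemma spec_refl (X : topologicalType) (p : X) : spec p p.
Proof. by []. Qed.

Lemma spec_trans (X : topologicalType) (p q r : X) :
  spec p q -> spec q r -> spec p r.
Proof. by move=> h1 h2 U oU Up; apply: h2 => //; apply: h1. Qed.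

Lemma spec_continuous (X Y : topologicalType) (f : X -> Y) (p q : X) :
  continuous f -> spec p q -> spec (f p) (f q).
Proof.
by move=> /continuousP cf h U oU; apply: (h (f @^-1` U)); apply: cf.
Qed.

Lemma open_minopen (X : topologicalType) (p : X) :
  finite_set [set: X] -> open (minopen p).
Proof.
move=> finX.
have hU q : exists U : set X, [/\ open U, U p & U q -> spec p q].
  have [h|/existsNP[U /not_implyP[oU /not_implyP[Up nUq]]]] := pselect (spec p q).
    by exists setT; split=> //; apply: openT.
  by exists U.
have [U hU'] := choice hU.
rewrite (_ : minopen p = ~` \bigcup_(q in [set: X]) ~` U q).
  apply/closed_openC/closed_bigcup => // q _; apply: open_closedC.
  by have [] := hU' q.
rewrite setC_bigcup; apply/seteqP; split=> [q pq r _|q h].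
  by rewrite setCK; have [oU Up _] := hU' r; apply: pq.
by have [_ _] := hU' q; apply; have := h q I; rewrite setCK.
Qed.

(* A sheaf on a finite space is encoded by its stalks F_p = F(U_p) and the
   restrictions F_p -> F_q for p <= q (the values on the basis of the smallest
   open subsets, on which the sheaf condition is void); its sections on an open
   subset are the compatible families of elements of the stalks. *)
Record ringed_finite_space (k : comPzRingType) := RingedFiniteSpace {
  rs_top :> topologicalType;
  rs_finite : finite_set [set: rs_top];
  rs_O : rs_top -> comPzRingType;
  rs_res : forall p q : rs_top, spec p q -> {rmorphism rs_O p -> rs_O q};
  rs_res_id : forall (p : rs_top) (h : spec p p) a, rs_res h a = a;
  rs_res_comp : forall (p q r : rs_top) (h : spec p q) (h' : spec q r)
    (h'' : spec p r) a, rs_res h' (rs_res h a) = rs_res h'' a;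
  rs_str : forall p, {rmorphism k -> rs_O p};
  rs_str_res : forall (p q : rs_top) (h : spec p q) c,
    rs_res h (rs_str p c) = rs_str q c }.

Definition finite_space (k : comPzRingType) (X : ringed_finite_space k) :=
  forall (p q : X) (h : spec p q), flat (rs_res h).

Record morphism (k : comPzRingType) (X Y : ringed_finite_space k) := Morphism {
  mor_fun :> X -> Y;
  mor_cont : continuous mor_fun;
  mor_sharp : forall x, {rmorphism rs_O (mor_fun x) -> rs_O x};
  mor_res : forall (x x' : X) (h : spec x x') (h' : spec (mor_fun x) (mor_fun x')) a,
    rs_res h (mor_sharp x a) = mor_sharp x' (rs_res h' a);
  mor_str : forall x c, mor_sharp x (rs_str (mor_fun x) c) = rs_str x c }.

Section ProductSpace.
Variables (k : comPzRingType) (X Y : ringed_finite_space k).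
Local Notation XY := (X * Y)%type.

Fact prod_finite : finite_set [set: XY].
Proof.
rewrite (_ : [set: XY] = [set: X] `*` [set: Y]); last first.
  by apply/seteqP; split.
by apply: finite_setX; apply: rs_finite.
Qed.
Fact spec_fst (p q : XY) : spec p q -> spec p.1 q.1.
Proof. by apply: spec_continuous => x; apply: cvg_fst. Qed.
Fact spec_snd (p q : XY) : spec p q -> spec p.2 q.2.
Proof. by apply: spec_continuous => x; apply: cvg_snd. Qed.

Definition prod_O (p : XY) : comPzRingType :=
  tensalg (rs_str p.1) (rs_str p.2).
Definition prod_res (p q : XY) (h : spec p q) : {rmorphism prod_O p -> prod_O q} :=
  tamap (rs_str_res (spec_fst h)) (rs_str_res (spec_snd h)).
Fact prod_res_id (p : XY) (h : spec p p) a : prod_res h a = a.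
Proof.
elim/tensalg_ind: a => [a b||a b ha hb].
- by rewrite [LHS]tamapE !rs_res_id.
- by rewrite rmorph0.
- by rewrite rmorphD ha hb.
Qed.
Fact prod_res_comp (p q r : XY) (h : spec p q) (h' : spec q r) (h'' : spec p r) a :
  prod_res h' (prod_res h a) = prod_res h'' a.
Proof.
elim/tensalg_ind: a => [a b||a b ha hb].
- rewrite [prod_res h _]tamapE [LHS]tamapE [RHS]tamapE.
  by rewrite (rs_res_comp _ _ (spec_fst h'')) (rs_res_comp _ _ (spec_snd h'')).
- by rewrite !rmorph0.
- by rewrite !rmorphD ha hb.
Qed.
Definition prod_str (p : XY) : {rmorphism k -> prod_O p} :=
  tainl (rs_str p.1) (rs_str p.2) \o rs_str p.1.
Fact prod_str_res (p q : XY) (h : spec p q) c :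
  prod_res h (prod_str p c) = prod_str q c.
Proof. by rewrite [LHS]tamapE rs_str_res rmorph1. Qed.

Definition prod_space : ringed_finite_space k :=
  RingedFiniteSpace prod_finite prod_res_id prod_res_comp prod_str_res.

Fact prod_fst_res (p q : XY) (h : spec p q) (h' : spec p.1 q.1) a :
  prod_res h (tainl (rs_str p.1) (rs_str p.2) a)
  = tainl (rs_str q.1) (rs_str q.2) (rs_res h' a).
Proof. by rewrite [LHS]tamapE rmorph1 (Prop_irrelevance (spec_fst h) h'). Qed.
Fact prod_snd_res (p q : XY) (h : spec p q) (h' : spec p.2 q.2) a :
  prod_res h (tainr (rs_str p.1) (rs_str p.2) a)
  = tainr (rs_str q.1) (rs_str q.2) (rs_res h' a).
Proof. by rewrite [LHS]tamapE rmorph1 (Prop_irrelevance (spec_snd h) h'). Qed.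

Definition prod_proj1 : morphism prod_space X :=
  @Morphism k prod_space X (fun p => p.1) (fun p => cvg_fst)
    (fun p => tainl (rs_str p.1) (rs_str p.2)) prod_fst_res
    (fun p c => erefl).
Fact prod_proj2_str (p : XY) c :
  tainr (rs_str p.1) (rs_str p.2) (rs_str p.2 c) = prod_str p c.
Proof. by rewrite -tainlr. Qed.
Definition prod_proj2 : morphism prod_space Y :=
  @Morphism k prod_space Y (fun p => p.2) (fun p => cvg_snd)
    (fun p => tainr (rs_str p.1) (rs_str p.2)) prod_snd_res prod_proj2_str.
End ProductSpace.

Section Modules.
Variables (k : comPzRingType) (X : ringed_finite_space k).

Record omodule := OModule {
  om_st :> forall p : X, lmodType (rs_O p);
  om_res : forall p q : X, spec p q -> om_st p -> om_st q;
  om_res_lin : forall (p q : X) (h : spec p q), semilinear (rs_res h) (om_res h);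
  om_res_id : forall (p : X) (h : spec p p) m, om_res h m = m;
  om_res_comp : forall (p q r : X) (h : spec p q) (h' : spec q r)
    (h'' : spec p r) m, om_res h' (om_res h m) = om_res h'' m }.

Record ohom (M N : omodule) := OHom {
  oh_fun :> forall p : X, {linear M p -> N p};
  oh_nat : forall (p q : X) (h : spec p q) m,
    om_res h (oh_fun p m) = oh_fun q (om_res h m) }.

Definition ohom_eq (M N : omodule) (f g : ohom M N) := forall p m, f p m = g p m.

Definition ohom_id (M : omodule) : ohom M M :=
  @OHom M M (fun p => idfun) (fun p q h m => erefl).

Fact ohom_comp_nat (L M N : omodule) (g : ohom M N) (f : ohom L M)
  (p q : X) (h : spec p q) m :
  om_res h ((g p \o f p) m) = (g q \o f q) (om_res h m).
Proof. by rewrite /= -!oh_nat. Qed.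
Definition ohom_comp (L M N : omodule) (g : ohom M N) (f : ohom L M) : ohom L N :=
  @OHom L N (fun p => g p \o f p) (ohom_comp_nat g f).

Definition omodcat : category.
refine (@Category omodule ohom ohom_eq ohom_id (fun a b c g f => ohom_comp g f)
  _ _ _ _ _ _ _) => //.
- by move=> M N f g h p m; rewrite h.
- by move=> M N f g h h1 h2 p m; rewrite h1 h2.
- by move=> L M N g g' f f' hg hf p m; rewrite /= hf hg.
Defined.

Record ohom_on (U : set X) (M N : omodule) := OHomOn {
  ho_fun :> forall p : X, U p -> {linear M p -> N p};
  ho_nat : forall (p q : X) (h : spec p q) (Up : U p) (Uq : U q) m,
    om_res h (ho_fun Up m) = ho_fun Uq (om_res h m) }.

Section ModuleDirectSum.
Variables (I : Type) (V : I -> omodule) (P : I -> Prop).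
Definition odsum_st (p : X) : lmodType (rs_O p) := dsum (fun i => V i p) P.
Definition odsum_res_fun (p q : X) (h : spec p q) (t : odsum_st p) :
  prodm (fun i => V i q) := fun i => om_res h (subm_val t i).
Fact odsum_res_supp (p q : X) (h : spec p q) (t : odsum_st p) :
  finsupp_mem P (odsum_res_fun h t).
Proof.
have [ft Pt] := submP t.
have key i : odsum_res_fun h t i <> 0 -> subm_val t i <> 0.
  by move=> hi ti; apply: hi; rewrite /odsum_res_fun ti (semilin0 (om_res_lin h)).
by split=> [|i /key/Pt//]; apply: sub_finite_set ft => i /key.
Qed.
Definition odsum_res (p q : X) (h : spec p q) (t : odsum_st p) : odsum_st q :=
  mksubm (W := dsum_submod _ _) (odsum_res_supp h t).
Fact odsum_inj (p : X) (s t : odsum_st p) :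
  (forall i, subm_val s i = subm_val t i) -> s = t.
Proof. by move=> h; apply: val_inj; apply: functional_extensionality_dep. Qed.
Fact odsum_res_lin (p q : X) (h : spec p q) :
  semilinear (rs_res h) (odsum_res h).
Proof. by move=> a u v; apply: odsum_inj => i; apply: om_res_lin. Qed.
Fact odsum_res_id (p : X) (h : spec p p) t : odsum_res h t = t.
Proof. by apply: odsum_inj => i; apply: om_res_id. Qed.
Fact odsum_res_comp (p q r : X) (h : spec p q) (h' : spec q r) (h'' : spec p r) t :
  odsum_res h' (odsum_res h t) = odsum_res h'' t.
Proof. by apply: odsum_inj => i; apply: om_res_comp. Qed.
(* The direct sum of the V i over the indices i satisfying P *)
Definition odsum : omodule := OModule odsum_res_lin odsum_res_id odsum_res_comp.
End ModuleDirectSum.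

Section DirectSumMap.
Variables (I : Type) (V W : I -> omodule) (P : I -> Prop).
Variable u : forall i, ohom (V i) (W i).
Definition odsum_map_fun (p : X) (t : odsum V P p) : prodm (fun i => W i p) :=
  fun i => u i p (subm_val t i).
Fact odsum_map_supp (p : X) (t : odsum V P p) : finsupp_mem P (odsum_map_fun t).
Proof.
have [ft Pt] := submP t.
have key i : odsum_map_fun t i <> 0 -> subm_val t i <> 0.
  by move=> hi ti; apply: hi; rewrite /odsum_map_fun ti linear0.
by split=> [|i /key/Pt//]; apply: sub_finite_set ft => i /key.
Qed.
Definition odsum_map_st (p : X) (t : odsum V P p) : odsum W P p :=
  mksubm (W := dsum_submod _ _) (odsum_map_supp t).
Fact odsum_map_lin (p : X) : linear (@odsum_map_st p).
Proof. by move=> a s t; apply: odsum_inj => i; apply: (linearP (u i p)). Qed.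
Fact odsum_map_nat (p q : X) (h : spec p q) (t : odsum V P p) :
  om_res h (mklin (@odsum_map_lin p) t) = mklin (@odsum_map_lin q) (om_res h t).
Proof. by apply: odsum_inj => i; apply: oh_nat. Qed.
Definition odsum_map : ohom (odsum V P) (odsum W P) :=
  @OHom (odsum V P) (odsum W P) (fun p => mklin (@odsum_map_lin p)) odsum_map_nat.
End DirectSumMap.

Fact reg_res_lin (p q : X) (h : spec p q) :
  semilinear (rs_res h) (rs_res h : (rs_O p)^o -> (rs_O q)^o).
Proof. by move=> a u v; rewrite rmorphD rmorphM. Qed.
Definition structure_sheaf : omodule :=
  @OModule (fun p => (rs_O p)^o) (fun p q h => rs_res h) reg_res_lin
    (@rs_res_id _ X) (@rs_res_comp _ X).

Definition free_module (I : Type) : omodule :=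
  odsum (fun _ : I => structure_sheaf) (fun _ => True).

Definition quasi_coherent (M : omodule) :=
  forall p : X, exists U : set X, [/\ open U, U p &
    exists (I J : Type) (phi : ohom_on U (free_module J) (free_module I))
           (psi : ohom_on U (free_module I) M),
    forall (q : X) (Uq : U q),
      (forall m : M q, exists e, psi q Uq e = m) /\
      (forall e, psi q Uq e = 0 <-> exists e', phi q Uq e' = e)].

(* M(U), as a module over a ring R mapping to O(U), that is, compatibly to the
   stalks of O at the points of U *)
Section Sections.
Variables (M : omodule) (U : set X) (R : comPzRingType).
Variable (rho : forall p : X, U p -> {rmorphism R -> rs_O p}).
Hypothesis rho_res : forall (p q : X) (h : spec p q) (Up : U p) (Uq : U q) a,
  rs_res h (rho Up a) = rho Uq a.

Definition sections_fam : lmodType R :=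
  prodm (fun i : {p : X | U p} => rscal (rho (proj2_sig i)) (M (sval i))).
Definition compatible (t : sections_fam) :=
  forall (i j : {p : X | U p}) (h : spec (sval i) (sval j)),
    om_res h (t i : M (sval i)) = (t j : M (sval j)).
Fact compatible0 : compatible 0.
Proof. by move=> i j h; exact: (semilin0 (om_res_lin h)). Qed.
Fact compatibleP a u v : compatible u -> compatible v -> compatible (a *: u + v).
Proof.
move=> hu hv i j h.
rewrite -[LHS]/(om_res h (rho (proj2_sig i) a *: (u i : M (sval i)) + (v i : M (sval i)))).
by rewrite om_res_lin /= hu hv (rho_res h (proj2_sig i) (proj2_sig j)).
Qed.
Definition compatible_submod : submodule sections_fam :=
  Submodule compatible0 compatibleP.
Definition sections : lmodType R := subm compatible_submod.
End Sections.

End Modules.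
Arguments compatible {k X} M U {R} rho t.
Arguments ohom {k X} M N.
Arguments omodcat {k} X.

Lemma sections_minopen (k : comPzRingType) (X : ringed_finite_space k)
  (M : omodule X) (p : X) (m : M p) :
  exists! s : sections M (U := minopen p) (rho := fun q _ => rs_str q)
      (fun q r h _ _ c => rs_str_res h c),
    forall i, (subm_val s i : M (sval i)) = om_res (proj2_sig i) m.
Proof.
pose t : sections_fam M (fun q (_ : minopen p q) => rs_str q) :=
  fun i => om_res (proj2_sig i) m.
have ht : compatible M (minopen p) (fun q _ => rs_str q) t.
  by move=> i j h; apply: om_res_comp.
pose W := @compatible_submod k X M (minopen p) k (fun q _ => rs_str q)
  (fun q r h _ _ c => rs_str_res h c).
exists (@mksubm _ _ W t ht).
split=> // s hs.
apply: val_inj; apply: functional_extensionality_dep => i.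
exact: esym (hs i).
Qed.

Section InverseImage.
Variables (k : comPzRingType) (X Y : ringed_finite_space k) (f : morphism X Y).

Definition spec_mor (x x' : X) (h : spec x x') : spec (f x) (f x') :=
  spec_continuous (@mor_cont _ _ _ f) h.

Section Object.
Variable M : omodule Y.
Definition pull_st (x : X) : lmodType (rs_O x) :=
  tens (mor_sharp f x) (M (f x)) (rs_O x)^o.
Definition pull_res (x x' : X) (h : spec x x') : pull_st x -> pull_st x' :=
  tmap (mor_sharp f x) (mor_sharp f x') (om_res (spec_mor h))
    (rs_res h : (rs_O x)^o -> (rs_O x')^o).
Fact pull_res_lin (x x' : X) (h : spec x x') :
  semilinear (rs_res h) (pull_res h).
Proof.
apply: (tmap_semilinear (alpha := rs_res (spec_mor h))).
- by move=> a; apply: mor_res.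
- exact: om_res_lin.
- exact: reg_res_lin.
Qed.
Fact pull_res_pure (x x' : X) (h : spec x x') m a :
  pull_res h (tpure (mor_sharp f x) m a)
  = tpure (mor_sharp f x') (om_res (spec_mor h) m) (rs_res h a : (rs_O x')^o).
Proof.
apply: (tmap_pure (alpha := rs_res (spec_mor h)) (beta := rs_res h)).
- by move=> c; apply: mor_res.
- exact: om_res_lin.
- exact: reg_res_lin.
Qed.
Fact pull_res_id (x : X) (h : spec x x) m : pull_res h m = m.
Proof.
elim/tens_ind: m => [m a||m m' hm hm'].
- by rewrite pull_res_pure om_res_id rs_res_id.
- exact: (semilin0 (pull_res_lin h)).
- by rewrite (semilinD (pull_res_lin h)) hm hm'.
Qed.
Fact pull_res_comp (p q r : X) (h : spec p q) (h' : spec q r) (h'' : spec p r) m :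
  pull_res h' (pull_res h m) = pull_res h'' m.
Proof.
have hL := @pull_res_lin.
elim/tens_ind: m => [m a||m m' hm hm'].
- by rewrite !pull_res_pure (om_res_comp _ _ (spec_mor h'')) (rs_res_comp _ _ h'').
- by rewrite !(semilin0 (pull_res_lin _)).
- by rewrite !(semilinD (pull_res_lin _)) hm hm'.
Qed.
Definition pullback : omodule X := OModule pull_res_lin pull_res_id pull_res_comp.
End Object.

Section Map.
Variables (M N : omodule Y) (u : ohom M N).
Definition pull_map_st (x : X) : {linear pullback M x -> pullback N x} :=
  tmapl (mor_sharp f x) (u (f x)) idfun.
Fact pull_map_pure (x : X) m a :
  pull_map_st x (tpure (mor_sharp f x) m a) = tpure (mor_sharp f x) (u (f x) m) a.
Proof.
apply: (@tmap_pure _ _ _ _ _ _ idfun idfun) => // c y z; exact: linearP.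
Qed.
Fact pull_map_nat (p q : X) (h : spec p q) m :
  om_res h (pull_map_st p m) = pull_map_st q (om_res h m).
Proof.
elim/tens_ind: m => [m a||m m' hm hm'].
- by rewrite pull_map_pure [LHS]pull_res_pure oh_nat [om_res h _]pull_res_pure pull_map_pure.
- by rewrite linear0 !(semilin0 (om_res_lin h)) linear0.
- by rewrite linearD !(semilinD (om_res_lin h)) linearD hm hm'.
Qed.
Definition pull_map : ohom (pullback M) (pullback N) := OHom pull_map_nat.
End Map.

Definition pull_functor : functor (omodcat Y) (omodcat X).
refine (@Functor (omodcat Y) (omodcat X) pullback pull_map _ _ _).
- move=> M N u v huv p m; elim/tens_ind: m => [m a||m m' hm hm'].
  + by rewrite !pull_map_pure huv.
  + by rewrite !linear0.
  + by rewrite !linearD hm hm'.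
- move=> M p m; elim/tens_ind: m => [m a||m m' hm hm'].
  + by rewrite pull_map_pure.
  + by rewrite !linear0.
  + by rewrite !linearD hm hm'.
- move=> L M N u v p m; elim/tens_ind: m => [m a||m m' hm hm'].
  + rewrite -[LHS]/(pull_map_st (ohom_comp u v) p _).
    by rewrite -[RHS]/(pull_map_st u p (pull_map_st v p _)) !pull_map_pure.
  + by rewrite !linear0.
  + by rewrite !linearD hm hm'.
Defined.
End InverseImage.

Section DirectImage.
Variables (k : comPzRingType) (X Y : ringed_finite_space k) (f : morphism X Y).

Definition push_open (y : Y) : set X := f @^-1` minopen y.
Definition push_rho (y : Y) (x : X) (h : push_open y x) :
  {rmorphism rs_O y -> rs_O x} := mor_sharp f x \o rs_res h.
Fact push_rho_res (y : Y) (p q : X) (h : spec p q) (Up : push_open y p)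
  (Uq : push_open y q) a : rs_res h (push_rho Up a) = push_rho Uq a.
Proof.
by rewrite /= (mor_res h (spec_mor h)) (rs_res_comp _ _ Uq).
Qed.

Section Object.
Variable M : omodule X.
(* (f_* M)_y = M(f^{-1}(U_y)) *)
Definition push_st (y : Y) : lmodType (rs_O y) :=
  sections M (@push_rho_res y).
Definition push_restr (y y' : Y) (h : spec y y') (t : push_st y) :
  sections_fam M (@push_rho y') :=
  fun i => subm_val t (exist _ (sval i) (spec_trans h (proj2_sig i))).
Fact push_restr_compat (y y' : Y) (h : spec y y') (t : push_st y) :
  compatible M _ _ (push_restr h t).
Proof.
move=> i j hij.
exact: (@submP _ _ (compatible_submod M (@push_rho_res y)) t
  (exist _ (sval i) (spec_trans h (proj2_sig i)))
  (exist _ (sval j) (spec_trans h (proj2_sig j))) hij).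
Qed.
Definition push_res (y y' : Y) (h : spec y y') (t : push_st y) : push_st y' :=
  mksubm (W := compatible_submod M (@push_rho_res y')) (push_restr_compat h t).
Fact push_val_inj (y : Y) (s t : push_st y) :
  (forall i, subm_val s i = subm_val t i) -> s = t.
Proof. by move=> h; apply: val_inj; apply: functional_extensionality_dep. Qed.
Fact push_res_lin (y y' : Y) (h : spec y y') :
  semilinear (rs_res h) (push_res h).
Proof.
move=> a u v; apply: push_val_inj => -[x hx].
set hx' : push_open y x := spec_trans h hx.
pose u0 := subm_val u (exist _ x hx') : M x.
pose v0 := subm_val v (exist _ x hx') : M x.
rewrite -[LHS]/(push_rho hx' a *: u0 + v0).
rewrite -[RHS]/(push_rho hx (rs_res h a) *: u0 + v0) /=.
by rewrite (rs_res_comp h hx hx').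
Qed.
Fact push_res_id (y : Y) (h : spec y y) t : push_res h t = t.
Proof.
apply: push_val_inj => -[x hx]; rewrite /= /push_restr /=.
by rewrite (Prop_irrelevance (spec_trans h hx) hx).
Qed.
Fact push_res_comp (p q r : Y) (h : spec p q) (h' : spec q r) (h'' : spec p r) t :
  push_res h' (push_res h t) = push_res h'' t.
Proof.
apply: push_val_inj => -[x hx]; rewrite /= /push_restr /= /push_restr /=.
by rewrite (Prop_irrelevance (spec_trans h (spec_trans h' hx)) (spec_trans h'' hx)).
Qed.
Definition pushforward : omodule Y := OModule push_res_lin push_res_id push_res_comp.
End Object.

Section Map.
Variables (M N : omodule X) (u : ohom M N).
Definition push_map_fam (y : Y) (t : push_st M y) : sections_fam N (@push_rho y) :=
  fun i => u (sval i) (subm_val t i).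
Fact push_map_compat (y : Y) (t : push_st M y) : compatible N _ _ (push_map_fam t).
Proof.
move=> i j h; rewrite /push_map_fam oh_nat; congr (u _ _).
exact: (@submP _ _ (compatible_submod M (@push_rho_res y)) t i j h).
Qed.
Definition push_map_fun (y : Y) (t : push_st M y) : push_st N y :=
  mksubm (W := compatible_submod N (@push_rho_res y)) (push_map_compat t).
Fact push_map_lin (y : Y) : linear (@push_map_fun y).
Proof.
move=> a s t; apply: push_val_inj => i; exact: (linearP (u (sval i))).
Qed.
Fact push_map_nat (p q : Y) (h : spec p q) m :
  om_res (o := pushforward N) h (mklin (@push_map_lin p) m)
  = mklin (@push_map_lin q) (om_res (o := pushforward M) h m).
Proof. exact: push_val_inj. Qed.
Definition push_map : ohom (pushforward M) (pushforward N) :=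
  @OHom _ _ (pushforward M) (pushforward N) (fun y => mklin (@push_map_lin y))
    push_map_nat.
End Map.

Definition push_functor : functor (omodcat X) (omodcat Y).
refine (@Functor (omodcat X) (omodcat Y) pushforward push_map _ _ _).
- by move=> M N u v huv p m; apply: push_val_inj => i; apply: huv.
- by move=> M p m; apply: push_val_inj.
- by move=> L M N u v p m; apply: push_val_inj.
Defined.
End DirectImage.

Section Complexes.
Variables (k : comPzRingType) (X : ringed_finite_space k).

(* The differential is given in all bidegrees (i, j), and is zero unless
   j = i + 1. *)
Record complex := Complex {
  cx_ob :> int -> omodule X;
  cx_d : forall i j, ohom (cx_ob i) (cx_ob j);
  cx_d0 : forall i j, j != i + 1 -> forall p m, cx_d i j p m = 0;
  cx_dd : forall i j l p m, cx_d j l p (cx_d i j p m) = 0 }.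

Record chain_map (M N : complex) := ChainMap {
  cm_fun :> forall i, ohom (M i) (N i);
  cm_d : forall i j p m, cx_d N i j p (cm_fun i p m) = cm_fun j p (cx_d M i j p m) }.

Definition chain_eq (M N : complex) (f g : chain_map M N) :=
  forall i p m, f i p m = g i p m.

Definition chain_id (M : complex) : chain_map M M :=
  @ChainMap M M (fun i => ohom_id (M i)) (fun i j p m => erefl).

Fact chain_comp_d (L M N : complex) (g : chain_map M N) (f : chain_map L M) i j p m :
  cx_d N i j p (ohom_comp (g i) (f i) p m)
  = ohom_comp (g j) (f j) p (cx_d L i j p m).
Proof. by rewrite /= !cm_d. Qed.
Definition chain_comp (L M N : complex) (g : chain_map M N) (f : chain_map L M) :
  chain_map L N := ChainMap (chain_comp_d g f).

Definition cxcat : category.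
refine (@Category complex chain_map chain_eq chain_id
  (fun a b c g f => chain_comp g f) _ _ _ _ _ _ _) => //.
- by move=> M N f g h i p m; rewrite h.
- by move=> M N f g h h1 h2 i p m; rewrite h1 h2.
- by move=> L M N g g' f f' hg hf i p m; rewrite /= hf hg.
Defined.

Section Cohomology.
Variables (M : complex) (i : int).
Definition coh_st (p : X) : lmodType (rs_O p) :=
  homol (cx_d M (i - 1) i p) (cx_d M i (i + 1) p).
Definition coh_res (p q : X) (h : spec p q) : coh_st p -> coh_st q :=
  hmap (cx_d M (i - 1) i p) (cx_d M i (i + 1) p)
       (cx_d M (i - 1) i q) (cx_d M i (i + 1) q) (om_res h).
Fact coh_res_lin (p q : X) (h : spec p q) : semilinear (rs_res h) (coh_res h).
Proof.
apply: (hmap_semilinear (om_res_lin h) (om_res_lin h) (u1 := om_res h)) => x;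
  exact: esym (oh_nat _ h x).
Qed.
Fact coh_resE (p q : X) (h : spec p q) (z : subm (hker (cx_d M i (i + 1) p)))
  (z' : subm (hker (cx_d M i (i + 1) q))) :
  subm_val z' = om_res h (subm_val z) ->
  coh_res h (hclass (cx_d M (i - 1) i p) z) = hclass (cx_d M (i - 1) i q) z'.
Proof.
apply: (hmapE (om_res_lin h) (om_res_lin h) (u1 := om_res h)) => x;
  exact: esym (oh_nat _ h x).
Qed.
Fact coh_res_ker (p q : X) (h : spec p q) (z : subm (hker (cx_d M i (i + 1) p))) :
  hker (cx_d M i (i + 1) q) (om_res h (subm_val z)).
Proof.
rewrite /= /hker_mem -oh_nat.
by have -> := submP z; rewrite (semilin0 (om_res_lin h)).
Qed.
Fact coh_res_id (p : X) (h : spec p p) m : coh_res h m = m.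
Proof.
by elim/homol_ind: m => z; apply: coh_resE; rewrite om_res_id.
Qed.
Fact coh_res_comp (p q r : X) (h : spec p q) (h' : spec q r) (h'' : spec p r) m :
  coh_res h' (coh_res h m) = coh_res h'' m.
Proof.
elim/homol_ind: m => z.
rewrite (@coh_resE _ _ h z (mksubm (coh_res_ker h z))) //.
set w := mksubm _.
rewrite (@coh_resE _ _ h' w (mksubm (coh_res_ker h' w))) //.
rewrite (@coh_resE _ _ h'' z (mksubm (coh_res_ker h' w))) //.
exact: om_res_comp.
Qed.
Definition cohomology : omodule X := OModule coh_res_lin coh_res_id coh_res_comp.
End Cohomology.

Definition coh_map (M N : complex) (f : chain_map M N) (i : int) (p : X) :
  cohomology M i p -> cohomology N i p :=
  hmap (cx_d M (i - 1) i p) (cx_d M i (i + 1) p)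
       (cx_d N (i - 1) i p) (cx_d N i (i + 1) p) (f i p).

Definition quasi_iso (M N : complex) (f : chain_map M N) :=
  forall i p, bijective (@coh_map M N f i p).

Definition acyclic (M : complex) :=
  forall i (p : X) (x : cohomology M i p), x = 0.

Definition qc_cohomology (M : complex) :=
  forall i, quasi_coherent (cohomology M i).

Definition null_homotopic (M N : complex) (f : chain_map M N) :=
  exists s : forall i j, ohom (M i) (N j), forall i p m,
    f i p m = cx_d N (i - 1) i p (s i (i - 1) p m)
              + s (i + 1) i p (cx_d M i (i + 1) p m).

Definition K_injective (I : complex) :=
  forall A : complex, acyclic A -> forall f : chain_map A I, null_homotopic f.

Definition derived : category :=
  @localization cxcat quasi_iso.
Definition Qfun : functor cxcat derived := @loc_functor cxcat quasi_iso.

Definition Dqc : category := @fullcat derived qc_cohomology.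
Definition Dqc_incl : functor Dqc derived := @full_incl derived qc_cohomology.

End Complexes.

(* A functor between categories of modules preserving zero maps, applied
   degreewise to complexes *)
Section Degreewise.
Variables (k : comPzRingType) (X Y : ringed_finite_space k).
Variable F : functor (omodcat X) (omodcat Y).
Hypothesis F0 : forall (M N : omodule X) (u : ohom M N),
  (forall p m, u p m = 0) ->
  forall p m, (fmap F (a := M) (b := N) u : ohom (F M) (F N)) p m = 0.

Section Object.
Variable M : complex X.
Definition dw_d i j : ohom (F (M i) : omodule Y) (F (M j) : omodule Y) :=
  fmap F (a := M i) (b := M j) (cx_d M i j).
Fact dw_d0 i j : j != i + 1 -> forall p m, dw_d i j p m = 0.
Proof. by move=> h; apply: F0 => p m; apply: cx_d0. Qed.
Fact dw_dd i j l p m : dw_d j l p (dw_d i j p m) = 0.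
Proof.
rewrite -[LHS](fmap_comp F (a := M i) (b := M j) (c := M l)).
by apply: F0 => q x; apply: cx_dd.
Qed.
Definition dw_complex : complex Y := Complex dw_d0 dw_dd.
End Object.

Section Map.
Variables (M N : complex X) (f : chain_map M N).
Definition dw_fun i : ohom (dw_complex M i) (dw_complex N i) :=
  fmap F (a := M i) (b := N i) (f i).
Fact dw_fun_d i j p m :
  cx_d (dw_complex N) i j p (dw_fun i p m) = dw_fun j p (cx_d (dw_complex M) i j p m).
Proof.
rewrite -[LHS](fmap_comp F (a := M i) (b := N i) (c := N j)).
rewrite -[RHS](fmap_comp F (a := M i) (b := M j) (c := N j)).
apply: (@fmap_eq _ _ F (M i) (N j) (ohom_comp (cx_d N i j) (f i))
  (ohom_comp (f j) (cx_d M i j))) => q x; exact: cm_d.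
Qed.
Definition dw_map : chain_map (dw_complex M) (dw_complex N) := ChainMap dw_fun_d.
End Map.

Definition degreewise : functor (cxcat X) (cxcat Y).
refine (@Functor (cxcat X) (cxcat Y) dw_complex dw_map _ _ _).
- move=> M N f g h i.
  by apply: (@fmap_eq _ _ F (M i) (N i) (f i) (g i)) => p m; apply: h.
- by move=> M i; apply: (@fmap_id _ _ F (M i)).
- move=> L M N g f i.
  exact: (@fmap_comp _ _ F (L i) (M i) (N i) (g i) (f i)).
Defined.
End Degreewise.

Section ComplexImages.
Variables (k : comPzRingType) (X Y : ringed_finite_space k) (f : morphism X Y).
Fact pull0 (M N : omodule Y) (u : ohom M N) :
  (forall p m, u p m = 0) -> forall p m, pull_map f u p m = 0.
Proof.
move=> h p m; elim/tens_ind: m => [m a||m m' hm hm'].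
- rewrite [LHS]pull_map_pure h.
  exact: (bal0l (tpure_balanced (mor_sharp f p) (N (f p)) (rs_O p)^o)).
- exact: linear0.
- by rewrite linearD hm hm' addr0.
Qed.
Fact push0 (M N : omodule X) (u : ohom M N) :
  (forall p m, u p m = 0) -> forall p m, push_map f u p m = 0.
Proof. by move=> h p m; apply: push_val_inj => i; apply: h. Qed.
Definition pull_cx : functor (cxcat Y) (cxcat X) :=
  @degreewise k Y X (pull_functor f) pull0.
Definition push_cx : functor (cxcat X) (cxcat Y) :=
  @degreewise k X Y (push_functor f) push0.
End ComplexImages.

Section ModuleTensor.
Variables (k : comPzRingType) (X : ringed_finite_space k).

Section Object.
Variables (M N : omodule X).
Local Notation idr p := (idfun : {rmorphism rs_O (p : X) -> rs_O p}).
Definition ot_st (p : X) : lmodType (rs_O p) := tens (idr p) (M p) (N p).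
Definition ot_res (p q : X) (h : spec p q) : ot_st p -> ot_st q :=
  tmap (idr p) (idr q) (om_res h) (om_res h).
Fact ot_res_lin (p q : X) (h : spec p q) : semilinear (rs_res h) (ot_res h).
Proof. by apply: (tmap_semilinear (alpha := rs_res h)) => //; apply: om_res_lin. Qed.
Fact ot_res_pure (p q : X) (h : spec p q) m n :
  ot_res h (tpure (idr p) m n) = tpure (idr q) (om_res h m) (om_res h n).
Proof.
by apply: (tmap_pure (alpha := rs_res h) (beta := rs_res h)) => //; apply: om_res_lin.
Qed.
Fact ot_res_id (p : X) (h : spec p p) m : ot_res h m = m.
Proof.
elim/tens_ind: m => [m n||m m' hm hm'].
- by rewrite ot_res_pure !om_res_id.
- exact: (semilin0 (ot_res_lin h)).
- by rewrite (semilinD (ot_res_lin h)) hm hm'.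
Qed.
Fact ot_res_comp (p q r : X) (h : spec p q) (h' : spec q r) (h'' : spec p r) m :
  ot_res h' (ot_res h m) = ot_res h'' m.
Proof.
elim/tens_ind: m => [m n||m m' hm hm'].
- by rewrite !ot_res_pure !(om_res_comp _ _ h'').
- by rewrite !(semilin0 (ot_res_lin _)).
- by rewrite !(semilinD (ot_res_lin _)) hm hm'.
Qed.
Definition otensor : omodule X := OModule ot_res_lin ot_res_id ot_res_comp.
End Object.

Section Map.
Variables (M N M' N' : omodule X) (u : ohom M M') (v : ohom N N').
Local Notation idr p := (idfun : {rmorphism rs_O (p : X) -> rs_O p}).
Definition ot_map_st (p : X) : {linear otensor M N p -> otensor M' N' p} :=
  tmapl (idr p) (u p) (v p).
Fact ot_map_pure (p : X) m n :
  ot_map_st p (tpure (idr p) m n) = tpure (idr p) (u p m) (v p n).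
Proof.
apply: (@tmap_pure _ _ _ _ _ _ idfun idfun) => // c y z; exact: linearP.
Qed.
Fact ot_map_nat (p q : X) (h : spec p q) m :
  om_res h (ot_map_st p m) = ot_map_st q (om_res h m).
Proof.
elim/tens_ind: m => [m n||m m' hm hm'].
- rewrite ot_map_pure [LHS]ot_res_pure !oh_nat.
  rewrite -[RHS]/(ot_map_st q (ot_res h (tpure (idr p) m n))).
  by rewrite ot_res_pure ot_map_pure.
- by rewrite linear0 !(semilin0 (om_res_lin h)) linear0.
- by rewrite linearD !(semilinD (om_res_lin h)) linearD hm hm'.
Qed.
Definition ot_map : ohom (otensor M N) (otensor M' N') := OHom ot_map_nat.
End Map.

Lemma ot_ind (M N : omodule X) (p : X) (P : otensor M N p -> Prop) :
  (forall m n, P (tpure idfun m n)) -> P 0 ->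
  (forall x y, P x -> P y -> P (x + y)) -> forall x, P x.
Proof. exact: tens_ind. Qed.

Lemma ot_map_eq (M N M' N' : omodule X) (u u' : ohom M M') (v v' : ohom N N') p m :
  (forall m, u p m = u' p m) -> (forall n, v p n = v' p n) ->
  ot_map u v p m = ot_map u' v' p m.
Proof.
move=> hu hv; elim/ot_ind: m => [m n||m m' hm hm'].
- by rewrite !ot_map_pure hu hv.
- by rewrite !linear0.
- by rewrite !linearD hm hm'.
Qed.
Lemma ot_map_id (M N : omodule X) p m : ot_map (ohom_id M) (ohom_id N) p m = m.
Proof.
elim/ot_ind: m => [m n||m m' hm hm'].
- by rewrite ot_map_pure.
- by rewrite linear0.
- by rewrite linearD hm hm'.
Qed.
Lemma ot_map_comp (M N M' N' M'' N'' : omodule X) (u' : ohom M' M'')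
  (v' : ohom N' N'') (u : ohom M M') (v : ohom N N') p m :
  ot_map u' v' p (ot_map u v p m) = ot_map (ohom_comp u' u) (ohom_comp v' v) p m.
Proof.
elim/ot_ind: m => [m n||m m' hm hm'].
- by rewrite !ot_map_pure.
- by rewrite !linear0.
- by rewrite !linearD hm hm'.
Qed.
Lemma ot_map0l (M N M' N' : omodule X) (u : ohom M M') (v : ohom N N') p m :
  (forall m, u p m = 0) -> ot_map u v p m = 0.
Proof.
move=> hu; elim/ot_ind: m => [m n||m m' hm hm'].
- by rewrite ot_map_pure hu; apply: (bal0l (tpure_balanced idfun (M' p) (N' p))).
- exact: linear0.
- by rewrite linearD hm hm' addr0.
Qed.
Lemma ot_map0r (M N M' N' : omodule X) (u : ohom M M') (v : ohom N N') p m :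
  (forall n, v p n = 0) -> ot_map u v p m = 0.
Proof.
move=> hv; elim/ot_ind: m => [m n||m m' hm hm'].
- rewrite ot_map_pure hv -[0 in LHS](scale0r (0 : N' p)) -tens_scale_pure.
  exact: scale0r.
- exact: linear0.
- by rewrite linearD hm hm' addr0.
Qed.
End ModuleTensor.

Lemma sign_pred (R : comPzRingType) (i : int) :
  (-1) ^+ `|(i - 1)%R|%N = - (-1) ^+ `|i|%N :> R.
Proof.
case: i => [[|n]|n]; first by rewrite /= expr1 expr0.
  have -> : n.+1%:Z - 1 = n%:Z by rewrite intS [1 + _]addrC addrK.
  by rewrite !absz_nat exprS mulN1r opprK.
by rewrite NegzE -opprD -PoszD !abszN !absz_nat addn1 [in LHS]exprS mulN1r.
Qed.

Section TensorComplex.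
Variables (k : comPzRingType) (X : ringed_finite_space k).

Section Object.
Variables (M N : complex X).
(* (M (x) N)^n is the direct sum of the M^i (x) N^j with i + j = n, with
   d = d_M (x) 1 + (-1)^i (1 (x) d_N) on M^i (x) N^j. *)
Definition tc_bi (ij : int * int) : omodule X := otensor (M ij.1) (N ij.2).
Definition tc_ob (n : int) : omodule X :=
  odsum tc_bi (fun ij => ij.1 + ij.2 = n).

Definition tc_d1 (p : X) (t : prodm (fun ij => tc_bi ij p)) (ij : int * int) :
    tc_bi ij p :=
  ot_map (cx_d M (ij.1 - 1) ij.1) (ohom_id (N ij.2)) p (t (ij.1 - 1, ij.2)).
Definition tc_d2 (p : X) (t : prodm (fun ij => tc_bi ij p)) (ij : int * int) :
    tc_bi ij p :=
  ot_map (ohom_id (M ij.1)) (cx_d N (ij.2 - 1) ij.2) p (t (ij.1, ij.2 - 1)).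
Definition tc_d_fam (m : int) (p : X) (t : prodm (fun ij => tc_bi ij p)) :
    prodm (fun ij => tc_bi ij p) :=
  fun ij => if ij.1 + ij.2 == m
            then tc_d1 t ij + (-1) ^+ `|ij.1|%N *: tc_d2 t ij else 0.

Fact tc_d_supp (n m : int) (p : X) (t : tc_ob n p) :
  finsupp_mem (fun ij => ij.1 + ij.2 = m) (tc_d_fam m (subm_val t)).
Proof.
have [ft Pt] := submP t; split; last first.
  by move=> ij; rewrite /tc_d_fam; case: eqP.
have hs : [set ij | tc_d_fam m (subm_val t) ij <> 0] `<=`
    (fun ij : int * int => (ij.1 + 1, ij.2)) @` [set ij | subm_val t ij <> 0] `|`
    (fun ij : int * int => (ij.1, ij.2 + 1)) @` [set ij | subm_val t ij <> 0].
  move=> [i j]; rewrite /= /tc_d_fam /tc_d1 /tc_d2 /=; case: eqP => // _ h.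
  have [h1|h1] := pselect (subm_val t (i - 1, j) = 0); last first.
    by left; exists (i - 1, j); rewrite //= subrK.
  have [h2|h2] := pselect (subm_val t (i, j - 1) = 0); last first.
    by right; exists (i, j - 1); rewrite //= subrK.
  by exfalso; apply: h; rewrite h1 h2 !linear0 ?scaler0 addr0.
apply: sub_finite_set hs _; rewrite finite_setU.
by split; apply: finite_image.
Qed.
Definition tc_d_st (n m : int) (p : X) (t : tc_ob n p) : tc_ob m p :=
  mksubm (W := dsum_submod _ _) (tc_d_supp m t).
Fact tc_d_lin (n m : int) (p : X) : linear (@tc_d_st n m p).
Proof.
move=> a s t; apply: odsum_inj => ij.
rewrite -[LHS]/(tc_d_fam m (a *: subm_val s + subm_val t) ij).
rewrite -[RHS]/(a *: tc_d_fam m (subm_val s) ij + tc_d_fam m (subm_val t) ij).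
rewrite /tc_d_fam; case: eqP => _; last by rewrite scaler0 addr0.
rewrite /tc_d1 /tc_d2.
rewrite -[(a *: subm_val s + subm_val t) (ij.1 - 1, ij.2)]/
  (a *: subm_val s (ij.1 - 1, ij.2) + subm_val t (ij.1 - 1, ij.2)).
rewrite -[(a *: subm_val s + subm_val t) (ij.1, ij.2 - 1)]/
  (a *: subm_val s (ij.1, ij.2 - 1) + subm_val t (ij.1, ij.2 - 1)).
rewrite !linearP !scalerDr !scalerA [a * _]mulrC addrACA.
by [].
Qed.
Fact tc_d_nat (n m : int) (p q : X) (h : spec p q) (t : tc_ob n p) :
  om_res h (mklin (@tc_d_lin n m p) t) = mklin (@tc_d_lin n m q) (om_res h t).
Proof.
apply: odsum_inj => ij.
rewrite -[LHS]/(om_res h (tc_d_fam m (subm_val t) ij)).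
rewrite -[RHS]/(tc_d_fam m (fun ij => om_res h (subm_val t ij)) ij).
rewrite /tc_d_fam; case: eqP => _; last exact: (semilin0 (om_res_lin h)).
rewrite (semilinD (om_res_lin h)) (semilinZ (om_res_lin h)) /tc_d1 /tc_d2.
by rewrite !oh_nat rmorphXn rmorphN1.
Qed.
Definition tc_d (n m : int) : ohom (tc_ob n) (tc_ob m) :=
  @OHom _ _ (tc_ob n) (tc_ob m) (fun p => mklin (@tc_d_lin n m p)) (@tc_d_nat n m).

Fact tc_d0 n m : m != n + 1 -> forall p t, tc_d n m p t = 0.
Proof.
move=> hm p t; apply: odsum_inj => -[i j].
rewrite -[LHS]/(tc_d_fam m (subm_val t) (i, j)) /tc_d_fam /=.
case: eqP => // hij; have [_ Pt] := submP t.
have t0 i' j' : i' + j' <> n -> subm_val t (i', j') = 0.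
  by move=> h; have [//|/Pt/h] := pselect (subm_val t (i', j') = 0).
rewrite /tc_d1 /tc_d2 /= !t0 ?linear0 ?scaler0 ?addr0 // => h;
  by move/eqP: hm; apply; rewrite -hij -h ?addrA ?subrK // addrAC subrK.
Qed.
Fact tc_dd n m l p t : tc_d m l p (tc_d n m p t) = 0.
Proof.
apply: odsum_inj => -[i j].
rewrite -[LHS]/(tc_d_fam l (tc_d_fam m (subm_val t)) (i, j)).
rewrite /tc_d_fam; case: eqP => // _.
rewrite /tc_d1 /tc_d2; cbv beta iota delta [fst snd].
rewrite addrA [i - 1 + j]addrAC.
case: eqP => _; last by rewrite !linear0 ?scaler0 addr0.
rewrite !linearD !linearZ !ot_map_comp.
have h1 x : ohom_comp (cx_d M (i - 1) i) (cx_d M (i - 1 - 1) (i - 1)) p x = 0.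
  exact: cx_dd.
have h2 x : ohom_comp (cx_d N (j - 1) j) (cx_d N (j - 1 - 1) (j - 1)) p x = 0.
  exact: cx_dd.
rewrite (ot_map0l _ _ h1) (ot_map0r _ _ h2).
set A : otensor (M i) (N j) p := ot_map _ _ p _.
set B : otensor (M i) (N j) p := ot_map (ohom_comp (ohom_id (M i)) _) _ p _.
have -> : A = B by apply: ot_map_eq.
pose e : rs_O p := (-1) ^+ `|i|%N.
pose e' : rs_O p := (-1) ^+ `|(i - 1)%R|%N.
transitivity (0 + e' *: B + (e *: B + e *: (e *: (0 : otensor (M i) (N j) p)))) => //.
by rewrite !scaler0 add0r addr0 /e' sign_pred scaleNr addNr.
Qed.
Definition tensor_complex : complex X := Complex tc_d0 tc_dd.
End Object.

Section Map.
Variables (M N M' N' : complex X) (f : chain_map M M') (g : chain_map N N').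
Definition tc_map_fun (n : int) :
    ohom (tensor_complex M N n) (tensor_complex M' N' n) :=
  odsum_map _ (fun ij : int * int =>
    ot_map (f ij.1) (g ij.2) : ohom (tc_bi M N ij) (tc_bi M' N' ij)).
Fact tc_map_d n m p t :
  cx_d (tensor_complex M' N') n m p (tc_map_fun n p t)
  = tc_map_fun m p (cx_d (tensor_complex M N) n m p t).
Proof.
apply: odsum_inj => -[i j].
pose ft : prodm (fun ij => tc_bi M' N' ij p) :=
  fun ij => ot_map (f ij.1) (g ij.2) p (subm_val t ij).
rewrite -[LHS]/(tc_d_fam m ft (i, j)).
rewrite -[RHS]/(ot_map (f i) (g j) p (tc_d_fam m (subm_val t) (i, j))).
rewrite /tc_d_fam; case: eqP => _; last by rewrite linear0.
rewrite linearD linearZ /tc_d1 /tc_d2 /ft; cbv beta iota delta [fst snd].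
rewrite !ot_map_comp.
by congr (_ + _ *: _); apply: ot_map_eq => x //=; rewrite cm_d.
Qed.
Definition tc_map : chain_map (tensor_complex M N) (tensor_complex M' N') :=
  ChainMap tc_map_d.
End Map.

Definition tensor_cx : functor (prodcat (cxcat X) (cxcat X)) (cxcat X).
refine (@Functor (prodcat (cxcat X) (cxcat X)) (cxcat X)
  (fun MN => tensor_complex MN.1 MN.2) (fun a b fg => tc_map fg.1 fg.2) _ _ _).
- move=> a b f g [h1 h2] n p t; apply: odsum_inj => ij.
  by apply: ot_map_eq => x; [apply: h1|apply: h2].
- by move=> a n p t; apply: odsum_inj => ij; apply: ot_map_id.
- move=> a b c g f n p t; apply: odsum_inj => ij.
  by symmetry; apply: ot_map_comp.
Defined.

Definition K_flat (P : complex X) :=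
  forall N : complex X, acyclic N -> acyclic (tensor_complex P N).
End TensorComplex.

Section DerivedFunctors.
Variables (k : comPzRingType).

Definition derived_pullback (X Y : ringed_finite_space k) (f : morphism X Y) :=
  left_derived (Qfun Y) (fcompose (Qfun X) (pull_cx f)) (@K_flat k Y).

Definition derived_pushforward (X Y : ringed_finite_space k) (f : morphism X Y) :=
  right_derived (Qfun X) (fcompose (Qfun Y) (push_cx f)) (@K_injective k X).

Definition derived_tensor (X : ringed_finite_space k) :=
  left_derived (prodfun (Qfun X) (Qfun X)) (fcompose (Qfun X) (tensor_cx X))
    (fun MN => K_flat MN.1).

Definition integral_functor (X Y : ringed_finite_space k)
    (Lpi : derived_pullback (prod_proj1 X Y)) (T : derived_tensor (prod_space X Y))
    (Rpi : derived_pushforward (prod_proj2 X Y)) (K : derived (prod_space X Y)) :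
    functor (derived X) (derived Y) :=
  fcompose Rpi (fcompose (partial T K) Lpi).
End DerivedFunctors.

(* Main.v *)
(* Over a finite space (flat restrictions), a complex has quasi-coherent cohomology
   iff the maps M_p (x) O_q -> M_q are quasi-isomorphisms for p <= q.

   A complex N has a semifree resolution F, built from cells c lying over points:
   F_q is free on the cells over the points p <= q, and the boundary of a cell
   involves cells of smaller level only. Induction on the level shows that F is
   K-flat, and that if N has quasi-coherent cohomology then, for p <= q, F_q is
   homotopy equivalent to its span by the cells over the points <= p. This span is
   F_p (x) O_q, and the homotopy survives pullbacks and tensor products: hence (1)
   and (2).

   For (3), M -> I is a resolution by a K-injective complex of products of sheaves
   i_* Hom_Z(O_p, Q/Z), i being the inclusion of the point p; it is the limit of a
   tower each stage of which kills the cohomology of the previous one. Sections of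
   I over V x U_y satisfy base change along y <= y' for every open V: for V = U_x
   this is the quasi-coherence of the cohomology of I, and Mayer-Vietoris sequences,
   which stay exact after the tensor product, give the general case by induction on
   V. The direct image is the case V = X. *)
Require Import Defs.
From HB Require Import structures.
From mathcomp Require Import all_boot all_order all_algebra.
From mathcomp Require Import boolp classical_sets functions cardinality topology.

Set Implicit Arguments.
Unset Strict Implicit.
Unset Printing Implicit Defensive.

Import GRing.Theory.
Import Defs.

Local Open Scope classical_set_scope.
Local Open Scope ring_scope.
Local Open Scope quotient_scope.

(** * Tensor products and flatness *)

(** The complexes are unbounded, so neither truncation nor induction on the degree is available:
    inductions on complexes run on levels instead. The cells form one inductive type that contains,
    for every cocycle of the cone of F -> N at a point, a cell with that boundary and that value;
    the augmentation is thus a quasi-isomorphism without any iterated attachment. The tower is the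
    dual device: its components are indexed by characters, with the stage at which a character
    appears as level, and its limit needs a Mittag-Leffler argument.

    Quasi-isomorphisms are treated through elements of the mapping cone ([qis]), so that no quotient
    enters these inductions.

    In (3) the terms of I are infinite products, which need not commute with tensor products: base
    change is available for complexes of sections, not termwise, and has to be propagated from the
    stalks. This works because O at (x,y') is the base change of O at (x,y) along O_y -> O_y', and
    because extension by zero expresses the exactness of Mayer-Vietoris sequences by linear
    identities, which any tensor product preserves. *)

Section Image.
Variables (R : comPzRingType) (V W : lmodType R) (f : {linear V -> W}).
Definition lim_mem (y : W) := exists x, f x = y.
Fact lim0 : lim_mem 0. Proof. by exists 0; rewrite linear0. Qed.
Fact limP a u v : lim_mem u -> lim_mem v -> lim_mem (a *: u + v).
Proof. by move=> [x <-] [y <-]; exists (a *: x + y); rewrite linearP. Qed.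
Definition limage : submodule W := Submodule lim0 limP.
End Image.

Section TensorMore.
Variables (R S : comPzRingType) (phi : {rmorphism R -> S}).

Lemma tmapl_pure (M M' : lmodType R) (N N' : lmodType S) (u : {linear M -> M'})
    (v : {linear N -> N'}) m n :
  tmapl phi u v (tpure phi m n) = tpure phi (u m) (v n).
Proof. by apply: (@tmap_pure _ _ _ _ _ _ idfun idfun) => // c y z; exact: linearP. Qed.

Lemma tpureDl (M : lmodType R) (N : lmodType S) (m m' : M) (n : N) :
  tpure phi (m + m') n = tpure phi m n + tpure phi m' n.
Proof. exact: (balDl (tpure_balanced phi M N)). Qed.
Lemma tpureDr (M : lmodType R) (N : lmodType S) (m : M) (n n' : N) :
  tpure phi m (n + n') = tpure phi m n + tpure phi m n'.
Proof. exact: (balDr (tpure_balanced phi M N)). Qed.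
Lemma tpureZ (M : lmodType R) (N : lmodType S) a (m : M) (n : N) :
  tpure phi (a *: m) n = tpure phi m (phi a *: n).
Proof. exact: (balZ (tpure_balanced phi M N)). Qed.
Lemma tpure0l (M : lmodType R) (N : lmodType S) (n : N) : tpure phi (0 : M) n = 0.
Proof. exact: (bal0l (tpure_balanced phi M N)). Qed.
Lemma tpure0r (M : lmodType R) (N : lmodType S) (m : M) : tpure phi m (0 : N) = 0.
Proof. by rewrite -(scale0r (0 : N)) -tens_scale_pure scale0r. Qed.
Lemma tpureNl (M : lmodType R) (N : lmodType S) (m : M) (n : N) :
  tpure phi (- m) n = - tpure phi m n.
Proof. by apply: (addrI (tpure phi m n)); rewrite -tpureDl !subrr tpure0l. Qed.

Lemma tmapl_comp (M M' M'' : lmodType R) (N N' N'' : lmodType S)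
    (u : {linear M -> M'}) (v : {linear N -> N'}) (u' : {linear M' -> M''})
    (v' : {linear N' -> N''}) (u'' : {linear M -> M''}) (v'' : {linear N -> N''}) x :
  (forall m, u'' m = u' (u m)) -> (forall n, v'' n = v' (v n)) ->
  tmapl phi u' v' (tmapl phi u v x) = tmapl phi u'' v'' x.
Proof.
move=> hu hv; elim/tens_ind: x => [m n||x y hx hy].
- by rewrite !tmapl_pure hu hv.
- by rewrite !linear0.
- by rewrite !linearD hx hy.
Qed.

Lemma tmapl0l (M M' : lmodType R) (N N' : lmodType S) (u : {linear M -> M'})
    (v : {linear N -> N'}) x :
  (forall m, u m = 0) -> tmapl phi u v x = 0.
Proof.
move=> hu; elim/tens_ind: x => [m n||x y hx hy].
- by rewrite tmapl_pure hu tpure0l.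
- by rewrite linear0.
- by rewrite linearD hx hy addr0.
Qed.

Lemma morphD0 (G H : zmodType) (f : G -> H) : {morph f : x y / x + y} -> f 0 = 0.
Proof. by move=> h; apply: (addrI (f 0)); rewrite -h !addr0. Qed.
Lemma morphDN (G H : zmodType) (f : G -> H) : {morph f : x y / x + y} -> forall x, f (- x) = - f x.
Proof. by move=> h x; apply: (addrI (f x)); rewrite -h !subrr morphD0. Qed.
Lemma morphDB (G H : zmodType) (f : G -> H) :
  {morph f : x y / x + y} -> forall x y, f (x - y) = f x - f y.
Proof. by move=> h x y; rewrite h morphDN. Qed.
Lemma morphD_inj (G H : zmodType) (f : G -> H) : {morph f : x y / x + y} ->
  (forall x, f x = 0 -> x = 0) -> injective f.
Proof. by move=> h h0 x y e; apply: subr0_eq; apply: h0; rewrite morphDB // e subrr. Qed.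

Lemma morphD_sum (G H : zmodType) (f : G -> H) I (r : seq I) (F : I -> G) :
  {morph f : x y / x + y} -> f (\sum_(i <- r) F i) = \sum_(i <- r) f (F i).
Proof. by move=> h; apply: big_morph => //; apply: morphD0. Qed.

Lemma tens_ext (M : lmodType R) (N : lmodType S) (G : zmodType)
    (f g : tens phi M N -> G) : {morph f : x y / x + y} -> {morph g : x y / x + y} ->
  (forall m n, f (tpure phi m n) = g (tpure phi m n)) -> forall x, f x = g x.
Proof.
move=> hf hg h; apply: tens_ind => [//||x y hx hy]; first by rewrite !morphD0.
by rewrite hf hg hx hy.
Qed.

Lemma tens_surj (M M' : lmodType R) (N : lmodType S) (u : {linear M -> M'}) :
  (forall y, exists x, u x = y) ->
  forall y, exists x, tmapl phi u (idfun : {linear N -> N}) x = y.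
Proof.
move=> h; apply: tens_ind => [m n||x y [a <-] [b <-]].
- by have [x <-] := h m; exists (tpure phi x n); rewrite tmapl_pure.
- by exists 0; rewrite linear0.
- by exists (a + b); rewrite linearD.
Qed.

(** A set-theoretic section [g] of [v] induces a balanced map to the cokernel of [U], because two
    lifts of one element differ by the image of [u]. The projection onto this cokernel therefore
    factors through [V]. *)
Lemma tens_right_exact (M1 M2 M3 : lmodType R) (N : lmodType S)
    (u : {linear M1 -> M2}) (v : {linear M2 -> M3}) :
  (forall y, v y = 0 -> exists x, u x = y) -> (forall z, exists y, v y = z) ->
  forall y, tmapl phi v (idfun : {linear N -> N}) y = 0 ->
  exists x, tmapl phi u (idfun : {linear N -> N}) x = y.
Proof.
move=> hex hs.
have [g hg] := choice hs.
set U := tmapl phi u _; set V := tmapl phi v _.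
pose Q := quotm (limage U).
pose b (z : M3) (n : N) : Q := \pi_Q (tpure phi (g z) n).
have piD (s t : tens phi M2 N) : \pi_Q (s + t) = \pi_Q s + \pi_Q t :> Q.
  exact: pi_quotm_add.
have key y z n : v y = v z -> \pi_Q (tpure phi y n) = \pi_Q (tpure phi z n).
  move=> e; have [x hx] : exists x, u x = y - z.
    by apply: hex; rewrite linearB e subrr.
  by apply/quotmP; exists (tpure phi x n); rewrite tmapl_pure hx tpureDl tpureNl.
have hb : balanced phi b.
  split=> [z z' n|z n n'|a z n]; rewrite /b -?piD -?tpureDr //.
    by rewrite -tpureDl; apply: key; rewrite linearD !hg.
  by rewrite -tpureZ; apply: key; rewrite linearZ /= !hg.
have e y : \pi_Q y = tlift b (V y).
  apply: (tens_ind (P := fun y => \pi_Q y = tlift b (V y))) => [m n||x z hx hz].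
  - by rewrite tmapl_pure tlift_pure //; apply: key; rewrite hg.
  - by rewrite linear0; apply/esym/(tlift_zero hb).
  - by rewrite linearD [RHS](tliftD hb) -hx -hz piD.
move=> y hy; have : \pi_Q y = \pi_Q 0 by rewrite !e linear0 hy.
by move=> /quotmP[x hx]; exists x; rewrite hx subr0.
Qed.

Hypothesis fl : flat phi.

Lemma flat_inj (M M' : lmodType R) (u : {linear M -> M'}) :
  (forall x, u x = 0 -> x = 0) ->
  forall x, tmapl phi u (idfun : {linear S^o -> S^o}) x = 0 -> x = 0.
Proof.
move=> h x e; apply: (fl (u := u)); last by rewrite linear0.
by move=> a b /eqP; rewrite -subr_eq0 -linearB => /eqP/h/subr0_eq.
Qed.

(** Since [flat] speaks of injections only, [v] is split into the surjection onto its image, handled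
    by right exactness, and the inclusion of the image, handled by flatness. *)
Lemma flat_exact (M1 M2 M3 : lmodType R)
    (u : {linear M1 -> M2}) (v : {linear M2 -> M3}) :
  (forall y, v y = 0 -> exists x, u x = y) ->
  forall y, tmapl phi v (idfun : {linear S^o -> S^o}) y = 0 ->
  exists x, tmapl phi u (idfun : {linear S^o -> S^o}) x = y.
Proof.
move=> hex y hy.
pose W0 := limage v.
pose w (a : M2) := mksubm (W := W0) (ex_intro _ a erefl).
have wl : linear w.
  by move=> a s t; apply: val_inj; exact: (linearP v).
have il : linear (val : subm W0 -> M3) by move=> *.
pose i := mklin il.
apply: (tens_right_exact (v := mklin wl)) => [z hz|z|].
- by apply: hex; exact: (congr1 val hz).
- by have [a ha] := submP z; exists a; apply: val_inj.
- apply: (flat_inj (u := i)) => [z hz|]; first exact: val_inj.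
  by rewrite -hy; apply: tmapl_comp.
Qed.

End TensorMore.

Section TensorAssoc.
Variables (R S T : comPzRingType).
Variables (phi : {rmorphism R -> S}) (psi : {rmorphism S -> T}) (chi : {rmorphism R -> T}).
Hypothesis hchi : forall a, chi a = psi (phi a).
Variables (M : lmodType R) (N : lmodType T).

Definition tassoc1 (n : N) (x : tens phi M S^o) : tens chi M N :=
  tlift (fun (m : M) (s : S^o) => tpure chi m (psi s *: n)) x.
Definition tassoc (x : tens psi (tens phi M S^o) N) : tens chi M N :=
  tlift (fun x n => tassoc1 n x) x.

Fact tassoc1_bal (n : N) : balanced phi (fun (m : M) (s : S^o) => tpure chi m (psi s *: n)).
Proof.
split=> [m m' s|m s s'|a m s]; first exact: tpureDl.
  by rewrite rmorphD scalerDl tpureDr.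
by rewrite tpureZ hchi scalerA -rmorphM.
Qed.
Fact tassoc1_pure (n : N) m s : tassoc1 n (tpure phi m s) = tpure chi m (psi s *: n).
Proof. exact: tlift_pure (tassoc1_bal n). Qed.
Fact tassoc1D (n : N) : {morph tassoc1 n : x y / x + y}.
Proof. exact: tliftD (tassoc1_bal n). Qed.
Fact tassoc_bal : balanced psi (fun x n => tassoc1 n x).
Proof.
split=> [x y n|x n n'|a x n]; first exact: tassoc1D.
  apply: (tens_ext (f := tassoc1 (n + n')) (g := fun x => tassoc1 n x + tassoc1 n' x)).
  - exact: tassoc1D.
  - by move=> y z; rewrite !tassoc1D addrACA.
  - by move=> m s; rewrite !tassoc1_pure scalerDr tpureDr.
apply: (tens_ext (f := fun x => tassoc1 n (a *: x)) (g := tassoc1 (psi a *: n))).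
- by move=> y z; rewrite scalerDr tassoc1D.
- exact: tassoc1D.
- move=> m s; rewrite tens_scale_pure !tassoc1_pure scalerA -rmorphM.
  by rewrite [a *: s]mulrC.
Qed.
Lemma tassoc_pure (m : M) s (n : N) :
  tassoc (tpure psi (tpure phi m s) n) = tpure chi m (psi s *: n).
Proof. by rewrite /tassoc (tlift_pure _ _ tassoc_bal) tassoc1_pure. Qed.
Lemma tassocD : {morph tassoc : x y / x + y}.
Proof. exact: tliftD tassoc_bal. Qed.

Definition tassoc_inv (x : tens chi M N) : tens psi (tens phi M S^o) N :=
  tlift (fun (m : M) (n : N) => tpure psi (tpure phi m (1 : S^o)) n) x.
Fact tassoc_inv_bal :
  balanced chi (fun (m : M) (n : N) => tpure psi (tpure phi m (1 : S^o)) n : tens psi _ N).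
Proof.
split=> [m m' s|m s s'|a m s]; first by rewrite !tpureDl.
  by rewrite tpureDr.
by rewrite tpureZ -tens_scale_pure tpureZ hchi.
Qed.
Lemma tassoc_invD : {morph tassoc_inv : x y / x + y}.
Proof. exact: tliftD tassoc_inv_bal. Qed.
Lemma tassoc_inv_pure (m : M) (n : N) :
  tassoc_inv (tpure chi m n) = tpure psi (tpure phi m (1 : S^o)) n.
Proof. exact: tlift_pure tassoc_inv_bal. Qed.

Lemma tassocK : cancel tassoc tassoc_inv.
Proof.
apply: tens_ext => [x y|//|x n]; first by rewrite tassocD tassoc_invD.
apply: (tens_ext (f := fun x => tassoc_inv (tassoc (tpure psi x n)))
  (g := fun x => tpure psi x n)) => [y z|y z|m s].
- by rewrite tpureDl tassocD tassoc_invD.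
- by rewrite tpureDl.
- rewrite tassoc_pure tassoc_inv_pure -tpureZ tens_scale_pure.
  by congr (tpure _ (tpure _ _ _) _); exact: (mulr1 (s : S)).
Qed.
Lemma tassoc_invK : cancel tassoc_inv tassoc.
Proof.
apply: tens_ext => [x y|//|m n]; first by rewrite tassoc_invD tassocD.
by rewrite tassoc_inv_pure tassoc_pure rmorph1 scale1r.
Qed.
End TensorAssoc.

(** * Base change of flatness, and products of finite spaces *)

Lemma flat_comp (R S T : comPzRingType) (phi : {rmorphism R -> S})
    (psi : {rmorphism S -> T}) (chi : {rmorphism R -> T}) :
  (forall a, chi a = psi (phi a)) -> flat phi -> flat psi -> flat chi.
Proof.
move=> hchi f1 f2 M M' u iu x y e.
apply: (can_inj (@tassoc_invK _ _ _ phi psi chi hchi M T^o)).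
apply: (f2 _ _ _ (f1 _ _ _ iu)).
have h z : tmapl psi (tmapl phi u (idfun : {linear S^o -> S^o}))
    (idfun : {linear T^o -> T^o}) (tassoc_inv phi psi z) =
    tassoc_inv phi psi (tmapl chi u (idfun : {linear T^o -> T^o}) z).
  move: z; apply: tens_ext => [a b|a b|m n]; last first.
  - by rewrite tassoc_inv_pure // !tmapl_pure tassoc_inv_pure.
  - by rewrite linearD tassoc_invD.
  - by rewrite tassoc_invD // linearD.
by rewrite !h e.
Qed.

(* sigma witnesses that S' is the pushout of R' and S over R *)
Section Pushout.
Variables (R S R' S' : comPzRingType).
Variables (phi : {rmorphism R -> S}) (psi : {rmorphism R' -> S'}).
Variables (al : {rmorphism R -> R'}) (be : {rmorphism S -> S'}).
Hypothesis sq : forall a, be (phi a) = psi (al a).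
Variable sigma : forall N : lmodType R', N -> S' -> tens phi (rscal al N) S^o.
Hypothesis sigmaDl : forall N n n' s, @sigma N (n + n') s = sigma n s + sigma n' s.
Hypothesis sigmaDr : forall N n s s', @sigma N n (s + s') = sigma n s + sigma n s'.
Hypothesis sigmaZ : forall N a n s, @sigma N (a *: n) s = sigma n (psi a * s).
Hypothesis sigmaE : forall N n s, @sigma N n (be s) = tpure phi (n : rscal al N) (s : S^o).
Hypothesis gen : forall P : S' -> Prop, (forall a s, P (psi a * be s)) -> P 0 ->
  (forall x y, P x -> P y -> P (x + y)) -> forall x, P x.

Definition pushout_map (N : lmodType R') : tens phi (rscal al N) S^o -> tens psi N S'^o :=
  tmap phi psi (fun n : rscal al N => n : N) (be : S^o -> S'^o).
Fact pushout_semi1 (N : lmodType R') : semilinear al (fun n : rscal al N => n : N).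
Proof. by []. Qed.
Fact pushout_semi2 : semilinear be (be : S^o -> S'^o).
Proof. by move=> a u v; rewrite rmorphD rmorphM. Qed.
Lemma pushout_mapD (N : lmodType R') : {morph @pushout_map N : x y / x + y}.
Proof. exact: (tmapD (alpha := al) (beta := be) sq (@pushout_semi1 N) pushout_semi2). Qed.
Lemma pushout_map_pure (N : lmodType R') (n : N) s :
  pushout_map (tpure phi (n : rscal al N) (s : S^o)) = tpure psi n (be s : S'^o).
Proof. exact: (tmap_pure (alpha := al) (beta := be) sq (@pushout_semi1 N) pushout_semi2). Qed.

(** [sigma] is a balanced pairing and induces the left inverse. Surjectivity comes from [gen], so
    that S' never has to be identified with a tensor product of rings. *)
Lemma pushout_map_inj (N : lmodType R') : injective (@pushout_map N).
Proof.
have hb : balanced psi (fun (n : N) (s : S'^o) => sigma n s).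
  by split=> *; [apply: sigmaDl|apply: sigmaDr|apply: sigmaZ].
apply: (can_inj (g := fun x => tlift (fun (n : N) (s : S'^o) => sigma n s) x)).
apply: tens_ext => [x y|//|m s]; first by rewrite pushout_mapD (tliftD hb).
by rewrite pushout_map_pure tlift_pure // sigmaE.
Qed.
Lemma pushout_map_surj (N : lmodType R') y : exists x, @pushout_map N x = y.
Proof.
elim/tens_ind: y => [n s||x y [a <-] [b <-]]; last 2 first.
- by exists 0; apply: (morphD0 (@pushout_mapD N)).
- by exists (a + b); rewrite pushout_mapD.
move: s; apply: gen => [a s||s t [x hx] [y hy]].
- exists (tpure phi (a *: n : rscal al N) (s : S^o)).
  by rewrite pushout_map_pure tpureZ.
- by exists 0; rewrite (morphD0 (@pushout_mapD N)) tpure0r.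
- by exists (x + y); rewrite pushout_mapD hx hy -tpureDr.
Qed.
(** For modules restricted along [al], tensoring with S over R is tensoring with S' over R'; the
    injectivity of [u] is thus tested along [phi]. *)
Lemma pushout_flat : flat phi -> flat psi.
Proof.
move=> fl M M' u iu.
apply: morphD_inj => [x y|x]; first by rewrite linearD.
have [{}x <-] := pushout_map_surj x.
have ul : linear (fun n : rscal al M => u n : rscal al M').
  by move=> a s t; rewrite linearD /= linearZ.
have h z : tmapl psi u (idfun : {linear S'^o -> S'^o}) (pushout_map z) =
    pushout_map (tmapl phi (mklin ul) (idfun : {linear S^o -> S^o}) z).
  move: z; apply: tens_ext => [a b|a b|m n]; last first.
  - by rewrite pushout_map_pure !tmapl_pure pushout_map_pure.
  - by rewrite linearD pushout_mapD.
  - by rewrite pushout_mapD linearD.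
rewrite h -(morphD0 (@pushout_mapD M')) => /pushout_map_inj.
move=> /(flat_inj fl (u := mklin ul)) => ->; last first.
  by move=> z hz; apply: iu; rewrite linear0.
exact: (morphD0 (@pushout_mapD M)).
Qed.
End Pushout.

Section ProductPushout.
Variables (k A B A' : comPzRingType).
Variables (al : {rmorphism k -> A}) (be : {rmorphism k -> B}) (al' : {rmorphism k -> A'}).
Variable (u : {rmorphism A -> A'}).
Hypothesis hu : forall c, u (al c) = al' c.

Variable psi : {rmorphism tensalg al be -> tensalg al' be}.
Hypothesis psiE : forall a b, psi (tapure al be a b) = tapure al' be (u a) b.

(** The pairing sends n and a (x) b to (1 (x) b) n tensored with a. It inverts the canonical map
    from N (x)_A A' to the tensor product of N with A' (x) B over A (x) B. *)
Definition sigma_l (N : lmodType (tensalg al be)) (n : N) (y : tensalg al' be) :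
    tens u (rscal (tainl al be) N) A'^o :=
  tlift (fun (a : rscal al' A'^o) (b : B^o) =>
    tpure u (tainr al be b *: n : rscal (tainl al be) N) (a : A'^o)) y.
Fact sigma_l_bal (N : lmodType (tensalg al be)) (n : N) :
  balanced be (fun (a : rscal al' A'^o) (b : B^o) =>
    tpure u (tainr al be b *: n : rscal (tainl al be) N) (a : A'^o)).
Proof.
split=> [a a' b|a b b'|c a b]; first exact: tpureDr.
  by rewrite rmorphD scalerDl; apply: tpureDl.
rewrite -[c *: a]/(al' c * (a : A')) -hu -[u _ * a]/(u (al c) *: (a : A'^o)) -tpureZ.
congr (tpure _ _ _); rewrite -[LHS]/(tainl al be (al c) *: (tainr al be b *: n)).
by rewrite scalerA tainlr -rmorphM.
Qed.
Lemma flat_tensl : flat u -> flat psi.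
Proof.
have P N n a b : @sigma_l N n (tapure al' be a b) =
    tpure u (tainr al be b *: n : rscal (tainl al be) N) (a : A'^o).
  exact: tlift_pure (sigma_l_bal n).
have D N n : {morph @sigma_l N n : x y / x + y} by exact: tliftD (sigma_l_bal n).
apply: (@pushout_flat _ _ _ _ u psi (tainl al be) (tainl al' be) _ sigma_l).
- by move=> a; rewrite /= psiE.
- move=> N n n' y; elim/tensalg_ind: y => [a b||x y hx hy].
  + by rewrite !P scalerDr; apply: tpureDl.
  + by rewrite !(morphD0 (D _ _)) addr0.
  + by rewrite !D hx hy addrACA.
- by move=> N n; apply: D.
- move=> N z n y; elim/tensalg_ind: y => [a b||x y hx hy]; last 2 first.
  + by rewrite mulr0 !(morphD0 (D _ _)).
  + by rewrite mulrDr !D hx hy.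
  elim/tensalg_ind: z => [a' b'||x y hx hy].
  + rewrite psiE -tapureM !P -[u a' * a]/(u a' *: (a : A'^o)) -tpureZ.
    congr (tpure _ _ _); rewrite -[RHS]/(tainl al be a' *: (tainr al be (b' * b) *: n)).
    by rewrite !scalerA /tainl /tainr -!tapureM !mul1r !mulr1 [b * _]mulrC.
  + by rewrite scale0r rmorph0 mul0r (morphD0 (D N n)) P scaler0; apply: tpure0l.
  + by rewrite scalerDl rmorphD mulrDl D -hx -hy !P scalerDr; apply: tpureDl.
- by move=> N n a; rewrite /tainl P rmorph1 scale1r.
- move=> Q h1 h0 hD; apply: tensalg_ind => // a b.
  by have := h1 (tainr al be b) a; rewrite /= psiE rmorph1 /tainl -tapureM mul1r mulr1.
Qed.
End ProductPushout.

Section ProductPushoutRight.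
Variables (k A B B' : comPzRingType).
Variables (al : {rmorphism k -> A}) (be : {rmorphism k -> B}) (be' : {rmorphism k -> B'}).
Variable (v : {rmorphism B -> B'}).
Hypothesis hv : forall c, v (be c) = be' c.
Variable psi : {rmorphism tensalg al be -> tensalg al be'}.
Hypothesis psiE : forall a b, psi (tapure al be a b) = tapure al be' a (v b).

Definition sigma_r (N : lmodType (tensalg al be)) (n : N) (y : tensalg al be') :
    tens v (rscal (tainr al be) N) B'^o :=
  tlift (fun (a : rscal al A^o) (b : B'^o) =>
    tpure v (tainl al be a *: n : rscal (tainr al be) N) (b : B'^o)) y.
Fact sigma_r_bal (N : lmodType (tensalg al be)) (n : N) :
  balanced be' (fun (a : rscal al A^o) (b : B'^o) =>
    tpure v (tainl al be a *: n : rscal (tainr al be) N) (b : B'^o)).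
Proof.
split=> [a a' b|a b b'|c a b].
- by rewrite rmorphD scalerDl; apply: tpureDl.
- exact: tpureDr.
rewrite -hv -tpureZ; congr (tpure _ _ _).
have E : tainl al be (al c * a) = tainr al be (be c) * tainl al be a by rewrite rmorphM /= tainlr.
by rewrite -[LHS]/(tainl al be (al c * a) *: n) E -scalerA.
Qed.
Fact sigma_r_pure N n a b : @sigma_r N n (tapure al be' a b) =
    tpure v (tainl al be a *: n : rscal (tainr al be) N) (b : B'^o).
Proof. exact: tlift_pure (sigma_r_bal n). Qed.
Fact sigma_rD N n : {morph @sigma_r N n : x y / x + y}.
Proof. exact: tliftD (sigma_r_bal n). Qed.
Fact sigma_r_sq a : tainr al be' (v a) = psi (tainr al be a).
Proof. by rewrite psiE. Qed.
Fact sigma_rDl N n n' y : @sigma_r N (n + n') y = sigma_r n y + sigma_r n' y.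
Proof.
elim/tensalg_ind: y => [a b||x y hx hy].
- by rewrite !sigma_r_pure scalerDr; apply: tpureDl.
- by rewrite !(morphD0 (@sigma_rD _ _)) ?addr0.
- by rewrite !sigma_rD hx hy addrACA.
Qed.
Fact sigma_rZ N z n y : @sigma_r N (z *: n) y = sigma_r n (psi z * y).
Proof.
elim/tensalg_ind: y => [a b||x y hx hy]; last 2 first.
- by rewrite mulr0 !(morphD0 (@sigma_rD _ _)).
- by rewrite mulrDr !sigma_rD hx hy.
elim/tensalg_ind: z => [a' b'||x y hx hy].
- rewrite psiE -tapureM !sigma_r_pure -[v b' * b]/(v b' *: (b : B'^o)) -tpureZ.
  congr (tpure _ _ _); rewrite -[RHS]/(tainr al be b' *: (tainl al be (a' * a) *: n)).
  by rewrite !scalerA /tainl /tainr -!tapureM !mul1r !mulr1 [a * _]mulrC.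
- rewrite scale0r rmorph0 mul0r (morphD0 (@sigma_rD N n)) sigma_r_pure scaler0.
  exact: tpure0l.
- by rewrite scalerDl rmorphD mulrDl sigma_rD -hx -hy !sigma_r_pure scalerDr; apply: tpureDl.
Qed.
Fact sigma_rE N n b :
  @sigma_r N n (tainr al be' b) = tpure v (n : rscal (tainr al be) N) (b : B'^o).
Proof. by rewrite /tainr sigma_r_pure rmorph1 scale1r. Qed.
Fact sigma_r_gen (P : tensalg al be' -> Prop) :
  (forall a s, P (psi a * tainr al be' s)) -> P 0 ->
  (forall x y, P x -> P y -> P (x + y)) -> forall x, P x.
Proof.
move=> h1 h0 hD; apply: tensalg_ind => // a b.
by have := h1 (tainl al be a) b; rewrite /= psiE rmorph1 /tainr -tapureM mul1r mulr1.
Qed.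
Lemma flat_tensr : flat v -> flat psi.
Proof.
exact: (pushout_flat sigma_r_sq sigma_rDl sigma_rD sigma_rZ sigma_rE sigma_r_gen).
Qed.
Lemma tensr_map_inj (N : lmodType (tensalg al be)) :
  injective (@pushout_map _ _ _ _ v psi (tainr al be) (tainr al be') N).
Proof. exact: (pushout_map_inj sigma_r_sq sigma_rDl sigma_rD sigma_rZ sigma_rE). Qed.
Lemma tensr_map_surj (N : lmodType (tensalg al be)) y :
  exists x, @pushout_map _ _ _ _ v psi (tainr al be) (tainr al be') N x = y.
Proof. exact: (pushout_map_surj sigma_r_sq sigma_r_gen). Qed.
End ProductPushoutRight.

(** A restriction u (x) v is u (x) 1 followed by 1 (x) v, and each factor is the base change of a
    flat restriction. *)
Lemma prod_space_finite (k : comPzRingType) (X Y : ringed_finite_space k) :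
  finite_space X -> finite_space Y -> finite_space (prod_space X Y).
Proof.
move=> fX fY p q h.
set u := rs_res (spec_fst h); set v := rs_res (spec_snd h).
pose hid c : (idfun : {rmorphism rs_O p.2 -> rs_O p.2}) (rs_str p.2 c) = rs_str p.2 c := erefl.
pose hid' c : (idfun : {rmorphism rs_O q.1 -> rs_O q.1}) (rs_str q.1 c) = rs_str q.1 c := erefl.
pose f1 := tamap (rs_str_res (spec_fst h)) hid.
pose f2 := tamap hid' (rs_str_res (spec_snd h)).
apply: (@flat_comp _ _ _ f1 f2).
- apply: tensalg_ind => [a b||x y hx hy].
  + by rewrite [LHS]tamapE [f1 _]tamapE [RHS]tamapE.
  + by rewrite !rmorph0.
  + by rewrite !rmorphD hx hy.
- apply: (flat_tensl (u := u)); [exact: rs_str_res|exact: tamapE|exact: fX].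
- apply: (flat_tensr (v := v)); [exact: rs_str_res|exact: tamapE|exact: fY].
Qed.

(** * Base change of homology along a flat ring morphism *)

Lemma inj_surj_bij (A B : Type) (f : A -> B) :
  injective f -> (forall y, exists x, f x = y) -> bijective f.
Proof. by move=> fi /choice[g hg]; exists g => // x; apply: fi; rewrite hg. Qed.

Lemma bij_surj (A B : Type) (f : A -> B) : bijective f -> forall y, exists x, f x = y.
Proof. by move=> [g _ gK] y; exists (g y). Qed.

Section BaseChangeMap.
Variables (R S : comPzRingType) (phi : {rmorphism R -> S}).
Variables (N : lmodType R) (N' : lmodType S) (r : N -> N').
Hypothesis hr : semilinear phi r.
Definition bcmap_fun of semilinear phi r : tens phi N S^o -> N' :=
  tlift (fun (m : N) (b : S^o) => (b : S) *: r m).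
Fact bcmap_bal : balanced phi (fun (m : N) (b : S^o) => (b : S) *: r m).
Proof.
split=> [m m' b|m b b'|a m b].
- by rewrite (semilinD hr) scalerDr.
- by rewrite scalerDl.
- by rewrite (semilinZ hr) scalerA mulrC.
Qed.
Fact bcmap_pure_fun m (b : S^o) : bcmap_fun hr (tpure phi m b) = (b : S) *: r m.
Proof. exact: tlift_pure bcmap_bal. Qed.
Fact bcmap_lin : linear (bcmap_fun hr).
Proof.
move=> a x y; rewrite [LHS](tliftD bcmap_bal); congr (_ + _).
move: x; apply: tens_ext => [x y'|x y'|m b].
- by rewrite scalerDr [LHS](tliftD bcmap_bal).
- by rewrite [bcmap_fun hr _](tliftD bcmap_bal) scalerDr.
- by rewrite tens_scale_pure [LHS]bcmap_pure_fun bcmap_pure_fun scalerA.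
Qed.
Definition bcmap : {linear tens phi N S^o -> N'} := mklin bcmap_lin.
Lemma bcmap_pure m (b : S^o) : bcmap (tpure phi m b) = (b : S) *: r m.
Proof. exact: bcmap_pure_fun. Qed.
End BaseChangeMap.

Section HClass.
Variables (R : comPzRingType) (A B C : lmodType R).
Variables (d1 : {linear A -> B}) (d2 : {linear B -> C}).
Let hc : {linear subm (hker d2) -> homol d1 d2} := mklin (@hclass_linear _ _ _ _ d1 d2).
Lemma hclassD z w : hclass d1 (z + w) = hclass d1 z + hclass d1 (w : subm (hker d2)).
Proof. exact: (linearD hc). Qed.
Lemma hclassZ a z : hclass d1 (a *: z : subm (hker d2)) = a *: hclass d1 z.
Proof. exact: (linearZ_LR hc). Qed.
Lemma hclass0 : hclass d1 (0 : subm (hker d2)) = 0.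
Proof. exact: (linear0 hc). Qed.
Lemma hclass_eq0 (z : subm (hker d2)) : hclass d1 z = 0 <-> exists a, d1 a = val z.
Proof. by rewrite -hclass0 hclass_eq /= subr0. Qed.
End HClass.

Section HomologyBaseChange.
Variables (R S : comPzRingType) (phi : {rmorphism R -> S}).
Variables (A B C : lmodType R) (d1 : {linear A -> B}) (d2 : {linear B -> C}).
Variables (A' B' C' : lmodType S) (d1' : {linear A' -> B'}) (d2' : {linear B' -> C'}).
Variables (r1 : A -> A') (r : B -> B') (r2 : C -> C').
Hypotheses (h1 : semilinear phi r1) (h : semilinear phi r) (h2 : semilinear phi r2).
Hypothesis sq1 : forall x, d1' (r1 x) = r (d1 x).
Hypothesis sq2 : forall x, d2' (r x) = r2 (d2 x).
Hypothesis dd : forall x, d2 (d1 x) = 0.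
Local Notation e1 := (tmapl phi d1 (idfun : {linear S^o -> S^o})).
Local Notation e2 := (tmapl phi d2 (idfun : {linear S^o -> S^o})).
Definition tens1 (V : lmodType R) (x : V) : tens phi V S^o := tpure phi x (1 : S^o).
Fact tens1_lin (V : lmodType R) : semilinear phi (@tens1 V).
Proof.
move=> a x y; rewrite /tens1 tpureDl tpureZ /=.
by rewrite tens_scale_pure.
Qed.
Fact tens1_sq (V W : lmodType R) (u : {linear V -> W}) x :
  tmapl phi u (idfun : {linear S^o -> S^o}) (tens1 x) = tens1 (u x).
Proof. exact: tmapl_pure. Qed.

Definition kap_sl : semilinear phi (hmap d1 d2 e1 e2 (@tens1 B)) :=
  hmap_semilinear (@tens1_lin B) (@tens1_lin C) (tens1_sq d1) (tens1_sq d2).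
(** The canonical map from the tensored homology to the homology of the tensored complex. *)
Definition kap : {linear tens phi (homol d1 d2) S^o -> homol e1 e2} := bcmap kap_sl.

Let i_lin : linear (val : subm (hker d2) -> B). Proof. by []. Qed.
Let i : {linear subm (hker d2) -> B} := mklin i_lin.
Let i1 := tmapl phi i (idfun : {linear S^o -> S^o}).
Let p : {linear subm (hker d2) -> homol d1 d2} := mklin (@hclass_linear _ _ _ _ d1 d2).
Let p1 := tmapl phi p (idfun : {linear S^o -> S^o}).

Fact i1_ker x : hker e2 (i1 x).
Proof.
rewrite /= /hker_mem; move: x; apply: tens_ext => [x y|x y|m n].
- by rewrite !linearD.
- by rewrite addr0.
- by rewrite !tmapl_pure -[i m]/(val m) (submP m) tpure0l.
Qed.
Fact kap_p x : kap (p1 x) = hclass e1 (mksubm (i1_ker x)).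
Proof.
move: x; apply: tens_ext => [x y|x y|m n].
- by rewrite !linearD.
- by rewrite -hclassD; congr (hclass e1 _); apply: val_inj; rewrite /= linearD.
- rewrite tmapl_pure [LHS]bcmap_pure.
  pose w : subm (hker e2) := mksubm (i1_ker (tpure phi m (1 : S^o))).
  rewrite (hmapE (@tens1_lin B) (@tens1_lin C) (tens1_sq d1) (tens1_sq d2) (z' := w)) /=;
    last by rewrite /i1 tmapl_pure.
  rewrite -hclassZ; congr (hclass e1 _); apply: val_inj; rewrite /= /i1 !tmapl_pure tens_scale_pure.
  by congr (tpure _ _ _); exact: (mulr1 (n : S)).
Qed.

Hypothesis fl : flat phi.
(** By exactness of the tensor product with S, the cycles of the tensored complex are the tensored
    cycles, and likewise for boundaries. *)
Lemma kap_bij : bijective kap.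
Proof.
have hp1 := @tens_surj _ _ phi _ _ S^o p _.
have ps y : exists x, p1 x = y.
  by apply: hp1 => z; elim/homol_ind: z => z; exists z.
apply: inj_surj_bij.
  apply: morphD_inj => [x y|y]; first exact: linearD.
  have [x <-] := ps y; rewrite kap_p.
  move=> /hclass_eq0[a ha].
  (* [d1] is corestricted to the cycles; as the tensored cycles embed into B (x) S, [x] is the image
     of [a] under the tensored corestriction, and its class vanishes. *)
  pose d1k a := mksubm (W := hker d2) (dd a).
  have dl : linear d1k by move=> c s t; apply: val_inj; exact: (linearP d1).
  pose D := tmapl phi (mklin dl) (idfun : {linear S^o -> S^o}).
  have -> : x = D a.
    apply/eqP; rewrite -subr_eq0; apply/eqP.
    apply: (flat_inj fl (u := i)) => [z hz|]; first exact: val_inj.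
    rewrite linearB; apply/eqP; rewrite subr_eq0; apply/eqP; rewrite -[LHS]ha.
    by apply/esym; apply: tmapl_comp.
  move: a {ha}; apply: tens_ext => [s t|s t|s t]; first by rewrite !linearD.
    by rewrite addr0.
  rewrite /D /p1 !tmapl_pure [p _](_ : _ = 0) ?tpure0l //.
  by apply/hclass_eq0; exists s.
elim/homol_ind => z.
have [x hx] := flat_exact fl (u := i) (v := d2)
  (fun y hy => ex_intro _ (mksubm (W := hker d2) hy) erefl) (submP z).
exists (p1 x); rewrite kap_p; congr (hclass e1 _); exact: val_inj.
Qed.

Definition hmap_sl : semilinear phi (hmap d1 d2 d1' d2' r) := hmap_semilinear h h2 sq1 sq2.

Lemma bc_sq (V W : lmodType R) (V' W' : lmodType S) (u : {linear V -> W})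
    (u' : {linear V' -> W'}) (s : V -> V') (t : W -> W') (hs : semilinear phi s)
    (ht : semilinear phi t) : (forall x, u' (s x) = t (u x)) ->
  forall x, u' (bcmap hs x) = bcmap ht (tmapl phi u (idfun : {linear S^o -> S^o}) x).
Proof.
move=> e; apply: tens_ext => [x y|x y|m n]; try by rewrite !linearD.
by rewrite tmapl_pure !bcmap_pure linearZ /= e.
Qed.

Lemma lin_semilin (V W : lmodType S) (u : {linear V -> W}) :
  semilinear (idfun : {rmorphism S -> S}) u.
Proof. by move=> a x y; rewrite linearP. Qed.

Lemma hmap_kap x :
  hmap e1 e2 d1' d2' (bcmap h) (kap x) = bcmap hmap_sl x.
Proof.
have L : semilinear (idfun : {rmorphism S -> S}) (hmap e1 e2 d1' d2' (bcmap h)).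
  exact: (hmap_semilinear (lin_semilin (bcmap h)) (lin_semilin (bcmap h2))
    (bc_sq h1 h sq1) (bc_sq h h2 sq2)).
move: x; apply: tens_ext => [x y|x y|m b].
- by rewrite linearD (semilinD L).
- by rewrite linearD.
rewrite !bcmap_pure [LHS](semilinZ L) /=; congr (_ *: _).
elim/homol_ind: m => z.
pose w : subm (hker e2) := mksubm (i1_ker (tpure phi z (1 : S^o))).
rewrite (hmapE (@tens1_lin B) (@tens1_lin C) (tens1_sq d1) (tens1_sq d2) (z' := w)) /=; last first.
  by rewrite /i1 tmapl_pure.
have zk : hker d2' (r (val z)).
  by rewrite /= /hker_mem sq2 (submP z) (semilin0 h2).
rewrite (hmapE h h2 sq1 sq2 (z' := mksubm zk)) //.
rewrite (hmapE (lin_semilin (bcmap h)) (lin_semilin (bcmap h2))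
    (bc_sq h1 h sq1) (bc_sq h h2 sq2) (z' := mksubm zk)) //=.
by rewrite /i1 tmapl_pure -[RHS]/(bcmap h _) bcmap_pure scale1r.
Qed.

(** By [hmap_kap], base change on homology is the bijection [kap] followed by the map that the base
    change of the complex induces on homology. *)
Lemma homol_bc : bijective (bcmap hmap_sl) <-> bijective (hmap e1 e2 d1' d2' (bcmap h)).
Proof.
have e : bcmap hmap_sl =1 hmap e1 e2 d1' d2' (bcmap h) \o kap.
  by move=> x; rewrite -hmap_kap.
have [g gK Kg] := kap_bij.
split=> hb.
  apply: (eq_bij (f := bcmap hmap_sl \o g)) => [|x]; last by rewrite /= -hmap_kap Kg.
  by apply: bij_comp => //; exists kap.
by apply: (eq_bij (bij_comp hb kap_bij)) => x; rewrite -e.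
Qed.
End HomologyBaseChange.

(** * Quasi-isomorphisms *)

(* Acyclicity of the mapping cone of f, in terms of elements *)
Definition qis (A A' : int -> zmodType) (dA : forall i j, A i -> A j)
    (dA' : forall i j, A' i -> A' j) (f : forall i, A i -> A' i) :=
  forall i j l m : int, j = i + 1 -> l = j + 1 -> m = l + 1 ->
  forall (x : A l) (x' : A' j), dA l m x = 0 -> dA' j l x' = f l x ->
  exists (y : A j) (y' : A' i), dA j l y = x /\ f j y = x' + dA' i j y'.
Arguments qis {A A'} dA dA' f.

Section QisHomology.
Variables (R R' : comPzRingType) (alpha : {rmorphism R -> R'}).
Variables (A : int -> lmodType R) (A' : int -> lmodType R').
Variables (dA : forall i j, {linear A i -> A j}) (dA' : forall i j, {linear A' i -> A' j}).
Variable f : forall i, A i -> A' i.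
Arguments f : clear implicits.
Hypothesis hf : forall i, semilinear alpha (f i).
Hypothesis sq : forall i j x, dA' i j (f i x) = f j (dA i j x).
Arguments hf : clear implicits.
Arguments sq : clear implicits.
Local Notation hm i j l := (hmap (dA i j) (dA j l) (dA' i j) (dA' j l) (f j)).

Lemma qis_hmap :
  (forall i, bijective (hm (i - 1) i (i + 1))) <->
  @qis A A' (fun i j => dA i j) (fun i j => dA' i j) f.
Proof.
have E i j l (z : subm (hker (dA j l))) (z' : subm (hker (dA' j l))) :
    val z' = f j (val z) -> hm i j l (hclass (dA i j) z) = hclass (dA' i j) z'.
  exact: (hmapE (hf j) (hf l) (sq i j) (sq j l)).
have L i j l : semilinear alpha (hm i j l).
  exact: (hmap_semilinear (hf j) (hf l) (sq i j) (sq j l)).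
split=> [hb i j l m ij jl lm x x' dx dx'|hq i].
  have {}hb a b c : b = a + 1 -> c = b + 1 -> bijective (hm a b c).
    move=> -> ->; have := hb (a + 1).
    by rewrite (_ : a + 1 - 1 = a) // addrK.
  have [y0 hy0] : exists y, dA j l y = x.
    have k1 : hker (dA l m) x by [].
    apply/(hclass_eq0 (dA j l) (mksubm k1)).
    apply: (bij_inj (hb j l m jl lm)).
    rewrite (semilin0 (L _ _ _)).
    have k2 : hker (dA' l m) (f l x) by rewrite /= /hker_mem sq dx (semilin0 (hf _)).
    by rewrite (E _ _ _ _ (mksubm k2)) //; apply/hclass_eq0; exists x'.
  (* The defect of [y0] is a cycle, so up to a boundary it is the image of a cycle [z], by which
     [y0] is corrected. *)
  have k3 : hker (dA' j l) (f j y0 - x').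
    by rewrite /= /hker_mem linearB sq hy0 dx' subrr.
  have [z hz] := bij_surj (hb i j l ij jl) (hclass (dA' i j) (mksubm k3)).
  move: hz; elim/homol_ind: z => z.
  have k4 : hker (dA' j l) (f j (val z)).
    by rewrite /= /hker_mem sq (submP z) (semilin0 (hf _)).
  rewrite (E _ _ _ _ (mksubm k4)) // => /hclass_eq[w /= hw].
  exists (y0 - val z), (- w); split.
    by rewrite linearB (submP z) subr0.
  rewrite (semilinB (hf _)) linearN /= [dA' i j w]hw opprB addrA [x' + _]addrC subrK.
  by [].
have ei : i = i - 1 + 1 by rewrite subrK.
apply: inj_surj_bij.
  apply: morphD_inj => [x y|x]; first exact: (semilinD (L _ _ _)).
  elim/homol_ind: x => z.
  have k4 : hker (dA' i (i + 1)) (f i (val z)).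
    by rewrite /= /hker_mem sq (submP z) (semilin0 (hf _)).
  rewrite (E _ _ _ _ (mksubm k4)) // => /hclass_eq0[w /= hw].
  have ei' : i - 1 = i - 1 - 1 + 1 by rewrite subrK.
  have [y [_ [hy _]]] := hq _ _ _ _ ei' ei erefl (val z) w (submP z) hw.
  by apply/hclass_eq0; exists y.
elim/homol_ind => z'.
have [y [y' [hy hy']]] := hq _ _ _ _ ei erefl erefl (0 : A (i + 1)) (val z')
   (linear0 _) (etrans (submP z') (esym (semilin0 (hf _)))).
exists (hclass (dA (i - 1) i) (mksubm (W := hker (dA i (i + 1))) hy)).
have k4 : hker (dA' i (i + 1)) (f i y).
  by rewrite /= /hker_mem sq hy (semilin0 (hf _)).
rewrite (E _ _ _ _ (mksubm k4)) //; apply/hclass_eq; exists y'.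
by rewrite /= hy' [X in _ = X - _]addrC addrK.
Qed.
End QisHomology.

Section QuasiIso.
Variables (k : comPzRingType) (X : ringed_finite_space k).

Lemma quasi_isoP (M N : complex X) (f : chain_map M N) :
  quasi_iso f <-> forall p : X, @qis (fun i => M i p) (fun i => N i p)
    (fun i j => cx_d M i j p) (fun i j => cx_d N i j p) (fun i => f i p).
Proof.
have Q p := @qis_hmap _ _ idfun (fun i => M i p) (fun i => N i p)
  (fun i j => cx_d M i j p) (fun i j => cx_d N i j p) (fun i => f i p)
  (fun i => lin_semilin (f i p)) (fun i j x => @cm_d _ _ _ _ f i j p x).
split=> [h p|h i p]; first by apply: (proj1 (Q p)) => i; apply: h.
exact: (proj2 (Q p) (h p)).
Qed.

Lemma acyclicP (M : complex X) :
  acyclic M <-> forall (p : X) (i j l : int), j = i + 1 -> l = j + 1 ->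
    forall x : M j p, cx_d M j l p x = 0 -> exists y, cx_d M i j p y = x.
Proof.
split=> [h p i j l -> -> x hx|h i p x].
  have : i + 1 - 1 = i by rewrite addrK.
  have := h (i + 1) p; rewrite /= /coh_st => {}h e; rewrite e in h.
  exact/(hclass_eq0 _ (mksubm (W := hker (cx_d M (i + 1) (i + 1 + 1) p)) hx))/h.
elim/homol_ind: x => z; apply/hclass_eq0.
by apply: (h p _ _ (i + 1)); rewrite ?subrK //; exact: (submP z).
Qed.
End QuasiIso.

(** * Direct sums and free modules *)

Lemma big_uniq_support (V : zmodType) (I : eqType) (s1 s2 : seq I) (f : I -> V) :
  uniq s1 -> uniq s2 -> {subset s1 <= s2} -> (forall i, i \notin s1 -> f i = 0) ->
  \sum_(i <- s2) f i = \sum_(i <- s1) f i.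
Proof.
move=> u1 u2 s12 f0.
rewrite (bigID (mem s1)) /= addrC big1 ?add0r; last by move=> i /f0.
rewrite -big_filter; apply: perm_big; apply: uniq_perm; rewrite ?filter_uniq //.
by move=> i; rewrite mem_filter; case h: (i \in s1); rewrite // (s12 _ h).
Qed.

(* T is the direct sum of the A s, through the coordinates c and injections e *)
Record decomp (T : zmodType) (S : choiceType) (v : S -> Prop) (A : S -> zmodType)
    (c : forall s, T -> A s) (e : forall s, A s -> T) : Prop := Decomp {
  dc_add : forall s, {morph c s : x y / x + y};
  de_add : forall s, {morph @e s : x y / x + y};
  dc_e : forall s a, v s -> c s (e s a) = a;
  dc_e0 : forall s s' a, s != s' -> c s (e s' a) = 0;
  dc_span : forall P : T -> Prop, P 0 -> (forall x y, P x -> P y -> P (x + y)) ->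
    (forall s a, v s -> P (e s a)) -> forall x, P x }.
Arguments decomp {T S} v {A} c e.

Section Decomposition.
Variables (T : zmodType) (S : choiceType) (v : S -> Prop) (A : S -> zmodType).
Variables (c : forall s, T -> A s) (e : forall s, A s -> T).
Arguments c : clear implicits.
Hypothesis h : decomp v c e.

(** The formula is stated for every larger list, so that the supports of two elements can be
    merged. *)
Lemma decomp_sum x : exists2 L : seq S, uniq L & forall L', uniq L' -> {subset L <= L'} ->
  x = \sum_(s <- L') e (c s x).
Proof.
move: x; apply: (dc_span h) => [|x y [L1 u1 h1] [L2 u2 h2]|s a vs].
- exists [::] => // L' _ _; rewrite big1 // => s _.
  by rewrite (morphD0 (dc_add h s)) (morphD0 (@de_add _ _ _ _ _ _ h s)).
- exists (undup (L1 ++ L2)); rewrite ?undup_uniq // => L' uL sL.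
  have s1 : {subset L1 <= L'} by move=> i hi; apply: sL; rewrite mem_undup mem_cat hi.
  have s2 : {subset L2 <= L'} by move=> i hi; apply: sL; rewrite mem_undup mem_cat hi orbT.
  rewrite {1}(h1 _ uL s1) {1}(h2 _ uL s2) -big_split; apply: eq_bigr => s _.
  by rewrite (dc_add h s) (de_add h).
- exists [:: s] => // L' uL sL.
  rewrite (big_uniq_support (s1 := [:: s])) // ?big_seq1 ?(dc_e h) //.
  move=> i; rewrite inE => i_s; rewrite (dc_e0 h) //.
  exact: (morphD0 (@de_add _ _ _ _ _ _ h i)).
Qed.

Lemma decomp_inj x : (forall s, c s x = 0) -> x = 0.
Proof.
move=> h0; have [L uL hL] := decomp_sum x; rewrite (hL L) //.
by rewrite big1 // => s _; rewrite h0 (morphD0 (@de_add _ _ _ _ _ _ h s)).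
Qed.

Lemma decomp_supp x : exists2 L : seq S, uniq L & forall s, s \notin L -> c s x = 0.
Proof.
have [L uL hL] := decomp_sum x; exists L => // s sL.
rewrite (hL L) // (morphD_sum _ _ (dc_add h s)) big_seq big1 // => s' hs'.
by rewrite (dc_e0 h) //; apply: contraNneq sL => ->.
Qed.

End Decomposition.

Section FreeModule.
Variables (R : comPzRingType) (I : choiceType) (Pd : I -> Prop).
(** One index type serves for all points and degrees and only [Pd] varies: restriction maps then act
    coordinate by coordinate. Outside [Pd] the basis vector is 0. *)
Definition freem : lmodType R := dsum (fun _ : I => R^o) Pd.

Definition fco_fun (i : I) (x : freem) : R^o := subm_val x i.
Fact fco_lin i : linear (fco_fun i). Proof. by []. Qed.
Definition fco (i : I) : {linear freem -> R^o} := mklin (fco_lin i).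

Lemma fcoZ i (a : R) x : fco i (a *: x) = a * fco i x :> R.
Proof. by []. Qed.

Lemma fco_inj (x y : freem) : (forall i, fco i x = fco i y) -> x = y.
Proof. by move=> h; apply: val_inj; apply: functional_extensionality_dep. Qed.

Definition fbas_fun (i : I) : prodm (fun _ : I => R^o) :=
  fun j => if (i == j) && `[< Pd i >] then 1 else 0.
Fact fbas_supp i : finsupp_mem Pd (fbas_fun i).
Proof.
rewrite /finsupp_mem /fbas_fun; split.
  apply: (@sub_finite_set _ _ [set i]) => [j /=|]; last exact: finite_set1.
  by case: eqP => // ->.
by move=> j; case: eqP => // ->; case: asboolP.
Qed.
Definition fbas (i : I) : freem := mksubm (W := dsum_submod _ _) (fbas_supp i).

Fact fcoE i j : fco i (fbas j) = if (j == i) && `[< Pd j >] then 1 else 0.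
Proof. by []. Qed.
Lemma fco_bas i : Pd i -> fco i (fbas i) = 1.
Proof. by move=> h; rewrite fcoE eqxx; case: asboolP. Qed.
Lemma fco_bas0 i j : i != j -> fco i (fbas j) = 0.
Proof. by rewrite eq_sym fcoE => /negbTE ->. Qed.
Lemma fbas0 i : ~ Pd i -> fbas i = 0.
Proof.
move=> h; apply: fco_inj => j; rewrite linear0 fcoE.
by case: asboolP => // _; rewrite andbF.
Qed.
Lemma fco0 i x : ~ Pd i -> fco i x = 0.
Proof. by have [_ h] := submP x; move=> hi; apply: contrapT => /h. Qed.

Lemma freem_supp (x : freem) :
  exists2 L : seq I, uniq L & forall i, i \notin L -> fco i x = 0.
Proof.
have [/finite_seqP[s hs] _] := submP x; exists (undup s); first exact: undup_uniq.
move=> i; rewrite mem_undup => his; apply: contrapT => hi.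
have : [set i | subm_val x i <> 0] i by [].
by rewrite hs /= (negbTE his).
Qed.

Lemma freem_sum (x : freem) (L : seq I) : uniq L -> (forall i, i \notin L -> fco i x = 0) ->
  x = \sum_(i <- L) (fco i x : R) *: fbas i.
Proof.
move=> uL hL; apply: fco_inj => j; rewrite linear_sum.
have [jL|jL] := boolP (j \in L); last first.
  rewrite -[LHS]/(fco j x) hL // big_seq big1 // => i iL.
  by rewrite fcoZ fco_bas0 ?[LHS]mulr0 //; apply: contraNneq jL => ->.
rewrite (bigD1_seq j) //= big1 => [|i ij]; last first.
  by rewrite fcoZ fco_bas0 ?[LHS]mulr0 // eq_sym.
rewrite addr0 -[RHS]/(fco j (fco j x *: fbas j)).
have [h|h] := pselect (Pd j); last by rewrite !fco0.
by rewrite fcoZ fco_bas // [RHS]mulr1.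
Qed.

Lemma freem_ind (P : freem -> Prop) : P 0 -> (forall x y, P x -> P y -> P (x + y)) ->
  (forall i a, Pd i -> P (a *: fbas i)) -> forall x, P x.
Proof.
move=> h0 hD hb x; have [L uL hL] := freem_supp x; rewrite (freem_sum uL hL).
apply: big_ind => // i _; have [h|h] := pselect (Pd i); first exact: hb.
by rewrite fbas0 // scaler0.
Qed.

Section Extension.
Variables (V : lmodType R) (u : I -> V).
Definition fsupp (x : freem) : seq I := s2val (cid2 (freem_supp x)).
Definition fext_fun (x : freem) : V := \sum_(i <- fsupp x) (fco i x : R) *: u i.
Lemma fext_supp (x : freem) (L : seq I) : uniq L -> (forall i, i \notin L -> fco i x = 0) ->
  fext_fun x = \sum_(i <- L) (fco i x : R) *: u i.
Proof.
rewrite /fext_fun /fsupp; case: (cid2 _) => L' uL' hL' /= uL hL.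
pose L2 := undup (L ++ L').
have uL2 : uniq L2 by apply: undup_uniq.
rewrite -(big_uniq_support uL uL2) => [|i|i /hL ->]; last by rewrite scale0r.
  rewrite -(big_uniq_support uL' uL2) => [//|i|i /hL' ->]; last by rewrite scale0r.
  by rewrite mem_undup mem_cat => ->; rewrite orbT.
by rewrite mem_undup mem_cat => ->.
Qed.
Fact fext_lin : linear fext_fun.
Proof.
move=> a x y; have [L1 u1 h1] := freem_supp x; have [L2 u2 h2] := freem_supp y.
pose L := undup (L1 ++ L2).
have uL : uniq L by apply: undup_uniq.
have hx i : i \notin L -> fco i x = 0.
  by rewrite mem_undup mem_cat negb_or => /andP[/h1].
have hy i : i \notin L -> fco i y = 0.
  by rewrite mem_undup mem_cat negb_or => /andP[_ /h2].
rewrite (fext_supp uL hx) (fext_supp uL hy) (@fext_supp _ L) //; last first.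
  by move=> i iL; rewrite linearP hx // hy // scaler0 addr0.
rewrite scaler_sumr -big_split; apply: eq_bigr => i _ /=.
by rewrite scalerA -scalerDl.
Qed.
Definition fext : {linear freem -> V} := mklin fext_lin.
Lemma fext_bas i : Pd i -> fext (fbas i) = u i.
Proof.
move=> h; rewrite [LHS](@fext_supp _ [:: i]) // => [|j].
  by rewrite big_seq1 fco_bas // scale1r.
by rewrite inE => /fco_bas0.
Qed.
End Extension.

Lemma freem_ext (V : zmodType) (f g : freem -> V) : {morph f : x y / x + y} ->
  {morph g : x y / x + y} -> (forall i a, Pd i -> f (a *: fbas i) = g (a *: fbas i)) ->
  forall x, f x = g x.
Proof.
move=> hf hg h; apply: freem_ind => [|x y hx hy|//]; first by rewrite !morphD0.
by rewrite hf hg hx hy.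
Qed.

Section Tensored.
Variables (S : comPzRingType) (phi : {rmorphism R -> S}) (N : lmodType S).
Fact fcot_bal i : balanced phi (fun (m : freem) (n : N) => phi (fco i m) *: n).
Proof.
split=> [m m' n|m n n'|a m n]; first by rewrite linearD rmorphD scalerDl.
  by rewrite scalerDr.
by rewrite fcoZ rmorphM scalerA mulrC.
Qed.
Definition fcot_fun i : tens phi freem N -> N :=
  tlift (fun (m : freem) (n : N) => phi (fco i m) *: n).
Fact fcot_pure_fun i m n : fcot_fun i (tpure phi m n) = phi (fco i m) *: n.
Proof. exact: tlift_pure (fcot_bal i). Qed.
Fact fcot_lin i : linear (fcot_fun i).
Proof.
move=> a x y; rewrite [LHS](tliftD (fcot_bal i)); congr (_ + _).
move: x; apply: tens_ext => [x z|x z|m n].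
- by rewrite scalerDr [LHS](tliftD (fcot_bal i)).
- by rewrite [fcot_fun i (x + z)](tliftD (fcot_bal i)) scalerDr.
- by rewrite tens_scale_pure [LHS]fcot_pure_fun fcot_pure_fun !scalerA mulrC.
Qed.
Definition fcot i : {linear tens phi freem N -> N} := mklin (fcot_lin i).
Lemma fcot_pure i m n : fcot i (tpure phi m n) = phi (fco i m) *: n.
Proof. exact: fcot_pure_fun. Qed.

Lemma fcot_decomp :
  decomp Pd (A := fun _ => N) (fun i => fcot i) (fun i n => tpure phi (fbas i) n).
Proof.
split=> [i x y|i x y|i n hi|i j n ij|P P0 PD Pe].
- exact: linearD.
- exact: tpureDr.
- by rewrite fcot_pure fco_bas // rmorph1 scale1r.
- by rewrite fcot_pure fco_bas0 // rmorph0 scale0r.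
apply: tens_ind => // m n; move: m; apply: freem_ind => [|x y hx hy|i a hi].
- by rewrite tpure0l.
- by rewrite tpureDl; apply: PD.
- by rewrite tpureZ; apply: Pe.
Qed.
End Tensored.
End FreeModule.
Arguments fco {R I} Pd i.
Arguments fbas {R I} Pd i.
Arguments fext {R I} Pd {V} u.
Arguments fcot {R I} Pd {S} phi N i.

(** * Quasi-coherence as base change *)

Section QuasiCoherence.
Variables (k : comPzRingType) (X : ringed_finite_space k).

Definition bcm (M : omodule X) (p q : X) (h : spec p q) :
  {linear tens (rs_res h) (M p) (rs_O q)^o -> M q} := bcmap (om_res_lin (o := M) h).

Lemma bcm_nat (M N : omodule X) (p q : X) (h : spec p q) (u : {linear M p -> N p})
    (v : {linear M q -> N q}) : (forall m, om_res h (u m) = v (om_res h m)) ->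
  forall x, v (bcm M h x) = bcm N h (tmapl (rs_res h) u (idfun : {linear (rs_O q)^o -> _}) x).
Proof. by move=> e x; apply: bc_sq => m; rewrite e. Qed.

Lemma free_resE (I : choiceType) (p q : X) (h : spec p q) (i : I) (e : free_module X I p) :
  fco (fun=> True) i (om_res h e : free_module X I q) = rs_res h (fco (fun=> True) i e : rs_O p).
Proof. by []. Qed.
Lemma free_res_bas (I : choiceType) (p q : X) (h : spec p q) (i : I) :
  om_res h (fbas (fun=> True) i : free_module X I p) = (fbas (fun=> True) i : free_module X I q).
Proof.
apply: (fco_inj (Pd := fun=> True)) => j; rewrite free_resE !fcoE.
by case: ifP => _; rewrite ?rmorph1 ?rmorph0.
Qed.

Lemma bcm_free_bij (I : choiceType) (p q : X) (h : spec p q) :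
  bijective (bcm (free_module X I) h).
Proof.
apply: inj_surj_bij.
  apply: morphD_inj => [x y|x e]; first exact: linearD.
  apply: (decomp_inj (fcot_decomp (fun _ : I => True) (rs_res h) (rs_O q)^o)) => i.
  suff -> : fcot (fun=> True) (rs_res h) (rs_O q)^o i x =
      fco (fun=> True) i (bcm (free_module X I) h x).
    by rewrite e.
  move: x {e}; apply: tens_ext => [x y|x y|m b]; try by rewrite !linearD.
  by rewrite fcot_pure [bcm _ _ _]bcmap_pure fcoZ free_resE mulrC.
apply: freem_ind => [|x y [a <-] [b <-]|i a _].
- by exists 0; rewrite linear0.
- by exists (a + b); rewrite linearD.
- exists (tpure (rs_res h) (fbas (fun=> True) i : free_module X I p) (a : (rs_O q)^o)).
  by rewrite [LHS]bcmap_pure free_res_bas.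
Qed.

(** Near p, the stalks of M at p and q are presented by the same free modules, for which base change
    is bijective; right exactness of the tensor product transfers this to M. *)
Lemma quasi_coherent_bcm (M : omodule X) : quasi_coherent M ->
  forall (p q : X) (h : spec p q), bijective (bcm M h).
Proof.
move=> qc p q h; have [U [oU Up [I [J [phi [psi ex]]]]]] := qc p.
have Uq : U q by apply: h.
have [ps pk] := ex p Up; have [qs qk] := ex q Uq.
have bI := @bcm_free_bij {classic I} p q h.
have bJ := @bcm_free_bij {classic J} p q h.
pose F x := bcm_nat (M := free_module X I) (N := M) (v := psi q Uq) (ho_nat psi h Up Uq) x.
pose G x := bcm_nat (M := free_module X J) (N := free_module X I) (v := phi q Uq)
  (ho_nat phi h Up Uq) x.
apply: inj_surj_bij.
  apply: morphD_inj => [x y|x e]; first exact: linearD.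
  have [x' hx'] := tens_surj (phi := rs_res h) (N := (rs_O q)^o) ps x.
  move: e; rewrite -hx' -F => /qk[e' he'].
  have [x2 hx2] := bij_surj bJ e'.
  move: he'; rewrite -hx2 G => /(bij_inj bI) <-.
  rewrite (tmapl_comp (u'' := psi p Up \o phi p Up) (v'' := idfun)) // tmapl0l //.
  by move=> m; apply/pk; exists m.
move=> m; have [e <-] := qs m; have [x <-] := bij_surj bI e.
by rewrite F; eexists.
Qed.

(** On U_p the generators are all the elements of M_p and the relations all those that hold at p. At
    q the sequence is the base change of the one at p, exact by flatness. *)
Lemma bcm_quasi_coherent (M : omodule X) : finite_space X ->
  (forall (p q : X) (h : spec p q), bijective (bcm M h)) -> quasi_coherent M.
Proof.
move=> fX hb p; exists (minopen p); split; [exact: open_minopen (rs_finite X)|by []|].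
pose I := {classic (M p : Type)}.
pose T := fun _ : I => True.
pose psi0 q (h : spec p q) : {linear free_module X I q -> M q} :=
  fext T (fun m : I => om_res h (m : M p)).
have psi_nat q r (h : spec q r) (Uq : spec p q) (Ur : spec p r) (e : free_module X I q) :
    om_res h (psi0 q Uq e) = psi0 r Ur (om_res h e).
  move: e; apply: (freem_ext (Pd := T)) => [x y|x y|i a _].
  - by rewrite linearD (semilinD (om_res_lin h)).
  - by rewrite (semilinD (om_res_lin h)) linearD.
  rewrite linearZ (semilinZ (om_res_lin h)) (semilinZ (om_res_lin h)) linearZ /=.
  congr (_ *: _); rewrite [psi0 q Uq _]fext_bas //.
  transitivity (psi0 r Ur (fbas T i : free_module X I r)).
    by rewrite [RHS]fext_bas //; exact: om_res_comp.
  by congr (psi0 r Ur _); apply/esym; exact: free_res_bas.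
pose J := {classic {e : free_module X I p | psi0 p (@spec_refl X p) e = 0}}.
pose TJ := fun _ : J => True.
pose phi0 q (h : spec p q) : {linear free_module X J q -> free_module X I q} :=
  fext TJ (fun j : J => om_res h
    (sval (j : {e : free_module X I p | psi0 p (@spec_refl X p) e = 0}))).
have phi_nat q r (h : spec q r) (Uq : spec p q) (Ur : spec p r) (e : free_module X J q) :
    om_res h (phi0 q Uq e) = phi0 r Ur (om_res h e).
  move: e; apply: (freem_ext (Pd := TJ)) => [x y|x y|i a _].
  - by rewrite linearD (semilinD (om_res_lin h)).
  - by rewrite (semilinD (om_res_lin h)) linearD.
  rewrite linearZ (semilinZ (om_res_lin h)) (semilinZ (om_res_lin h)) linearZ /=.
  congr (_ *: _); rewrite [phi0 q Uq _]fext_bas //.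
  transitivity (phi0 r Ur (fbas TJ i : free_module X J r)).
    by rewrite [RHS]fext_bas //; exact: (@om_res_comp _ X (free_module X I)).
  by congr (phi0 r Ur _); apply/esym; exact: free_res_bas.
exists I, J.
exists (@OHomOn _ X (minopen p) (free_module X J) (free_module X I) phi0 phi_nat).
exists (@OHomOn _ X (minopen p) (free_module X I) M psi0 psi_nat) => q h /=.
have zero e : psi0 q h (phi0 q h e) = 0.
  move: e; apply: (freem_ext (Pd := TJ) (g := fun=> 0)) => [x y|x y|j a _].
  - by rewrite !linearD.
  - by rewrite addr0.
  rewrite linearZ linearZ [phi0 q h _]fext_bas // -(psi_nat _ _ _ (@spec_refl X p)).
  rewrite (svalP (j : {e | _})) (semilin0 (om_res_lin h)). exact: scaler0.
split=> [m|e].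
  have [x <-] := bij_surj (hb p q h) m.
  elim/tens_ind: x => [m' b||x y [a ha] [c hc]].
  - exists ((b : rs_O q) *: (fbas T (m' : I) : free_module X I q)).
    by rewrite linearZ [psi0 q h _]fext_bas // [RHS]bcmap_pure.
  - by exists 0; rewrite !linear0.
  - by exists (a + c); rewrite !linearD; congr (_ + _).
split=> [|[e' <-]]; last exact: zero.
have [x <-] := bij_surj (@bcm_free_bij I p q h) e.
rewrite (bcm_nat (N := M) (u := psi0 p (@spec_refl X p))); last exact: psi_nat.
rewrite -(linear0 (bcm M h)) => /(bij_inj (hb p q h)).
move=> /(flat_exact (fX _ _ h) (u := phi0 p (@spec_refl X p)))[|y <-].
  move=> e1 he1.
  exists (fbas TJ (exist (fun e => psi0 p (@spec_refl X p) e = 0) e1 he1 : J)).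
  by rewrite [LHS]fext_bas // om_res_id.
exists (bcm (free_module X J) h y).
by rewrite (bcm_nat (u := phi0 p (@spec_refl X p))) //; apply: phi_nat.
Qed.


Section Complexes.
Variable M : complex X.
Definition bcx_d (p q : X) (h : spec p q) i j :
    {linear tens (rs_res h) (M i p) (rs_O q)^o -> tens (rs_res h) (M j p) (rs_O q)^o} :=
  tmapl (rs_res h) (cx_d M i j p) idfun.

Definition bc_qis := forall (p q : X) (h : spec p q),
  @qis (fun i => tens (rs_res h) (M i p) (rs_O q)^o) (fun i => M i q)
    (fun i j => bcx_d h i j) (fun i j => cx_d M i j q) (fun i => bcm (M i) h).

(** Flatness lets homology commute with the tensor product by O_q, so base change for the cohomology
    sheaves can be read on the complex itself, up to quasi-isomorphism. *)
Lemma qc_cohomologyP : finite_space X -> qc_cohomology M <-> bc_qis.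
Proof.
move=> fX.
have K i p q (h : spec p q) : bijective (bcm (cohomology M i) h) <->
    bijective (hmap (bcx_d h (i - 1) i) (bcx_d h i (i + 1))
      (cx_d M (i - 1) i q) (cx_d M i (i + 1) q) (bcm (M i) h)).
  have sq a b x : cx_d M a b q (om_res h x) = om_res h (cx_d M a b p x).
    by rewrite oh_nat.
  have := homol_bc (om_res_lin h) (om_res_lin h) (om_res_lin h) (sq (i - 1) i)
    (sq i (i + 1)) (fun x => cx_dd _ _ x) (fX _ _ h).
  set H1 := bcmap _; set H2 := bcmap _; rewrite /bcm.
  (* The restriction of the cohomology sheaf is semilinear for two proofs, which are identified here
     so that both base change maps coincide. *)
  by rewrite (Prop_irrelevance
    (om_res_lin h : semilinear (rs_res h) (om_res (o := cohomology M i) h))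
    (hmap_sl (om_res_lin h) (om_res_lin h) (sq (i - 1) i) (sq i (i + 1)))).
have Q p q (h : spec p q) := @qis_hmap _ _ idfun
  (fun i => tens (rs_res h) (M i p) (rs_O q)^o) (fun i => M i q)
  (bcx_d h) (fun i j => cx_d M i j q) (fun i => bcm (M i) h)
  (fun i => lin_semilin _)
  (fun i j => bcm_nat (u := cx_d M i j p) (v := cx_d M i j q) (fun x => oh_nat _ h x)).
split=> [qc p q h|qc i].
  by apply: (proj1 (Q p q h)) => i; apply/K/quasi_coherent_bcm.
apply: bcm_quasi_coherent => // p q h; apply/K.
by move: i; apply: (proj2 (Q p q h)); apply: qc.
Qed.
End Complexes.
End QuasiCoherence.

(** * Cohomology and derived functors *)

Section CohomologyFunctor.
Variables (k : comPzRingType) (X : ringed_finite_space k).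

Section Map.
Variables (M N : complex X) (f : chain_map M N) (i : int).
Lemma coh_mapE (p : X) (z : subm (hker (cx_d M i (i + 1) p)))
    (z' : subm (hker (cx_d N i (i + 1) p))) : val z' = f i p (val z) ->
  coh_map f (hclass (cx_d M (i - 1) i p) z) = hclass (cx_d N (i - 1) i p) z'.
Proof.
apply: (hmapE (lin_semilin (f i p)) (lin_semilin (f (i + 1) p)) (u1 := f (i - 1) p)).
  exact: (cm_d f).
exact: (cm_d f).
Qed.
Fact coh_map_ker (p : X) (z : subm (hker (cx_d M i (i + 1) p))) :
  hker (cx_d N i (i + 1) p) (f i p (val z)).
Proof. by rewrite /= /hker_mem cm_d (submP z) linear0. Qed.
Lemma coh_mapEE (p : X) (z : subm (hker (cx_d M i (i + 1) p))) :
  coh_map f (hclass (cx_d M (i - 1) i p) z) =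
  hclass (cx_d N (i - 1) i p) (mksubm (coh_map_ker z)).
Proof. exact: coh_mapE. Qed.
Lemma coh_map_lin (p : X) : linear (@coh_map _ _ _ _ f i p).
Proof.
have := hmap_semilinear (lin_semilin (f i p)) (lin_semilin (f (i + 1) p)) (u1 := f (i - 1) p).
by apply; exact: (cm_d f).
Qed.
Lemma coh_map_nat (p q : X) (h : spec p q) x :
  om_res h (coh_map f x) = @coh_map _ _ _ _ f i q (om_res h x).
Proof.
elim/homol_ind: x => z; rewrite coh_mapEE.
rewrite [RHS](_ : _ = coh_map f (hclass (cx_d M (i - 1) i q) (mksubm (coh_res_ker h z))));
  last first.
  by congr (coh_map f _); exact: coh_resE.
rewrite coh_mapEE; apply: coh_resE => /=; exact/esym/oh_nat.
Qed.
End Map.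

Definition binv (A B : Type) (f : A -> B) (hb : bijective f) (y : B) : A :=
  sval (cid (bij_surj hb y)).
Lemma binvK (A B : Type) (f : A -> B) (hb : bijective f) y : f (binv hb y) = y.
Proof. by rewrite /binv; case: cid. Qed.
Lemma binvK' (A B : Type) (f : A -> B) (hb : bijective f) x : binv hb (f x) = x.
Proof. by apply: (bij_inj hb); rewrite binvK. Qed.

(** Cohomology is extended to the localization by recursion on words, a formal inverse acting by the
    inverse bijection; [coh_word_eq] makes this independent of the word. *)
Fixpoint coh_word (a b : complex X) (w : @word (cxcat X) (@quasi_iso k X) a b) i p :
    cohomology a i p -> cohomology b i p :=
  match w in word _ a b return cohomology a i p -> cohomology b i p with
  | word_id _ => id
  | word_of _ _ f => @coh_map _ _ _ _ f i p
  | word_inv _ _ s Ws => binv (Ws i p)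
  | word_comp _ _ _ g f => fun x => coh_word g (coh_word f x)
  end.

Lemma coh_word_lin a b (w : @word (cxcat X) (@quasi_iso k X) a b) i p :
  linear (@coh_word a b w i p).
Proof.
elim: w => {a b} [a|a b f|a b s Ws|a b c g hg f hf] c' x y //=.
- exact: coh_map_lin.
- by apply: (bij_inj (Ws i p)); rewrite coh_map_lin !binvK.
- by rewrite hf hg.
Qed.
Lemma coh_word_nat a b (w : @word (cxcat X) (@quasi_iso k X) a b) i p q (h : spec p q) x :
  om_res h (@coh_word a b w i p x) = @coh_word a b w i q (om_res h x).
Proof.
elim: w x => {a b} [a|a b f|a b s Ws|a b c g hg f hf] x //=.
- exact: coh_map_nat.
- by apply: (bij_inj (Ws i q)); rewrite -coh_map_nat !binvK.
- exact: etrans (hg _) (congr1 _ (hf _)).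
Qed.
Lemma coh_word_eq a b (v w : @word (cxcat X) (@quasi_iso k X) a b) :
  word_eq v w -> forall i p x, @coh_word a b v i p x = @coh_word a b w i p x.
Proof.
elim=> {a b v w} //=.
- by move=> a b f g h _ h1 _ h2 i p x; rewrite h1 h2.
- by move=> a b c g g' f f' _ h1 _ h2 i p x; rewrite h2 h1.
- move=> a b f g h i p; elim/homol_ind => z; rewrite coh_mapEE; apply/esym/coh_mapE.
  exact: h.
- by move=> a i p; elim/homol_ind => z; exact: coh_mapE.
- move=> a b c g f i p; elim/homol_ind => z.
  by rewrite coh_mapEE [in RHS]coh_mapEE coh_mapEE; congr hclass; exact: val_inj.
- by move=> a b s Ws i p x; rewrite binvK'.
- by move=> a b s Ws i p x; rewrite binvK.
Qed.

Lemma quasi_coherent_iso (M N : omodule X) (u : ohom M N) :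
  (forall p, bijective (u p)) -> quasi_coherent M -> quasi_coherent N.
Proof.
move=> ub qc p; have [U [oU Up [I [J [phi [psi h]]]]]] := qc p.
exists U; split=> //; exists I, J, phi.
have nat q r (hqr : spec q r) (Uq : U q) (Ur : U r) m :
    om_res hqr ((u q \o psi q Uq) m) = (u r \o psi r Ur) (om_res hqr m).
  by rewrite /= oh_nat (ho_nat psi hqr Uq Ur).
exists (@OHomOn _ X U (free_module X I) N (fun q Uq => u q \o psi q Uq) nat) => q Uq /=.
have [h1 h2] := h q Uq; split=> [m|e].
  have [m' <-] := bij_surj (ub q) m; have [e <-] := h1 m'; by exists e.
rewrite -h2; split=> [|->]; last exact: linear0.
by move=> e0; apply: (bij_inj (ub q)); rewrite e0 linear0.
Qed.

(** This is what allows a derived functor to be evaluated on a resolution. *)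
Lemma qc_cohomology_iso (M N : derived X) (f : Hom M N) :
  is_iso f -> qc_cohomology M -> qc_cohomology N.
Proof.
move=> [g [gf fg]] qc i.
pose u : ohom (cohomology M i) (cohomology N i) :=
  @OHom _ _ (cohomology M i) (cohomology N i)
    (fun p => mklin (@coh_word_lin M N f i p)) (@coh_word_nat M N f i).
apply: (quasi_coherent_iso (u := u)) => // p.
exists (@coh_word N M g i p) => x.
  exact: (coh_word_eq gf).
exact: (coh_word_eq fg).
Qed.

Lemma qc_cohomology_qis (M N : complex X) (f : chain_map M N) :
  quasi_iso f -> qc_cohomology M <-> qc_cohomology N.
Proof.
move=> hf; split=> qc i.
  apply: (quasi_coherent_iso (M := cohomology M i)
    (u := @OHom _ _ (cohomology M i) (cohomology N i)
    (fun p => mklin (@coh_map_lin M N f i p)) (@coh_map_nat M N f i))) => //.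
  exact: hf.
have h := @qc_cohomology_iso N M (@word_inv (cxcat X) (@quasi_iso k X) _ _ f hf).
apply: h => //; exists (@word_of (cxcat X) (@quasi_iso k X) _ _ f); split.
  exact: we_invr.
exact: we_invl.
Qed.
End CohomologyFunctor.

Section Category.
Variables (C D : category).
Lemma is_iso_comp (a b c : C) (g : Hom b c) (f : Hom a b) :
  is_iso g -> is_iso f -> is_iso (compc g f).
Proof.
move=> [g' [g1 g2]] [f' [f1 f2]]; exists (compc f' g'); split.
  apply: Heq_trans (compcA _ _ _) _; apply: Heq_trans f1.
  apply: compc_eq; last exact: Heq_refl.
  apply: Heq_trans (Heq_sym (compcA _ _ _)) _; apply: Heq_trans (compc1 _).
  by apply: compc_eq => //; exact: Heq_refl.
apply: Heq_trans (compcA _ _ _) _; apply: Heq_trans g2.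
apply: compc_eq; last exact: Heq_refl.
apply: Heq_trans (Heq_sym (compcA _ _ _)) _; apply: Heq_trans (compc1 _).
by apply: compc_eq => //; exact: Heq_refl.
Qed.
Lemma is_iso_sym (a b : C) (f : Hom a b) : is_iso f -> exists g : Hom b a, is_iso g.
Proof. by move=> [g [gf fg]]; exists g; exists f. Qed.
Lemma is_iso_fmap (F : functor C D) (a b : C) (f : Hom a b) :
  is_iso f -> is_iso (fmap F f).
Proof.
move=> [g [gf fg]]; exists (fmap F g); split.
  by apply: Heq_trans (Heq_sym (fmap_comp F _ _)) _; apply: Heq_trans (fmap_id F _); apply: fmap_eq.
by apply: Heq_trans (Heq_sym (fmap_comp F _ _)) _; apply: Heq_trans (fmap_id F _); apply: fmap_eq.
Qed.
End Category.

(** As the subcategory is full, [F] itself provides the action on morphisms, and the natural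
    isomorphism is the identity. *)
Lemma restricts_full (A A' B : category) (I : functor A' A) (Q : B -> Prop)
    (F : functor A B) :
  (forall a, Q (F (I a))) -> restricts I (@full_incl B Q) F.
Proof.
move=> h.
pose G : functor A' (@fullcat B Q) := @Functor A' (@fullcat B Q)
  (fun a => exist _ (F (I a)) (h a)) (fun a b f => fmap F (fmap I f))
  (fun a b f g e => fmap_eq F (fmap_eq I e))
  (fun a => Heq_trans (fmap_eq F (fmap_id I a)) (fmap_id F (I a)))
  (fun a b c g f => Heq_trans (fmap_eq F (fmap_comp I g f)) (fmap_comp F _ _)).
exists G.
have n (a b : A') (f : Hom a b) : Heq (compc (idc (F (I b))) (fmap F (fmap I f)))
    (compc (fmap F (fmap I f)) (idc (F (I a)))).
  exact: Heq_trans (comp1c _) (Heq_sym (compc1 _)).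
exists (@NatTrans _ _ (fcompose (@full_incl B Q) G) (fcompose F I)
  (fun a => idc (F (I a))) n) => a.
exists (idc (F (I a))); split; exact: comp1c.
Qed.

Lemma quasi_iso_loc (k : comPzRingType) (X : ringed_finite_space k) (M N : complex X)
    (s : chain_map M N) : quasi_iso s -> is_iso (fmap (Qfun X) (a := M) (b := N) s).
Proof.
move=> hs; exists (word_inv (hs : @quasi_iso k X M N s)); split.
  exact: we_invl.
exact: we_invr.
Qed.

(** [L] sends the arrow inverted by [Q] to an isomorphism, and [ld_map] is an isomorphism at the
    adapted object [P]. *)
Lemma left_derived_resolution (C E D : category) (Q : functor C E) (F : functor C D)
    (ad : C -> Prop) (L : left_derived Q F ad) (P M : C) (s : Hom P M) :
  ad P -> is_iso (fmap Q s) -> exists f : Hom (F P) (L (Q M)), is_iso f.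
Proof.
move=> aP /(is_iso_fmap L) h1.
have [g hg] := is_iso_sym (ld_iso L aP).
by exists (compc (fmap L (fmap Q s)) g); apply: is_iso_comp.
Qed.
Lemma right_derived_resolution (C E D : category) (Q : functor C E) (F : functor C D)
    (ad : C -> Prop) (L : right_derived Q F ad) (P M : C) (s : Hom M P) :
  ad P -> is_iso (fmap Q s) -> exists f : Hom (F P) (L (Q M)), is_iso f.
Proof.
move=> aP /(is_iso_fmap L) /is_iso_sym[g hg].
by exists (compc g (rd_map L P)); apply: is_iso_comp => //; apply: rd_iso.
Qed.

(** * Semifree resolutions *)

Section PartialRestriction.
Variables (k : comPzRingType) (X : ringed_finite_space k).
(** The value 0 outside p <= q allows boundaries to be written for arbitrary cells, before
    well-formedness provides the specializations. *)
Definition resO (p q : X) (a : rs_O p) : rs_O q :=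
  if pselect (spec p q) is left h then rs_res h a else 0.
Definition resM (M : omodule X) (p q : X) (m : M p) : M q :=
  if pselect (spec p q) is left h then om_res h m else 0.
Lemma resOE (p q : X) (h : spec p q) a : resO q a = rs_res h a.
Proof. by rewrite /resO; case: pselect => // h'; rewrite (Prop_irrelevance h h'). Qed.
Lemma resME (M : omodule X) (p q : X) (h : spec p q) m : resM (M := M) q m = om_res h m.
Proof. by rewrite /resM; case: pselect => // h'; rewrite (Prop_irrelevance h h'). Qed.
Lemma resO_comp (p q r : X) (h : spec p q) (h' : spec q r) a :
  rs_res h' (resO q a) = resO r (a : rs_O p).
Proof.
by rewrite (resOE h) (resOE (spec_trans h h')); exact: rs_res_comp.
Qed.
Lemma resM_comp (M : omodule X) (p q r : X) (h : spec p q) (h' : spec q r) m :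
  om_res h' (resM q m) = resM r (m : M p).
Proof. by rewrite (resME h) (resME (spec_trans h h')); exact: om_res_comp. Qed.
Lemma resO_id (p : X) a : resO p a = a :> rs_O p.
Proof. by rewrite (resOE (@spec_refl X p)) rs_res_id. Qed.
Lemma resM_id (M : omodule X) (p : X) m : resM p m = m :> M p.
Proof. by rewrite (resME (@spec_refl X p)) om_res_id. Qed.
End PartialRestriction.

Section Cells.
Variables (k : comPzRingType) (X : ringed_finite_space k) (N : complex X).

(* A cell at the point p, in degree n, with boundary \sum_l a l *: f l and
   value m n in N; the values of m in the other degrees are junk. *)
Inductive cell := Cell (p : X) (n : int) (m : forall n', N n' p) (r : nat)
  (a : 'I_r -> rs_O p) (f : 'I_r -> cell).

HB.instance Definition _ := gen_eqMixin cell.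
HB.instance Definition _ := gen_choiceMixin cell.

Definition cpt c := let: Cell p _ _ _ _ _ := c in p.
Definition cdeg c := let: Cell _ n _ _ _ _ := c in n.
Definition cval c : forall n', N n' (cpt c) :=
  let: Cell _ _ m _ _ _ := c in m.
Definition clen c := let: Cell _ _ _ r _ _ := c in r.
Definition ccoef c : 'I_(clen c) -> rs_O (cpt c) := let: Cell _ _ _ _ a _ := c in a.
Definition cface c : 'I_(clen c) -> cell := let: Cell _ _ _ _ _ f := c in f.

Fixpoint clev (c : cell) : nat :=
  let: Cell _ _ _ r _ f := c in (\max_(l < r) (clev (f l)).+1)%N.
Lemma clev_face c l : (clev (@cface c l) < clev c)%N.
Proof.
by case: c l => p n m r a f l /=; exact: (leq_bigmax (F := fun l => (clev (f l)).+1) l).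
Qed.

(** The coefficient of [c'] in the boundary of [c] at q. It is a sum because a face may be
    repeated. *)
Definition bdc c q c' : rs_O q := \sum_(l < clen c | cface l == c') resO q (ccoef l).

(** Beyond the shape of the faces, it asks that the boundary be a cycle and that the value be
    compatible with the differentials. The cycle condition is written coefficient by coefficient,
    since the complex is defined only afterwards. *)
Fixpoint wf (c : cell) : Prop :=
  let: Cell p n m r a f := c in
  [/\ forall l, [/\ wf (f l), cdeg (f l) = n + 1 & spec (cpt (f l)) p],
    forall c', \sum_(l < r) a l * bdc (f l) p c' = 0 &
    \sum_(l < r) a l *: resM p (cval (f l) (n + 1)) = cx_d N n (n + 1) p (m n)].

Lemma wf_face c l : wf c -> [/\ wf (@cface c l), cdeg (@cface c l) = cdeg c + 1 &
  spec (cpt (@cface c l)) (cpt c)].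
Proof. by case: c l => p n m r a f l [h _ _]; apply: h. Qed.
Lemma wf_bd c c' : wf c -> \sum_(l < clen c) ccoef l * bdc (@cface c l) (cpt c) c' = 0.
Proof. by case: c => p n m r a f [_ h _]; apply: h. Qed.
Lemma wf_val c : wf c ->
  \sum_(l < clen c) ccoef l *: resM (cpt c) (cval (@cface c l) (cdeg c + 1)) =
  cx_d N (cdeg c) (cdeg c + 1) (cpt c) (cval c (cdeg c)).
Proof. by case: c => p n m r a f [_ _ h]; apply: h. Qed.

Definition sfP (n : int) (q : X) (c : cell) : Prop :=
  [/\ wf c, cdeg c = n & spec (cpt c) q].
Definition sf_st (n : int) (q : X) : lmodType (rs_O q) := freem (rs_O q) (sfP n q).
Local Notation e n q c := (fbas (sfP n q) c : sf_st n q).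

Section Restriction.
Variables (n : int) (p q : X) (h : spec p q).
Definition sf_res_fun (t : sf_st n p) : prodm (fun _ : cell => (rs_O q)^o) :=
  fun c => rs_res h (fco _ c t : rs_O p).
Fact sf_res_supp t : finsupp_mem (sfP n q) (sf_res_fun t).
Proof.
have [ft Pt] := submP t.
have key c : sf_res_fun t c <> 0 -> subm_val t c <> 0.
  by move=> hc tc; apply: hc; rewrite /sf_res_fun [fco _ _ _]tc rmorph0.
split=> [|c /key/Pt[h1 h2 h3]]; first by apply: sub_finite_set ft => c /key.
by split=> //; apply: spec_trans h3 h.
Qed.
Definition sf_res (t : sf_st n p) : sf_st n q := mksubm (W := dsum_submod _ _) (sf_res_supp t).
Lemma sf_resE c t : fco (sfP n q) c (sf_res t) = rs_res h (fco (sfP n p) c t : rs_O p).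
Proof. by []. Qed.
Fact sf_res_lin : semilinear (rs_res h) sf_res.
Proof.
by move=> a s t; apply: fco_inj => c; rewrite sf_resE linearP [RHS]linearP rmorphD rmorphM.
Qed.
End Restriction.

Fact sf_res_id n (p : X) (h : spec p p) (t : sf_st n p) : sf_res h t = t.
Proof. by apply: fco_inj => c; rewrite sf_resE rs_res_id. Qed.
Fact sf_res_comp n (p q r : X) (h : spec p q) (h' : spec q r) (h'' : spec p r)
  (t : sf_st n p) : sf_res h' (sf_res h t) = sf_res h'' t.
Proof. by apply: fco_inj => c; rewrite !sf_resE; exact: rs_res_comp. Qed.
Definition sf_ob n : omodule X := @OModule _ X (sf_st n) (@sf_res n) (@sf_res_lin n)
  (@sf_res_id n) (@sf_res_comp n).

Lemma sf_res_bas n (p q : X) (h : spec p q) c : wf c -> spec (cpt c) p ->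
  sf_res h (e n p c) = e n q c.
Proof.
move=> wc cp; apply: fco_inj => c'; rewrite sf_resE !fcoE.
have -> : `[< sfP n p c >] = `[< sfP n q c >].
  apply: asbool_equiv_eq; split=> -[h1 h2 h3]; split=> //; exact: spec_trans cp h.
by case: ifP => _; rewrite ?rmorph1 ?rmorph0.
Qed.

Definition sf_bd j q c : sf_st j q := \sum_(l < clen c) resO q (ccoef l) *: e j q (@cface c l).
Definition sf_d_st i j q : {linear sf_st i q -> sf_st j q} := fext (sfP i q) (sf_bd j q).

Lemma fco_sf_bd j q c c' : sfP j q c' -> fco (sfP j q) c' (sf_bd j q c) = bdc c q c'.
Proof.
move=> hc'; rewrite /sf_bd /bdc linear_sum [RHS]big_mkcond; apply: eq_bigr => l _.
rewrite fcoZ fcoE; case: eqP => [->|_]; last exact: mulr0.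
by rewrite asboolT // [LHS]mulr1.
Qed.

Lemma rs_res_bdc (p q : X) (h : spec p q) c c' : spec (cpt c) p ->
  rs_res h (bdc c p c') = bdc c q c'.
Proof.
by move=> cp; rewrite rmorph_sum; apply: eq_bigr => l _; exact: resO_comp.
Qed.

Fact sf_d_nat i j (p q : X) (h : spec p q) t :
  om_res (o := sf_ob j) h (sf_d_st i j p t) = sf_d_st i j q (om_res (o := sf_ob i) h t).
Proof.
move: t; apply: (freem_ext (Pd := sfP i p)) => [x y|x y|c a hc].
- by rewrite linearD (semilinD (om_res_lin h)).
- by rewrite (semilinD (om_res_lin h)) linearD.
rewrite linearZ !(semilinZ (om_res_lin h)) linearZ /=; congr (_ *: _).
have [wc dc cp] := hc.
rewrite sf_res_bas // [sf_d_st i j p _]fext_bas // [RHS]fext_bas; last first.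
  by split=> //; apply: spec_trans cp h.
rewrite /sf_bd (morphD_sum _ _ (semilinD (sf_res_lin h))); apply: eq_bigr => l _.
have [wl dl ll] := wf_face l wc.
rewrite (semilinZ (sf_res_lin h)) sf_res_bas //; last exact: spec_trans ll cp.
by rewrite (resO_comp cp).
Qed.
Definition sf_d i j : ohom (sf_ob i) (sf_ob j) := @OHom _ X (sf_ob i) (sf_ob j)
  (fun q => sf_d_st i j q) (@sf_d_nat i j).

Lemma sf_d_bas i j q c : sfP i q c -> sf_d i j q (e i q c) = sf_bd j q c.
Proof. by move=> hc; exact: fext_bas. Qed.

Fact sf_d0 i j : j != i + 1 -> forall p t, sf_d i j p t = 0.
Proof.
move=> ij p; apply: (freem_ext (Pd := sfP i p) (g := fun=> 0)) => [x y|x y|c a hc].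
- exact: linearD.
- by rewrite addr0.
rewrite linearZ_LR sf_d_bas // /sf_bd big1 ?scaler0 // => l _.
have [wc dc cp] := hc; have [wl dl ll] := wf_face l wc.
rewrite fbas0 ?scaler0 // => -[_ hj _]; move/eqP: ij; apply.
by rewrite -hj dl dc.
Qed.

Fact sf_dd i j l p t : sf_d j l p (sf_d i j p t) = 0.
Proof.
move: t; apply: (freem_ext (Pd := sfP i p) (g := fun=> 0)) => [x y|x y|c a hc].
- by rewrite !linearD.
- by rewrite addr0.
rewrite 2!linearZ_LR sf_d_bas //.
suff -> : sf_d j l p (sf_bd j p c) = 0 by rewrite scaler0.
have [wc dc cp] := hc.
have [ij|/sf_d0->//] := eqVneq l (j + 1).
have [ji|/sf_d0 h] := eqVneq j (i + 1); last first.
  by rewrite -(@sf_d_bas i j p c hc) h linear0.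
apply: fco_inj => c'; rewrite linear0.
have [hc'|hc'] := pselect (sfP l p c'); last by rewrite fco0.
pose G : {linear sf_st j p -> (rs_O p)^o} := fco (sfP l p) c' \o sf_d_st j l p.
rewrite -[LHS]/(G _) /sf_bd linear_sum.
have E s : G (resO p (ccoef s) *: e j p (@cface c s)) =
    rs_res cp (ccoef s * bdc (cface s) (cpt c) c').
  have [ws ds ss] := wf_face s wc.
  rewrite linearZ_LR -[G _]/(fco (sfP l p) c' (sf_d j l p _)) sf_d_bas; last first.
    by split=> //; [rewrite ds dc ji|apply: spec_trans ss cp].
  by rewrite fco_sf_bd // rmorphM -(resOE cp) rs_res_bdc.
rewrite (eq_bigr _ (fun s _ => E s)) -rmorph_sum wf_bd //.
exact: rmorph0.
Qed.
Definition semifree : complex X := Complex sf_d0 sf_dd.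

Definition sf_eps_st n q : {linear sf_st n q -> N n q} :=
  fext (sfP n q) (fun c => resM q (cval c n)).
Fact sf_eps_nat n (p q : X) (h : spec p q) t :
  om_res h (sf_eps_st n p t) = sf_eps_st n q (om_res (o := sf_ob n) h t).
Proof.
move: t; apply: (freem_ext (Pd := sfP n p)) => [x y|x y|c a hc].
- by rewrite linearD (semilinD (om_res_lin h)).
- by rewrite (semilinD (om_res_lin h)) linearD.
rewrite linearZ !(semilinZ (om_res_lin h)) linearZ /=; congr (_ *: _).
have [wc dc cp] := hc.
rewrite sf_res_bas // [sf_eps_st n p _]fext_bas // [RHS]fext_bas; last first.
  by split=> //; apply: spec_trans cp h.
by rewrite (resM_comp cp).
Qed.
Definition sf_eps_fun n : ohom (semifree n) (N n) := @OHom _ X (semifree n) (N n)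
  (fun q => sf_eps_st n q) (@sf_eps_nat n).
Lemma sf_eps_bas n q c : sfP n q c -> sf_eps_fun n q (e n q c) = resM q (cval c n).
Proof. by move=> hc; exact: fext_bas. Qed.

Fact sf_eps_d i j p t :
  cx_d N i j p (sf_eps_fun i p t) = sf_eps_fun j p (cx_d semifree i j p t).
Proof.
have [ij|ij] := eqVneq j (i + 1); last first.
  by rewrite !cx_d0 // linear0.
move: t; apply: (freem_ext (Pd := sfP i p)) => [x y|x y|c a hc]; try by rewrite !linearD.
rewrite 4!linearZ_LR; congr (_ *: _).
have [wc dc cp] := hc; rewrite {}ij; move: hc; rewrite -{}dc => hc.
rewrite sf_eps_bas // [cx_d semifree _ _ p _]sf_d_bas // /sf_bd linear_sum.
rewrite (resME cp) -oh_nat -(wf_val wc).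
rewrite (morphD_sum _ _ (semilinD (om_res_lin cp))); apply: eq_bigr => l _.
have [wl dl ll] := wf_face l wc.
rewrite (semilinZ (om_res_lin cp)) -(resOE cp) (resM_comp ll) linearZ_LR.
by rewrite sf_eps_bas //; split=> //; apply: spec_trans ll cp.
Qed.
Definition sf_eps : chain_map semifree N := ChainMap sf_eps_d.

(** A cocycle (x, x') of the cone is exactly the datum of a cell with boundary x and value x', and
    the basis vector of that cell solves the equations with [y' = 0]. *)
Lemma sf_eps_quasi_iso : quasi_iso sf_eps.
Proof.
apply/quasi_isoP => p i j l m ij jl lm x x' dx dx'.
suff [y [hy hy']] : exists y : semifree j p, cx_d semifree j l p y = x /\ sf_eps j p y = x'.
  by exists y, 0; rewrite linear0 addr0.
have [L0 uL0 hL0] := freem_supp (x : sf_st l p).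
(* Indices outside [sfP] have coefficient 0; they are dropped because the faces of a cell must be
   well-formed. *)
pose L := [seq c <- L0 | `[< sfP l p c >]].
have uL : uniq L by apply: filter_uniq.
have hL c : c \notin L -> fco _ c (x : sf_st l p) = 0.
  rewrite mem_filter negb_and => /orP[/asboolPn|]; first exact: fco0.
  exact: hL0.
have PL (s : 'I_(size L)) : sfP l p (tnth (in_tuple L) s).
  by have := mem_tnth s (in_tuple L); rewrite mem_filter => /andP[/asboolP].
have ex : x = \sum_(s < size L) (fco _ (tnth (in_tuple L) s) (x : sf_st l p) : rs_O p)
    *: e l p (tnth (in_tuple L) s).
  rewrite {1}(freem_sum uL hL).
  by rewrite (big_tnth _ _ L (fun=> true)).
(* Only degree [j] of the value matters, the other degrees are filled with 0. *)
have [mf hmf] : exists mf : forall n', N n' p, mf j = x'.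
  exists (fun n' => if pselect (j = n') is left e then ecast z (N z p) e x' else 0).
  by case: pselect => // e0; rewrite (eq_irrelevance e0 erefl).
pose c := @Cell p j mf (size L) (fun s => fco _ (tnth (in_tuple L) s) (x : sf_st l p))
  (fun s => tnth (in_tuple L) s).
have wc : wf c.
  split=> /= [s|c'|].
  - by have [h1 h2 h3] := PL s; split=> //; rewrite h2.
  - have [hc'|hc'] := pselect (sfP m p c').
      pose G : {linear sf_st l p -> (rs_O p)^o} := fco (sfP m p) c' \o sf_d_st l m p.
      have : G x = 0 := congr1 (fun t => fco (sfP m p) c' (t : sf_st m p)) dx.
      rewrite [in X in X -> _]ex linear_sum => h; rewrite -[RHS]h.
      apply: eq_bigr => s _; rewrite linearZ_LR; congr (_ * _).
      by rewrite -[RHS]/(fco _ c' (sf_d l m p _)) sf_d_bas ?fco_sf_bd.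
    apply: big1 => s _; rewrite /bdc big1 ?mulr0 // => t /eqP ht.
    case: hc'; rewrite -ht; have [ws ds ss] := PL s; have [w1 d1 s1] := wf_face t ws.
    by split=> //; [rewrite d1 ds lm|apply: spec_trans s1 ss].
  - rewrite hmf -jl [cx_d N _ _ _ _]dx' [in RHS]ex linear_sum; apply: eq_bigr => s _.
    by rewrite linearZ_LR [sf_eps l p _]sf_eps_bas.
exists (e j p c); split.
  rewrite [LHS]sf_d_bas; last by split.
  rewrite /sf_bd /= [RHS]ex; apply: eq_bigr => s _.
  by rewrite resO_id.
rewrite [LHS]sf_eps_bas; last by split.
by rewrite resM_id.
Qed.
End Cells.

(** * Triangular complexes *)

(** Recursion along a relation: [Q h s] looks at [h] in lower levels only, and it is solvable once
    those levels are solved. The approximation [G n] is final in the levels below n, and the next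
    one fills level n. *)
Lemma level_recursion (S : Type) (lev : S -> nat) (D : S -> Type)
    (Q : (forall s, D s) -> forall s, D s -> Prop) (h0 : forall s, D s) :
  (forall h h' s y, (forall s', (lev s' < lev s)%N -> h s' = h' s') -> Q h s y -> Q h' s y) ->
  (forall h s, (forall s', (lev s' < lev s)%N -> Q h s' (h s')) -> exists y, Q h s y) ->
  exists h, forall s, Q h s (h s).
Proof.
move=> loc sol.
(* The step is made total: it solves [Q h s] where a solution exists and returns the default [h0]
   elsewhere. *)
have step h : exists h' : forall s, D s, forall s, (exists y, Q h s y) -> Q h s (h' s).
  have H s : exists y, (exists y, Q h s y) -> Q h s y.
    have [[y hy]|n] := pselect (exists y, Q h s y); first by exists y.
    by exists (h0 s) => /n.
  by exists (fun s => sval (cid (H s))) => s; case: (cid (H s)).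
have [F hF] := choice step.
pose G := fix G n := if n is n'.+1 then
  fun s => if (lev s < n')%N then G n' s else F (G n') s else h0.
have GS n s : G n.+1 s = if (lev s < n)%N then G n s else F (G n) s by [].
have agree s n : (lev s < n)%N -> G n s = G (lev s).+1 s.
  elim: n => // n IH; rewrite ltnS leq_eqVlt => /orP[/eqP <- //|h].
  by rewrite GS h IH.
exists (fun s => G (lev s).+1 s).
have main n s : (lev s < n)%N -> Q (fun s => G (lev s).+1 s) s (G (lev s).+1 s).
  elim: n s => // n IH s hs; rewrite GS ltnn.
  apply: (loc (G (lev s))) => [s' hs'|]; first exact: agree.
  apply: hF; apply: sol => s' hs'.
  rewrite (agree s') //; apply: loc (IH s' _) => [s2 h2|].
    by rewrite (agree s2) //; apply: ltn_trans hs'.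
  exact: leq_trans hs' hs.
by move=> s; apply: main (ltnSn _).
Qed.

Section DecompMore.
Variables (T : zmodType) (S : choiceType) (v : S -> Prop) (A : S -> zmodType).
Variables (c : forall s, T -> A s) (e : forall s, A s -> T).
Arguments c : clear implicits.
Hypothesis h : decomp v c e.
Lemma decomp_c0 s x : ~ v s -> c s x = 0.
Proof.
move=> vs; move: x; apply: (dc_span h) => [|x y hx hy|s' a vs'].
- exact: (morphD0 (dc_add h s)).
- by rewrite (dc_add h) hx hy addr0.
- by rewrite (dc_e0 h) //; apply/eqP => e0; apply: vs; rewrite e0.
Qed.
Lemma decomp_coord_sum (L : seq S) (a : forall s, A s) s : uniq L -> v s ->
  c s (\sum_(s' <- L) e (a s')) = if s \in L then a s else 0.
Proof.
move=> uL vs; rewrite (morphD_sum _ _ (dc_add h s)).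
case: ifP => sL.
  rewrite (bigD1_seq s) //= (dc_e h) // big1 ?addr0 // => s' ss'.
  by rewrite (dc_e0 h) // eq_sym.
rewrite big_seq big1 // => s' hs'; rewrite (dc_e0 h) //.
by apply: contraFneq sL => ->.
Qed.
End DecompMore.

Lemma decomp_tens (R S0 : comPzRingType) (phi : {rmorphism R -> S0}) (N : lmodType S0)
    (T : lmodType R) (S : choiceType) (v : S -> Prop) (A : S -> lmodType R)
    (c : forall s, {linear T -> A s}) (e : forall s, {linear A s -> T}) :
  decomp v (A := fun s => A s) (fun s => c s) (fun s => e s) ->
  decomp v (T := tens phi T N) (A := fun s => tens phi (A s) N)
    (fun s => tmapl phi (c s) (idfun : {linear N -> N}))
    (fun s => tmapl phi (e s) (idfun : {linear N -> N})).
Proof.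
move=> h; split=> [s|s|s a vs|s s' a ss'|P P0 PD Pe].
- exact: linearD.
- exact: linearD.
- move: a; apply: tens_ext => // [x y|m n]; first by rewrite !linearD.
  by rewrite !tmapl_pure (dc_e h).
- rewrite (tmapl_comp (u'' := c s \o e s') (v'' := idfun)) // tmapl0l // => m.
  exact: (dc_e0 h).
apply: tens_ind => // m n; move: m; apply: (dc_span h) => [|x y hx hy|s a vs].
- by rewrite tpure0l.
- by rewrite tpureDl; apply: PD.
- by have := Pe s (tpure phi a n) vs; rewrite tmapl_pure.
Qed.

Section Triangular.
Variables (S : choiceType) (lev : S -> nat) (v : S -> Prop).
Variables (T : int -> zmodType) (B : S -> int -> zmodType).
Variables (c : forall n s, T n -> B s n) (e : forall n s, B s n -> T n).
Variables (d : forall n m, T n -> T m) (b : forall s n m, B s n -> B s m).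
Arguments c : clear implicits.
Arguments e : clear implicits.
Arguments d : clear implicits.
Arguments b : clear implicits.

(** The level filters T: on the piece s the differential is [b s] plus terms in pieces of strictly
    smaller level. *)
Record triangular : Prop := Triangular {
  tr_dec : forall n, decomp v (c n) (e n);
  tr_dadd : forall n m, {morph d n m : x y / x + y};
  tr_badd : forall s n m, {morph b s n m : x y / x + y};
  tr_dd : forall n m l x, d m l (d n m x) = 0;
  tr_diag : forall n m s a, m = n + 1 -> v s -> c m s (d n m (e n s a)) = b s n m a;
  tr_off : forall n m s s' a, m = n + 1 -> v s -> v s' -> s != s' ->
    ~~ (lev s < lev s')%N -> c m s (d n m (e n s' a)) = 0 }.

Arguments tr_dadd : clear implicits.
Arguments tr_badd : clear implicits.
(** Other pieces of the same or of a lower level do not reach s, so in the highest level present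
    only the diagonal differential is seen. *)
Lemma tr_coord (h : triangular) n m s x : m = n + 1 -> v s ->
  (forall s', (lev s < lev s')%N -> c n s' x = 0) -> c m s (d n m x) = b s n m (c n s x).
Proof.
move=> nm vs hx; have [L uL hL] := decomp_sum (tr_dec h n) x.
pose L' := undup (s :: L).
have uL' : uniq L' by apply: undup_uniq.
have sL' : s \in L' by rewrite mem_undup mem_head.
rewrite {1}(hL L') //; last by move=> i hi; rewrite mem_undup inE hi orbT.
rewrite (morphD_sum _ _ (tr_dadd h n m)) (morphD_sum _ _ (dc_add (tr_dec h m) s)).
rewrite (bigD1_seq s) //= (tr_diag h) // big1 ?addr0 // => s' ss'.
have [vs'|vs'] := pselect (v s'); last first.
  rewrite (decomp_c0 (tr_dec h n)) // (morphD0 (@de_add _ _ _ _ _ _ (tr_dec h n) s')).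
  by rewrite (morphD0 (tr_dadd h n m)) (morphD0 (dc_add (tr_dec h m) s)).
have [lt|nlt] := boolP (lev s < lev s')%N; last by rewrite (tr_off h) // eq_sym.
rewrite hx // (morphD0 (@de_add _ _ _ _ _ _ (tr_dec h n) s')).
by rewrite (morphD0 (tr_dadd h n m)) (morphD0 (dc_add (tr_dec h m) s)).
Qed.
End Triangular.
Arguments triangular {S} lev v {T B} c e d b.
Arguments tr_dadd {S lev v T B c e d b} _ n m x y : rename.
Arguments tr_badd {S lev v T B c e d b} _ s n m x y : rename.

Section TriangularQis.
Variables (S : choiceType) (lev : S -> nat) (v v' : S -> Prop).
Hypothesis vv' : forall s, v s -> v' s.
Variables (T T' : int -> zmodType) (B B' : S -> int -> zmodType).
Variables (c : forall n s, T n -> B s n) (e : forall n s, B s n -> T n).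
Variables (d : forall n m, T n -> T m) (b : forall s n m, B s n -> B s m).
Variables (c' : forall n s, T' n -> B' s n) (e' : forall n s, B' s n -> T' n).
Variables (d' : forall n m, T' n -> T' m) (b' : forall s n m, B' s n -> B' s m).
Variables (Phi : forall n, T n -> T' n) (phi : forall s n, B s n -> B' s n).
Arguments c : clear implicits.
Arguments e : clear implicits.
Arguments d : clear implicits.
Arguments b : clear implicits.
Arguments c' : clear implicits.
Arguments e' : clear implicits.
Arguments d' : clear implicits.
Arguments b' : clear implicits.
Arguments Phi : clear implicits.
Arguments phi : clear implicits.
Hypothesis h : triangular lev v c e d b.
Hypothesis h' : triangular lev v' c' e' d' b'.
Hypothesis PhiD : forall n, {morph Phi n : x y / x + y}.
Hypothesis phiD : forall s n, {morph phi s n : x y / x + y}.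
Arguments PhiD : clear implicits.
Arguments phiD : clear implicits.
Hypothesis Phi_d : forall n m x, d' n m (Phi n x) = Phi m (d n m x).
Hypothesis Phi_e : forall n s a, v s -> Phi n (e n s a) = e' n s (phi s n a).
Hypothesis d'_supp : forall n m s s' a, v s -> v' s' -> ~ v s' ->
  c' m s' (d' n m (e' n s a)) = 0.
Hypothesis Q : forall s, v s -> qis (b s) (b' s) (phi s).

Let c'_Phi n s x : v s -> c' n s (Phi n x) = phi s n (c n s x).
Proof.
move=> vs; move: x; apply: (dc_span (tr_dec h n)) => [|x y hx hy|s' a vs'].
- rewrite (morphD0 (PhiD n)) (morphD0 (dc_add (tr_dec h' n) s)).
  by rewrite (morphD0 (dc_add (tr_dec h n) s)) (morphD0 (phiD s n)).
- by rewrite PhiD (dc_add (tr_dec h' n)) hx hy (dc_add (tr_dec h n)) phiD.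
rewrite Phi_e //; have [e0|ss'] := eqVneq s s'.
  by case: _ / e0 a => a; rewrite (dc_e (tr_dec h' n)) ?(dc_e (tr_dec h n)) //; apply: vv'.
by rewrite (dc_e0 (tr_dec h' n)) // (dc_e0 (tr_dec h n)) // (morphD0 (phiD s n)).
Qed.

(** Induction on a bound for the levels in x and x'. In the top level the cone equations are those
    of the pieces, solved by [Q]; subtracting the solution lowers the bound. T' may have pieces that
    T lacks: x' avoids them, and [d'_supp] preserves this. *)
Lemma triangular_qis (i j l m : int) (x : T l) (x' : T' j) :
  j = i + 1 -> l = j + 1 -> m = l + 1 -> d l m x = 0 -> d' j l x' = Phi l x ->
  (forall s, v' s -> ~ v s -> c' j s x' = 0) ->
  exists (y : T j) (y' : T' i), d j l y = x /\ Phi j y = x' + d' i j y'.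
Proof.
move=> ij jl lm dx dx' sx'.
have D0 := fun n m => morphD0 (tr_dadd h n m).
have D'0 := fun n m => morphD0 (tr_dadd h' n m).
have [L1 uL1 hL1] := decomp_supp (tr_dec h l) x.
have [L2 uL2 hL2] := decomp_supp (tr_dec h' j) x'.
(* The bound J is strict, so that J = 0 forces x and x' to vanish. *)
have [J hJ] : exists J, forall s, (J <= lev s)%N -> c l s x = 0 /\ c' j s x' = 0.
  exists (\max_(s <- L1 ++ L2) (lev s).+1)%N => s hs.
  have sL : s \notin L1 ++ L2.
    apply/negP => hL; move: hs; rewrite leqNgt => /negP; apply.
    exact: (leq_bigmax_seq (F := fun s => (lev s).+1)).
  by move: sL; rewrite mem_cat negb_or => /andP[/hL1 -> /hL2 ->].
clear L1 uL1 hL1 L2 uL2 hL2.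
elim: J x x' dx dx' sx' hJ => [|J IH] x x' dx dx' sx' hJ.
  have x0 : x = 0 by apply: (decomp_inj (tr_dec h l)) => s; apply: (hJ s _).1.
  have x'0 : x' = 0 by apply: (decomp_inj (tr_dec h' j)) => s; apply: (hJ s _).2.
  by exists 0, 0; rewrite x0 x'0 D0 D'0 (morphD0 (PhiD j)) addr0.
have [L1 uL1 hL1] := decomp_supp (tr_dec h l) x.
have [L2 uL2 hL2] := decomp_supp (tr_dec h' j) x'.
pose L := [seq s <- undup (L1 ++ L2) | (lev s == J) && `[< v s >]].
have uL : uniq L by rewrite filter_uniq // undup_uniq.
have Lv s : s \in L -> v s /\ lev s = J.
  by rewrite mem_filter => /andP[/andP[/eqP h1 /asboolP h2] _].
have nL s : v s -> lev s = J -> s \notin L -> c l s x = 0 /\ c' j s x' = 0.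
  move=> vs ls; rewrite mem_filter ls eqxx asboolT //= mem_undup mem_cat negb_or.
  by move=> /andP[/hL1 -> /hL2 ->].
have sol s : exists a : B s j * B' s i, s \in L ->
    b s j l a.1 = c l s x /\ phi s j a.1 = c' j s x' + b' s i j a.2.
  have [sL|sL] := boolP (s \in L); last by exists (0, 0).
  have [vs ls] := Lv s sL.
  have h1 : b s l m (c l s x) = 0.
    rewrite -(tr_coord h) // ?dx ?(morphD0 (dc_add (tr_dec h m) s)) // => s' hs'.
    by apply: (hJ s' _).1; rewrite -ls.
  have h2 : b' s j l (c' j s x') = phi s l (c l s x).
    rewrite -(tr_coord h') ?dx' ?c'_Phi //; first exact: vv'.
    by move=> s' hs'; apply: (hJ s' _).2; rewrite -ls.
  by have [a [a' [e1 e2]]] := Q vs ij jl lm h1 h2; exists (a, a').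
pose a s := sval (cid (sol s)).
have ha s : s \in L -> b s j l (a s).1 = c l s x /\ phi s j (a s).1 = c' j s x' + b' s i j (a s).2.
  by rewrite /a; case: cid.
pose y := \sum_(s <- L) e j s (a s).1.
pose y' := \sum_(s <- L) e' i s (a s).2.
have cy s : v s -> c j s y = if s \in L then (a s).1 else 0.
  by move=> vs; apply: (decomp_coord_sum (tr_dec h j) (fun s => (a s).1)).
have cy' s : v' s -> c' i s y' = if s \in L then (a s).2 else 0.
  by move=> vs; apply: (decomp_coord_sum (tr_dec h' i) (fun s => (a s).2)).
have Lhigh s : (J < lev s)%N -> (s \in L) = false.
  by move=> hs; apply/negP => /Lv[_ ls]; rewrite ls ltnn in hs.
have cyh s : (J < lev s)%N -> c j s y = 0.
  move=> hs; have [vs|vs] := pselect (v s); last exact: (decomp_c0 (tr_dec h j)).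
  by rewrite cy // Lhigh.
have cyh' s : (J < lev s)%N -> c' i s y' = 0.
  move=> hs; have [vs|vs] := pselect (v' s); last exact: (decomp_c0 (tr_dec h' i)).
  by rewrite cy' // Lhigh.
(* What remains of the cocycle after the level J solution (y, y') has been removed. *)
have [||||z [z' [hz hz']]] := IH (x - d j l y) (x' - Phi j y + d' i j y').
- by rewrite (morphDB (tr_dadd h l m)) dx (tr_dd h) subr0.
- by rewrite (tr_dadd h') (morphDB (tr_dadd h' j l)) (tr_dd h') addr0 dx' Phi_d (morphDB (PhiD l)).
- move=> s v's vs.
  rewrite (dc_add (tr_dec h' j)) (morphDB (dc_add (tr_dec h' j) s)) sx' // sub0r.
  have -> : c' j s (Phi j y) = 0.
    rewrite (morphD_sum _ _ (PhiD j)) (morphD_sum _ _ (dc_add (tr_dec h' j) s)).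
    rewrite big_seq big1 // => s' /Lv[vs' _]; rewrite Phi_e // (dc_e0 (tr_dec h' j)) //.
    by apply/eqP => ss'; apply: vs; rewrite ss'.
  rewrite oppr0 add0r (morphD_sum _ _ (tr_dadd h' i j)) (morphD_sum _ _ (dc_add (tr_dec h' j) s)).
  by rewrite big_seq big1 // => s' /Lv[vs' _]; apply: d'_supp.
- move=> s Js; have [v's|v's] := pselect (v' s); last first.
    have vs : ~ v s by move=> /vv'.
    by rewrite (decomp_c0 (tr_dec h l)) // (decomp_c0 (tr_dec h' j)).
  have [vs|vs] := pselect (v s); last first.
    split; first exact: (decomp_c0 (tr_dec h l)).
    rewrite (dc_add (tr_dec h' j)) (morphDB (dc_add (tr_dec h' j) s)) sx' // sub0r.
    have -> : c' j s (Phi j y) = 0.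
      rewrite (morphD_sum _ _ (PhiD j)) (morphD_sum _ _ (dc_add (tr_dec h' j) s)).
      rewrite big_seq big1 // => s' /Lv[vs' _]; rewrite Phi_e // (dc_e0 (tr_dec h' j)) //.
      by apply/eqP => ss'; apply: vs; rewrite ss'.
    rewrite oppr0 add0r (morphD_sum _ _ (tr_dadd h' i j)) (morphD_sum _ _ (dc_add (tr_dec h' j) s)).
    by rewrite big_seq big1 // => s' /Lv[vs' _]; apply: d'_supp.
  have e1 : c l s (d j l y) = b s j l (c j s y).
    by apply: (tr_coord h) => // s' hs'; apply: cyh; apply: leq_ltn_trans hs'.
  have e2 : c' j s (d' i j y') = b' s i j (c' i s y').
    by apply: (tr_coord h') => // s' hs'; apply: cyh'; apply: leq_ltn_trans hs'.
  rewrite (morphDB (dc_add (tr_dec h l) s)) e1 (dc_add (tr_dec h' j)).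
  rewrite (morphDB (dc_add (tr_dec h' j) s)) e2 c'_Phi // cy // cy' //.
  case: ifP => sL.
    have [-> ->] := ha s sL; rewrite subrr; split=> //.
    by rewrite opprD addrA subrr sub0r addNr.
  have [-> ->] : c l s x = 0 /\ c' j s x' = 0.
    move: Js; rewrite leq_eqVlt => /orP[/eqP Js|/hJ//]; apply: nL => //.
    by rewrite sL.
  rewrite (morphD0 (tr_badd h s j l)) (morphD0 (phiD s j)) (morphD0 (tr_badd h' s i j)).
  by rewrite !subr0 addr0.
exists (y + z), (y' + z'); split.
  by rewrite (tr_dadd h) hz addrC subrK.
have E (a0 x0 w : T' j) : a0 + (x0 - a0 + w) = x0 + w by rewrite addrA [a0 + _]addrC subrK.
by rewrite PhiD hz' (tr_dadd h') -addrA E.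
Qed.
End TriangularQis.

Section DirectSumInjection.
Variables (R : comPzRingType) (I : Type) (V : I -> lmodType R) (P : I -> Prop).
(** The cast is forced by the dependence of [V i] on the index; [dinj_ind] allows reasoning without
    computing it. *)
Definition dinj_fun (i : I) (v : V i) : prodm V :=
  fun j => if pselect (i = j) is left e then ecast z (V z) e v else 0.
Lemma dinj_same i (v : V i) : dinj_fun v i = v.
Proof. by rewrite /dinj_fun; case: pselect => // e; rewrite (Prop_irrelevance e erefl). Qed.
Lemma dinj_diff i j (v : V i) : i <> j -> dinj_fun v j = 0.
Proof. by rewrite /dinj_fun; case: pselect. Qed.
Lemma dinj_ind i (v : V i) (Q : forall j, V j -> Prop) :
  Q i v -> (forall j, Q j 0) -> forall j, Q j (dinj_fun v j).
Proof.
by move=> Qv Q0 j; rewrite /dinj_fun; case: pselect => // e; case: _ / e.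
Qed.
Fact dinj_supp i (v : V i) : P i -> finsupp_mem P (dinj_fun v).
Proof.
move=> Pi; split; last by move=> j; apply: (dinj_ind (Q := fun j x => x <> 0 -> P j)).
apply: (@sub_finite_set _ _ [set i]) => [j|]; last exact: finite_set1.
by apply: (dinj_ind (Q := fun j x => x <> 0 -> j = i)).
Qed.
Definition dinj_st i (Pi : P i) (v : V i) : dsum V P :=
  mksubm (W := dsum_submod V P) (dinj_supp v Pi).
Fact dinj_lin i (Pi : P i) : linear (dinj_st Pi).
Proof.
move=> a x y; apply: val_inj; apply: functional_extensionality_dep => j.
rewrite -[LHS]/(dinj_fun (a *: x + y) j) -[RHS]/(a *: dinj_fun x j + dinj_fun y j).
rewrite /dinj_fun; case: pselect => [e|_]; last by rewrite scaler0 addr0.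
by case: _ / e.
Qed.
Definition dinj i (Pi : P i) : {linear V i -> dsum V P} := mklin (dinj_lin Pi).
Definition dco_fun i (x : dsum V P) : V i := subm_val x i.
Fact dco_lin i : linear (dco_fun i). Proof. by []. Qed.
Definition dco i : {linear dsum V P -> V i} := mklin (dco_lin i).
Lemma dsum_inj (x y : dsum V P) : (forall i, dco i x = dco i y) -> x = y.
Proof. by move=> h; apply: val_inj; apply: functional_extensionality_dep. Qed.
Lemma dsum_ind (Q : dsum V P -> Prop) : Q 0 -> (forall x y, Q x -> Q y -> Q (x + y)) ->
  (forall i (Pi : P i) v, Q (dinj Pi v)) -> forall x, Q x.
Proof.
move=> Q0 QD Qi x; have [/(@finite_seqP {classic I})[s hs] Px] := submP x.
have hs' (i : I) : subm_val x i <> 0 -> (i : {classic I}) \in s.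
  by move=> hi; have : [set i | subm_val x i <> 0] i by []; rewrite hs.
elim: s x {hs} Px hs' => [|i s IH] x Px hs.
  suff -> : x = 0 by [].
  by apply: dsum_inj => i; rewrite linear0; apply: contrapT => /hs.
have [xi|xi] := pselect (subm_val x i = 0).
  by apply: IH => // j hj; move: (hs j hj); rewrite inE => /orP[/eqP e|//]; rewrite e in hj.
pose u : dsum V P := dinj (Px i xi) (dco i x).
rewrite -[x](subrK u); apply: QD; last exact: Qi.
have ne j : i <> j -> dco j u = 0 by move=> ij; apply: dinj_diff.
have same : dco i u = dco i x by apply: dinj_same.
have key j : subm_val (x - u) j <> 0 -> j <> i /\ subm_val x j <> 0.
  rewrite -[subm_val (x - u) j]/(dco j (x - u)) linearB.
  have [e|e] := pselect (i = j); first by rewrite -e same subrr.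
  by rewrite ne // subr0 => h; split=> // ji; apply: e.
apply: IH => [j /key[_]|j /key[ji hj]]; first exact: Px.
by move: (hs j hj); rewrite inE => /orP[/eqP|].
Qed.
End DirectSumInjection.

Arguments dco {R I V P} i.
Arguments dinj {R I V P i} Pi.

(** * Tensor products with a semifree complex, by cells *)

Section SemifreeTensor.
Variables (k : comPzRingType) (X : ringed_finite_space k) (N M : complex X) (q : X).
Local Notation F := (semifree N).
Local Notation T n := (tensor_complex F M n q).
Local Notation idr := (idfun : {rmorphism rs_O q -> rs_O q}).

Definition sfv (s : cell N) := wf s /\ spec (cpt s) q.
Lemma sfvP s : sfv s -> sfP (cdeg s) q s. Proof. by case. Qed.

Definition tc_idx (n : int) (s : cell N) : int * int := (cdeg s, n - cdeg s).
Fact tc_idx_sum n s : (tc_idx n s).1 + (tc_idx n s).2 = n.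
Proof. by rewrite addrC subrK. Qed.
(** A cell s contributes to degree n of the tensor product one copy of M in degree n - deg s, whose
    diagonal differential is that of M up to the sign [tc_sgn]. *)
Definition tc_c n s : {linear T n -> M (n - cdeg s) q} :=
  fcot (sfP (cdeg s) q) idr (M (n - cdeg s) q) s \o
  dco (V := fun ij => tc_bi F M ij q) (P := fun ij => ij.1 + ij.2 = n) (tc_idx n s).
Definition tc_pure_fun s j (a : M j q) : otensor (F (cdeg s)) (M j) q :=
  tpure idr (fbas (sfP (cdeg s) q) s : F (cdeg s) q) a.
Fact tc_pure_lin s j : linear (@tc_pure_fun s j).
Proof. by move=> a x y; rewrite /tc_pure_fun tpureDr tens_scale_pure. Qed.
Definition tc_e n s : {linear M (n - cdeg s) q -> T n} :=
  dinj (V := fun ij => tc_bi F M ij q) (P := fun ij => ij.1 + ij.2 = n) (tc_idx_sum n s)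
  \o mklin (@tc_pure_lin s (n - cdeg s)).
Definition tc_sgn (s : cell N) : rs_O q := (-1) ^+ `|cdeg s|%N.
Definition tc_b_fun (s : cell N) n m (a : M (n - cdeg s) q) : M (m - cdeg s) q :=
  tc_sgn s *: cx_d M (n - cdeg s) (m - cdeg s) q a.
Fact tc_b_lin s n m : linear (@tc_b_fun s n m).
Proof. by move=> a x y; rewrite /tc_b_fun linearP scalerDr !scalerA mulrC. Qed.
Definition tc_b s n m := mklin (@tc_b_lin s n m).

Lemma tc_e_ind n s a (Q : forall ij, tc_bi F M ij q -> Prop) :
  Q (tc_idx n s) (tc_pure_fun s a) -> (forall ij, Q ij 0) ->
  forall ij, Q ij (subm_val (tc_e n s a) ij).
Proof. by move=> h1 h0 ij; apply: (dinj_ind (V := fun ij => tc_bi F M ij q) (Q := Q)). Qed.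

Lemma tc_decomp n : decomp sfv (A := fun s => M (n - cdeg s) q)
  (fun s => tc_c n s) (fun s => tc_e n s).
Proof.
split=> [s|s|s a hs|s s' a ss'|P P0 PD Pe].
- exact: linearD.
- exact: linearD.
- rewrite -[LHS]/(fcot (sfP (cdeg s) q) idr _ s (dinj_fun
    (V := fun ij => tc_bi F M ij q) (i := tc_idx n s) (tc_pure_fun s a) (tc_idx n s))).
  rewrite dinj_same /tc_pure_fun fcot_pure fco_bas ?scale1r //.
  exact: sfvP.
- rewrite -[LHS]/(fcot (sfP (cdeg s) q) idr _ s (subm_val (tc_e n s' a) (tc_idx n s))).
  suff H ij : fcot (sfP ij.1 q) idr (M ij.2 q) s (subm_val (tc_e n s' a) ij) = 0.
    exact: (H (tc_idx n s)).
  move: ij; apply: (tc_e_ind (Q := fun ij x => fcot (sfP ij.1 q) idr (M ij.2 q) s x = 0)).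
    by rewrite fcot_pure fco_bas0 // scale0r.
  by move=> ij; rewrite linear0.
apply: (dsum_ind (V := fun ij => tc_bi F M ij q)) => // -[i j] ij w.
move: w; apply: (dc_span (fcot_decomp (sfP i q) idr (M j q))) => [|x y hx hy|s a hs].
- by rewrite linear0.
- by rewrite linearD; apply: PD.
have [ws ds ps] := hs; simpl in ij.
have E : j = n - cdeg s by rewrite -ij ds addrC addKr.
subst i; subst j; have := Pe s a (conj ws ps).
by congr P; congr dinj_st; apply: Prop_irrelevance.
Qed.

Fact tc_c_d n m s s' (a : M (n - cdeg s') q) :
    tc_c m s (cx_d (tensor_complex F M) n m q (tc_e n s' a)) =
    fcot (sfP (cdeg s) q) idr (M (m - cdeg s) q) s
      (tc_d1 (subm_val (tc_e n s' a)) (tc_idx m s)) +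
    tc_sgn s *: fcot (sfP (cdeg s) q) idr (M (m - cdeg s) q) s
      (tc_d2 (subm_val (tc_e n s' a)) (tc_idx m s)).
Proof.
rewrite -[LHS]/(fcot (sfP (cdeg s) q) idr _ s (tc_d_fam m (subm_val (tc_e n s' a)) (tc_idx m s))).
by rewrite /tc_d_fam tc_idx_sum eqxx linearD linearZ.
Qed.
Fact tc_c_d1 n m s s' (a : M (n - cdeg s') q) : sfv s -> sfv s' ->
    (forall l, @cface _ _ _ s' l != s) ->
    fcot (sfP (cdeg s) q) idr (M (m - cdeg s) q) s
      (tc_d1 (subm_val (tc_e n s' a)) (tc_idx m s)) = 0.
Proof.
move=> vs vs' ll.
have H : forall ij i', fcot (sfP i' q) idr (M ij.2 q) s 
    (ot_map (cx_d F ij.1 i') (ohom_id (M ij.2)) q (subm_val (tc_e n s' a) ij)) = 0.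
  move=> ij i'; move: ij; apply: (tc_e_ind (Q := fun ij x => fcot (sfP i' q) idr (M ij.2 q) s
    (ot_map (cx_d F ij.1 i') (ohom_id (M ij.2)) q x) = 0)) => [|ij]; last by rewrite !linear0.
  rewrite [ot_map _ _ _ _]ot_map_pure fcot_pure.
  rewrite [cx_d F _ _ _ _]sf_d_bas; last exact: sfvP.
  have [hs|hs] := pselect (sfP i' q s); last by rewrite fco0 // rmorph0 scale0r.
  rewrite fco_sf_bd // /bdc big1 ?rmorph0 ?scale0r // => l /eqP fl.
  by have := ll l; rewrite fl eqxx.
exact: (H (cdeg s - 1, m - cdeg s) (cdeg s)).
Qed.

Lemma tc_off n m s s' (a : M (n - cdeg s') q) : sfv s -> sfv s' -> s != s' ->
    (forall l, @cface _ _ _ s' l != s) ->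
  tc_c m s (cx_d (tensor_complex F M) n m q (tc_e n s' a)) = 0.
Proof.
move=> vs vs' ss' ll; rewrite tc_c_d tc_c_d1 // add0r.
have H : forall ij j', fcot (sfP ij.1 q) idr (M j' q) s (ot_map (ohom_id (F ij.1))
    (cx_d M ij.2 j') q (subm_val (tc_e n s' a) ij)) = 0.
  move=> ij j'; move: ij; apply: (tc_e_ind (Q := fun ij x => fcot (sfP ij.1 q) idr (M j' q) s
    (ot_map (ohom_id (F ij.1)) (cx_d M ij.2 j') q x) = 0)) => [|ij]; last by rewrite !linear0.
  by rewrite [ot_map _ _ _ _]ot_map_pure fcot_pure fco_bas0 // scale0r.
by rewrite (H (cdeg s, m - cdeg s - 1) (m - cdeg s)) scaler0.
Qed.

Lemma tc_triangular : triangular (@clev _ _ N) sfv (B := fun s n => M (n - cdeg s) q)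
  (fun n s => tc_c n s) (fun n s => tc_e n s)
  (fun n m => cx_d (tensor_complex F M) n m q) (fun s n m => tc_b s n m).
Proof.
split=> [n|n m|s n m|n m l x|n m s a nm vs|n m s s' a nm vs vs' ss' ll].
- exact: tc_decomp.
- exact: linearD.
- exact: linearD.
- exact: cx_dd.
- rewrite tc_c_d tc_c_d1 ?add0r //; last first.
    by move=> l'; apply/eqP => e; have := clev_face l'; rewrite e ltnn.
  congr (_ *: _).
  have H j : n - cdeg s = j -> fcot (sfP (cdeg s) q) idr (M (m - cdeg s) q) s
      (ot_map (ohom_id (F (cdeg s))) (cx_d M j (m - cdeg s)) q
      (subm_val (tc_e n s a) (cdeg s, j))) = cx_d M (n - cdeg s) (m - cdeg s) q a.
    move=> <-.
    have -> : subm_val (tc_e n s a) (cdeg s, n - cdeg s) = tc_pure_fun s a.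
      exact: (dinj_same (V := fun ij => tc_bi F M ij q) (i := tc_idx n s)).
    rewrite [ot_map _ _ _ _]ot_map_pure fcot_pure fco_bas ?scale1r //.
    exact: sfvP.
  by apply: H; rewrite /= nm addrAC addrK.
by apply: tc_off => // l'; apply/eqP => e; move: ll; rewrite -e clev_face.
Qed.

Lemma tc_sgnM s : tc_sgn s * tc_sgn s = 1.
Proof. by rewrite /tc_sgn -exprMn mulN1r opprK expr1n. Qed.

End SemifreeTensor.

Section SemifreeFlat.
Variables (k : comPzRingType) (X : ringed_finite_space k) (N : complex X).
Local Notation F := (semifree N).

(** For the map from the zero complex, [qis] means acyclicity of the target; by [triangular_qis] it
    suffices to check the pieces, which are shifts of M up to sign. *)
Lemma semifree_K_flat : K_flat F.
Proof.
move=> M /acyclicP aM; apply/acyclicP => q i j l ij jl x dx.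
(* Row vectors of length 0 serve as the zero group. *)
pose Z (n : int) : zmodType := 'rV[int]_0.
have Z0 n (z : Z n) : z = 0 by exact: thinmx0.
have := @triangular_qis _ (@clev _ _ N) (@sfv _ _ N q) (@sfv _ _ N q) (fun s h => h)
  Z _ (fun s n => Z n) (fun s n => M (n - cdeg s) q)
  (fun n s z => z) (fun n s z => z) (fun n m z => z) (fun s n m z => z)
  _ _ _ _ (fun n z => 0) (fun s n z => 0) _ (tc_triangular N M q).
move=> /(_ _ _ _ _ _ _ _ i j l (l + 1) 0 x ij jl erefl)[||||||||||y [y' [_ e]]] //.
- split=> [n|//|//|n m l' z|//|n m s s' a _ _ _ _ _]; try exact: Z0.
  by split=> // P P0 _ _ z; rewrite [z]Z0.
- by move=> n z z'; rewrite addr0.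
- by move=> s n z z'; rewrite addr0.
- by move=> n m z; rewrite linear0.
- by move=> n s a _; rewrite linear0.
- move=> s vs i1 j1 l1 m1 ij1 jl1 lm1 a a' _ /(congr1 (fun z => tc_sgn q s *: z)).
  rewrite scaler0 scalerA tc_sgnM scale1r => da.
  have e1 : j1 - cdeg s = i1 - cdeg s + 1 by rewrite ij1 addrAC.
  have e2 : l1 - cdeg s = j1 - cdeg s + 1 by rewrite jl1 addrAC.
  have [b hb] := aM q _ _ _ e1 e2 a' da.
  have E : tc_b M q s i1 j1 (tc_sgn q s *: b) = a'.
    rewrite -[LHS]/(tc_sgn q s *: cx_d M (i1 - cdeg s) (j1 - cdeg s) q (tc_sgn q s *: b)).
    by rewrite linearZ scalerA tc_sgnM scale1r.
  exists 0, (- (tc_sgn q s *: b)); split; first by rewrite [RHS]Z0.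
  by rewrite linearN E subrr.
exists (- y'); rewrite linearN; apply/eqP; rewrite eqr_oppLR; apply/eqP/(addrI x).
by rewrite -e subrr.
Qed.
End SemifreeFlat.

Section TensorBaseChange.
Variables (k : comPzRingType) (X : ringed_finite_space k) (N M M' : complex X).
Variables (p q : X) (h : spec p q).
Local Notation F := (semifree N).
Variable r : forall j, M j p -> M' j q.
Arguments r : clear implicits.
Hypothesis r_lin : forall j, semilinear (rs_res h) (r j).
Arguments r_lin : clear implicits.
Hypothesis r_d : forall i j x, cx_d M' i j q (r i x) = r j (cx_d M i j p x).
Local Notation idp := (idfun : {rmorphism rs_O p -> rs_O p}).
Local Notation idq := (idfun : {rmorphism rs_O q -> rs_O q}).

Definition tr_bi (i j : int) : otensor (F i) (M j) p -> otensor (F i) (M' j) q :=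
  tmap idp idq (om_res (o := F i) h) (r j).
Fact tr_bi_lin i j : semilinear (rs_res h) (@tr_bi i j).
Proof.
apply: (tmap_semilinear (alpha := rs_res h)) => //; exact: om_res_lin.
Qed.
Arguments tr_bi_lin : clear implicits.
Fact tr_bi_pure i j x y : @tr_bi i j (tpure idp x y) = tpure idq (om_res h x) (r j y).
Proof.
apply: (tmap_pure (alpha := rs_res h) (beta := rs_res h)) => //; exact: om_res_lin.
Qed.
Definition tr_fun n (t : tensor_complex F M n p) : prodm (fun ij => tc_bi F M' ij q) :=
  fun ij => @tr_bi ij.1 ij.2 (subm_val t ij).
Fact tr_supp n (t : tensor_complex F M n p) :
  finsupp_mem (fun ij => ij.1 + ij.2 = n) (tr_fun t).
Proof.
have [ft Pt] := submP t.
have key ij : tr_fun t ij <> 0 -> subm_val t ij <> 0.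
  by move=> hi ti; apply: hi; rewrite /tr_fun ti (semilin0 (tr_bi_lin _ _)).
by split=> [|ij /key/Pt//]; apply: sub_finite_set ft => ij /key.
Qed.
Definition tr n (t : tensor_complex F M n p) : tensor_complex F M' n q :=
  mksubm (W := dsum_submod _ _) (tr_supp t).
Fact tr_lin n : semilinear (rs_res h) (@tr n).
Proof. by move=> a s t; apply: odsum_inj => ij; apply: (tr_bi_lin ij.1 ij.2). Qed.
Arguments tr_lin : clear implicits.

Fact tr_bi_map i i' j j' (u : ohom (F i) (F i')) (v : ohom (M j) (M j'))
    (v' : ohom (M' j) (M' j')) x : (forall y, v' q (r j y) = r j' (v p y)) ->
  ot_map u v' q (@tr_bi i j x) = @tr_bi i' j' (ot_map u v p x).
Proof.
move=> hv; have L := tr_bi_lin.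
elim/ot_ind: x => [m n||x y hx hy].
- by rewrite ot_map_pure !tr_bi_pure ot_map_pure hv oh_nat.
- by rewrite linear0 !(semilin0 (L _ _)) linear0.
- by rewrite linearD !(semilinD (L _ _)) linearD hx hy.
Qed.
Fact tr_d n m t :
  cx_d (tensor_complex F M') n m q (tr t) = tr (cx_d (tensor_complex F M) n m p t).
Proof.
apply: odsum_inj => ij.
rewrite -[LHS]/(tc_d_fam m (tr_fun t) ij).
rewrite -[RHS]/(@tr_bi ij.1 ij.2 (tc_d_fam m (subm_val t) ij)).
rewrite /tc_d_fam; case: eqP => _; last by rewrite (semilin0 (tr_bi_lin _ _)).
rewrite (semilinD (tr_bi_lin _ _)) (semilinZ (tr_bi_lin _ _)) rmorphXn rmorphN1.
congr (_ + _ *: _).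
  by rewrite /tc_d1 /tr_fun; apply: tr_bi_map.
by rewrite /tc_d2 /tr_fun; apply: tr_bi_map => y; apply: r_d.
Qed.

Definition trB n : {linear tens (rs_res h) (tensor_complex F M n p) (rs_O q)^o ->
  tensor_complex F M' n q} := bcmap (tr_lin n).
Definition rB j : {linear tens (rs_res h) (M j p) (rs_O q)^o -> M' j q} := bcmap (r_lin j).
Local Notation idB := (idfun : {linear (rs_O q)^o -> (rs_O q)^o}).

Definition cell_supported n (x : tensor_complex F M' n q) :=
  forall s, sfv q s -> ~ spec (cpt s) p -> tc_c M' q n s x = 0.

Lemma sfv_res (s : cell N) : sfv p s -> sfv q s.
Proof. by move=> [ws sp]; split=> //; apply: spec_trans sp h. Qed.

Fact rs_res_sgn (s : cell N) : rs_res h (tc_sgn p s) = tc_sgn q s.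
Proof. by rewrite /tc_sgn rmorphXn rmorphN1. Qed.

Fact tmapl_tc_b (s : cell N) n m x : tmapl (rs_res h) (tc_b M p s n m) idB x =
  tc_sgn q s *: tmapl (rs_res h) (cx_d M (n - cdeg s) (m - cdeg s) p) idB x.
Proof.
move: x; apply: tens_ext => [x y|x y|x y]; first by rewrite linearD.
  by rewrite linearD scalerDr.
by rewrite !tmapl_pure tens_scale_pure -rs_res_sgn -tpureZ.
Qed.

Fact tens_triangular : triangular (@clev _ _ N) (@sfv _ _ N p)
  (B := fun s n => tens (rs_res h) (M (n - cdeg s) p) (rs_O q)^o)
  (fun n s => tmapl (rs_res h) (tc_c M p n s) idB)
  (fun n s => tmapl (rs_res h) (tc_e M p n s) idB)
  (fun n m => tmapl (rs_res h) (cx_d (tensor_complex F M) n m p) idB)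
  (fun s n m => tmapl (rs_res h) (tc_b M p s n m) idB).
Proof.
have h1 := tc_triangular N M p.
split=> [n|n m|s n m|n m l x|n m s a nm vs|n m s s' a nm vs vs' ss' ll].
- exact: (decomp_tens _ _ (tr_dec h1 n)).
- exact: linearD.
- exact: linearD.
- rewrite (tmapl_comp (u'' := cx_d (tensor_complex F M) m l p \o cx_d (tensor_complex F M) n m p)
    (v'' := idB)) // tmapl0l // => y; exact: cx_dd.
- move: a; apply: tens_ext => [x y|x y|x y]; try by rewrite !linearD.
  by rewrite !tmapl_pure (tr_diag h1).
- move: a; apply: (tens_ext (g := fun=> 0)) => [x y|x y|x y]; first by rewrite !linearD.
    by rewrite addr0.
  by rewrite !tmapl_pure (tr_off h1) // tpure0l.
Qed.

Hypothesis Q : @qis (fun j => tens (rs_res h) (M j p) (rs_O q)^o) (fun j => M' j q)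
  (fun i j => tmapl (rs_res h) (cx_d M i j p) idB) (fun i j => cx_d M' i j q)
  (fun j => rB j).

(** On the piece of a cell over p the comparison is, up to sign, base change for M, a
    quasi-isomorphism by [Q]. Cells not over p have no counterpart in the source, whence the
    condition on the support of x'. *)
Lemma tensor_bc_qis (i j l m : int) (x : tens (rs_res h) (tensor_complex F M l p) (rs_O q)^o)
    (x' : tensor_complex F M' j q) : j = i + 1 -> l = j + 1 -> m = l + 1 ->
  tmapl (rs_res h) (cx_d (tensor_complex F M) l m p) idB x = 0 ->
  cx_d (tensor_complex F M') j l q x' = trB l x -> cell_supported x' ->
  exists y (y' : tensor_complex F M' i q),
    tmapl (rs_res h) (cx_d (tensor_complex F M) j l p) idB y = x /\
    trB j y = x' + cx_d (tensor_complex F M') i j q y'.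
Proof.
move=> ij jl lm dx dx' sx'.
apply: (triangular_qis sfv_res tens_triangular (tc_triangular N M' q)
  (Phi := fun n => trB n) (phi := fun s n => rB (n - cdeg s)) _ _ _ _ _ _ ij jl lm dx dx').
- by move=> n; apply: linearD.
- by move=> s n; apply: linearD.
- by move=> n m'; apply: bc_sq => y; apply: tr_d.
- move=> n s a vs; move: a; apply: tens_ext => [x1 y|x1 y|a b]; try by rewrite !linearD.
  rewrite tmapl_pure [LHS]bcmap_pure [rB _ _]bcmap_pure linearZ; congr (_ *: _).
  apply: odsum_inj => ij0.
  rewrite -[LHS]/(@tr_bi ij0.1 ij0.2 (dinj_fun (V := fun ij => tc_bi F M ij p)
    (i := tc_idx n s) (tc_pure_fun s a) ij0)).
  rewrite -[RHS]/(dinj_fun (V := fun ij => tc_bi F M' ij q)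
    (i := tc_idx n s) (tc_pure_fun s (r _ a)) ij0).
  have [e|e] := pselect (tc_idx n s = ij0); last first.
    by rewrite !dinj_diff // (semilin0 (tr_bi_lin _ _)).
  rewrite -e !dinj_same /tc_pure_fun tr_bi_pure; congr (tpure _ _ _).
  by have [ws sp] := vs; apply: sf_res_bas.
- move=> n m' s s' a [ws sp] vs' ns'.
  have vs : sfv q s by apply: sfv_res.
  apply: tc_off => // [|l']; apply/eqP => e; apply: ns'.
    by rewrite e.
  have [_ _ fs] := wf_face l' ws.
  by split; [case: vs'|rewrite -e; apply: spec_trans fs sp].
- move=> s vs i1 j1 l1 m1 ij1 jl1 lm1 a a'; rewrite tmapl_tc_b => da da'.
  have inv (V : lmodType (rs_O q)) (z : V) : tc_sgn q s *: (tc_sgn q s *: z) = z.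
    by rewrite scalerA tc_sgnM scale1r.
  have sh a0 b0 : b0 = a0 + 1 -> b0 - cdeg s = a0 - cdeg s + 1 by move=> ->; rewrite addrAC.
  (* Multiplication by the sign, which squares to 1, turns the cone equations of the piece into
     those of M. *)
  have da2 : tmapl (rs_res h) (cx_d M (l1 - cdeg s) (m1 - cdeg s) p) idB (tc_sgn q s *: a) = 0.
    by rewrite linearZ.
  have da'2 : cx_d M' (j1 - cdeg s) (l1 - cdeg s) q a' = rB (l1 - cdeg s) (tc_sgn q s *: a).
    by rewrite linearZ -[rB _ a]da' /= [RHS]inv.
  have [y [y0 [hy hy0]]] := Q (sh _ _ ij1) (sh _ _ jl1) (sh _ _ lm1) da2 da'2.
  exists y, (tc_sgn q s *: y0); rewrite tmapl_tc_b hy inv; split=> //.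
  rewrite hy0; congr (_ + _).
  by rewrite linearZ_LR -[tc_b M' q s i1 j1 y0]/(tc_sgn q s *: cx_d M' _ _ q y0) inv.
- by move=> s vs ns; apply: sx' => // sp; apply: ns; split=> //; case: vs.
Qed.
End TensorBaseChange.

(** * Contraction of a semifree resolution *)

Lemma addr_sub3 (V : zmodType) (x1 x2 y1 y2 z1 z2 : V) :
  (x1 + x2) - (y1 + y2) - (z1 + z2) = (x1 - y1 - z1) + (x2 - y2 - z2).
Proof. by rewrite !opprD (addrACA x1 x2) (addrACA (x1 - y1)). Qed.

(* If N has quasi-coherent cohomology then so has its semifree resolution F, so the
   quotient of F_q by the span of the cells over p is acyclic, hence contractible. *)
Section Contraction.
Variables (k : comPzRingType) (X : ringed_finite_space k) (N : complex X).
Variables (p q : X) (h : spec p q).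
Local Notation F := (semifree N).
Local Notation e n c := (fbas (sfP n q) (c : cell N) : F n q).

Definition sf_over n (x : F n q) :=
  forall c, sfP n q c -> ~ spec (cpt c) p -> fco (sfP n q) c x = 0.
Lemma sf_over0 n : @sf_over n 0. Proof. by move=> c _ _; rewrite linear0. Qed.
Lemma sf_overD n x y : @sf_over n x -> @sf_over n y -> @sf_over n (x + y).
Proof. by move=> hx hy c h1 h2; rewrite linearD hx ?hy ?addr0. Qed.
Lemma sf_overZ n a x : @sf_over n x -> @sf_over n (a *: x).
Proof. by move=> hx c h1 h2; rewrite fcoZ hx ?[LHS]mulr0. Qed.
Lemma sf_over_bas n c : spec (cpt c) p -> @sf_over n (e n c).
Proof.
by move=> cp c' _ hc'; rewrite fco_bas0 //; apply/eqP => ce; apply: hc'; rewrite ce.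
Qed.

Lemma sfP_res n (c : cell N) : sfP n p c -> sfP n q c.
Proof. by move=> [h1 h2 h3]; split=> //; apply: spec_trans h3 h. Qed.

Lemma bcm_sf_inj n : injective (bcm (F n) h).
Proof.
apply: morphD_inj => [x y|x x0]; first exact: linearD.
apply: (decomp_inj (fcot_decomp (sfP n p) (rs_res h) (rs_O q)^o)) => c.
suff -> : fcot (sfP n p) (rs_res h) (rs_O q)^o c x = fco (sfP n q) c (bcm (F n) h x).
  by rewrite x0 linear0.
move: x {x0}; apply: tens_ext => [x y|x y|m b]; try by rewrite !linearD.
by rewrite fcot_pure [bcm _ _ _]bcmap_pure fcoZ sf_resE mulrC.
Qed.

Lemma bcm_sf_over n x : sf_over (bcm (F n) h x).
Proof.
elim/tens_ind: x => [m b||x y hx hy].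
- rewrite [bcm _ _ _]bcmap_pure; apply: sf_overZ => c hc hp.
  by rewrite [om_res _ _]/(sf_res h m) sf_resE fco0 ?rmorph0 // => -[_ _ /hp].
- by rewrite linear0; apply: sf_over0.
- by rewrite linearD; apply: sf_overD.
Qed.

Lemma sf_over_bcm n x : @sf_over n x -> exists y, bcm (F n) h y = x.
Proof.
move=> hx; have [L uL hL] := freem_supp (x : sf_st N n q).
rewrite (freem_sum uL hL); elim: L {uL hL} => [|c L [y hy]].
  by exists 0; rewrite big_nil linear0.
rewrite big_cons -hy.
have [cp|cp] := pselect (spec (cpt c) p); last first.
  exists y; have [hc|hc] := pselect (sfP n q c); first by rewrite hx // scale0r add0r.
  by rewrite fbas0 // scaler0 add0r.
have [hc|hc] := pselect (sfP n q c); last by exists y; rewrite fbas0 // scaler0 add0r.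
exists (tpure (rs_res h) (fbas (sfP n p) c : F n p) (fco (sfP n q) c x : (rs_O q)^o) + y).
rewrite linearD; congr (_ + _).
rewrite [LHS]bcmap_pure; congr (_ *: _); apply: sf_res_bas => //.
by case: hc.
Qed.

Lemma fext_bd_eq m (V : lmodType (rs_O q)) (u u' : cell N -> V) c :
  (forall l, u (@cface _ _ _ c l) = u' (cface l)) ->
  fext (sfP m q) u (sf_bd m q c) = fext (sfP m q) u' (sf_bd m q c).
Proof.
move=> uu'; rewrite /sf_bd !linear_sum; apply: eq_bigr => l _; rewrite !linearZ_LR.
have [hl|hl] := pselect (sfP m q (cface l)); last by rewrite fbas0 // !linear0.
by rewrite !fext_bas // uu'.
Qed.

Hypothesis Q : @qis (fun i => tens (rs_res h) (F i p) (rs_O q)^o) (fun i => F i q)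
  (fun i j => bcx_d F h i j) (fun i j => cx_d F i j q) (fun i => bcm (F i) h).

(** The contraction is chosen on the basis by recursion on the level, as 0 on the cells over p. For
    another cell c, u = e_c - hh (d e_c) has its boundary in the span over p, so [Q] puts u + d y'
    in that span for some y', and hh e_c is - y'. *)
Lemma sf_contraction : exists hh : forall i j, {linear F i q -> F j q},
  (forall j l t, l = j + 1 -> hh l j (om_res (o := F l) h t) = 0) /\
  (forall j l m x, l = j + 1 -> m = l + 1 ->
    sf_over (x - cx_d F j l q (hh l j x) - hh m l (cx_d F l m q x))).
Proof.
(* The index (j, c) stands for the component in degree j of hh at the basis vector of c; it is
   constrained only when c has degree j + 1. *)
pose S := (int * cell N)%type.
pose D (s : S) : Type := F s.1 q.
pose ex (H : forall s, D s) l m : {linear F m q -> F l q} :=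
  fext (sfP m q) (fun c => H (l, c) : F l q).
pose R (H : forall s, D s) (s : S) (y : D s) := forall l m, l = s.1 + 1 -> m = l + 1 ->
  sfP l q s.2 -> (spec (cpt s.2) p -> y = 0) /\
  sf_over (e l s.2 - cx_d F s.1 l q y - ex H l m (cx_d F l m q (e l s.2))).
have [|H [j c] IH|H hH] := @level_recursion S (fun s => clev s.2) D R (fun s => 0).
- move=> H H' [j c] y hH hR l m lj ml hc; have [h1 h2] := hR l m lj ml hc; split=> //.
  move: h2; rewrite /ex [cx_d F l m q _]sf_d_bas //.
  rewrite (@fext_bd_eq m (F l q) (fun c => H (l, c)) (fun c => H' (l, c))) // => l'.
  exact: (hH (l, cface l') (clev_face l')).
- have [hc|nc] := pselect (sfP (j + 1) q c); last first.
    by exists 0 => l m lj _ hc; case: nc; rewrite -lj.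
  have [wc dc cq] := hc.
  pose l := j + 1; pose m := l + 1; pose m' := m + 1.
  pose u := e l c - ex H l m (cx_d F l m q (e l c)).
  (* The faces of a cell over p are over p, so hh vanishes on them too. *)
  have [cp|cp] := pselect (spec (cpt c) p).
    exists 0 => l1 m1 /= -> -> _; split=> //.
    rewrite linear0 subr0; apply: sf_overD; first exact: sf_over_bas.
    suff -> : ex H l m (cx_d F l m q (e l c)) = 0 by rewrite oppr0; apply: sf_over0.
    rewrite [cx_d F l m q _]sf_d_bas // /sf_bd linear_sum big1 // => l' _.
    have [wl dl ll] := wf_face l' wc.
    rewrite linearZ_LR [ex _ _ _ _]fext_bas; last first.
      by split=> //; [rewrite dl dc|apply: spec_trans ll cq].
    rewrite (_ : H (l, cface l') = 0) ?scaler0 //.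
    apply: (proj1 (IH (l, cface l') (clev_face l') m m' erefl erefl _)).
      by split=> //; [rewrite dl dc|apply: spec_trans ll cq].
    exact: spec_trans ll cp.
  have du : sf_over (cx_d F l m q u).
    (* [G v] is the homotopy formula at v. It holds on the faces by induction, hence on d e_c, where
       it says that d u lies in the span over p because d d = 0. *)
    pose G (v : F m q) := sf_over (v - cx_d F l m q (ex H l m v) - ex H m m' (cx_d F m m' q v)).
    have G0 : G 0 by rewrite /G !linear0 ?subr0 ?addr0; apply: sf_over0.
    have GP a v w : G v -> G w -> G (a *: v + w).
      move=> /(sf_overZ a) gv gw; have := sf_overD gv gw; rewrite /G.
      rewrite [ex H l m (_ + _)]linearP [cx_d F l m q (_ + _)]linearP.
      by rewrite [cx_d F m m' q (_ + _)]linearP [ex H m m' (_ + _)]linearP addr_sub3 !scalerBr.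
    have Gd : G (cx_d F l m q (e l c)).
      rewrite [cx_d F l m q _]sf_d_bas // /sf_bd; elim/big_rec: _ => // l' v _ gv.
      apply: GP => //; have [wl dl ll] := wf_face l' wc.
      have hl : sfP m q (cface l').
        by split=> //; [rewrite dl dc|apply: spec_trans ll cq].
      have [_] := IH (l, cface l') (clev_face l') m m' erefl erefl hl.
      by rewrite /G [ex H l m _]fext_bas.
    move: Gd; rewrite /G cx_dd linear0 subr0; congr sf_over.
    by rewrite /u linearB.
  have [x hx] := sf_over_bcm du.
  have dx : bcx_d F h m m' x = 0.
    apply: bcm_sf_inj; rewrite linear0 -(bcm_nat (v := cx_d F m m' q)) ?hx ?cx_dd //.
    by move=> t; apply: oh_nat.
  have [y [y' [_ hy]]] := Q (erefl l) (erefl m) (erefl m') dx (esym hx).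
  exists (- y') => l1 m1 /= -> -> _; split=> //.
  rewrite linearN opprK addrAC -/u -hy; exact: bcm_sf_over.
exists (fun i j => ex H j i); split=> [j l t lj|j l m x lj ml].
  move: t; apply: (freem_ext (Pd := sfP l p) (g := fun=> 0)) => [x y|x y|c a hc].
  - by rewrite (semilinD (om_res_lin h)) linearD.
  - by rewrite addr0.
  rewrite (semilinZ (om_res_lin h)) linearZ_LR; have [wc dc cp] := hc.
  rewrite [om_res h _]sf_res_bas // [ex _ _ _ _]fext_bas; last exact: sfP_res.
  rewrite (_ : H (j, c) = 0) ?scaler0 //.
  exact: (proj1 (hH (j, c) l _ lj erefl (sfP_res hc))).
move: x; apply: (freem_ind (Pd := sfP l q)) => [|x y hx hy|c a hc].
- by rewrite !linear0 ?subr0 ?addr0; apply: sf_over0.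
- have := sf_overD hx hy; congr sf_over; rewrite -addr_sub3.
  by congr (_ - _ - _); rewrite !linearD.
- have [_ h2] := hH (j, c) l m lj ml hc.
  have := sf_overZ a h2; congr sf_over; rewrite !scalerBr; congr (_ - _ - _).
    by rewrite 2!linearZ_LR [ex H j l _]fext_bas.
  by rewrite !linearZ_LR.
Qed.
End Contraction.

(** * Inverse images of semifree complexes *)

Section PullbackSemifree.
Variables (k : comPzRingType) (X Y : ringed_finite_space k) (f : morphism X Y).
Variable N : complex Y.
Local Notation F := (semifree N).
Local Notation C := (pull_cx f F : complex X).

Section Restriction.
Variables (x x' : X) (h : spec x x').
Local Notation h' := (@spec_mor _ _ _ f _ _ h).
Local Notation sh := (mor_sharp f x').
Local Notation chi := (rs_res h \o mor_sharp f x : {rmorphism rs_O (f x) -> rs_O x'}).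
Local Notation idX := (idfun : {linear (rs_O x')^o -> (rs_O x')^o}).
Local Notation Phi n := (bcm (C n) h).

Definition pull_sf_res n : tens chi (F n (f x)) (rs_O x')^o -> tens sh (F n (f x')) (rs_O x')^o :=
  tmap chi sh (om_res (o := F n) h') idX.
Fact pull_sf_sq a : (idfun : {rmorphism rs_O x' -> rs_O x'}) (chi a) = sh (rs_res h' a).
Proof. exact: mor_res. Qed.
Fact pull_sf_lin : semilinear (idfun : {rmorphism rs_O x' -> rs_O x'}) idX.
Proof. by []. Qed.
Lemma pull_sf_res_pure n m b :
  @pull_sf_res n (tpure chi m b) = tpure sh (om_res h' m : F n (f x')) b.
Proof. exact: (tmap_pure pull_sf_sq (om_res_lin h') pull_sf_lin). Qed.
Lemma pull_sf_resD n : {morph @pull_sf_res n : a b / a + b}.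
Proof. exact: (tmapD pull_sf_sq (om_res_lin h') pull_sf_lin). Qed.

(** The basis at f x is part of the basis at f x', so every coordinate of [z] can be read on its
    image. *)
Lemma pull_sf_res_inj n : injective (@pull_sf_res n).
Proof.
apply: morphD_inj => [|z z0]; first exact: pull_sf_resD.
apply: (decomp_inj (fcot_decomp (sfP n (f x)) chi (rs_O x')^o)) => c.
suff -> : fcot (sfP n (f x)) chi (rs_O x')^o c z =
    fcot (sfP n (f x')) sh (rs_O x')^o c (pull_sf_res z) by rewrite z0 linear0.
move: z {z0}; apply: tens_ext => [a b|a b|m b]; try by rewrite ?pull_sf_resD linearD.
rewrite pull_sf_res_pure !fcot_pure; congr (_ *: _).
by rewrite [om_res _ _]/(sf_res h' m) sf_resE /= (mor_res h h').
Qed.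

(** Transitivity of base change eliminates the ring at x: base change of the pullback becomes a
    restriction of F from f x to f x', with coefficients in the ring at x'. *)
Lemma pull_sf_bcm n z :
  Phi n z = pull_sf_res (tassoc chi z).
Proof.
have aD := @tassocD _ _ _ (mor_sharp f x) (rs_res h) chi (fun=> erefl) (F n (f x)) (rs_O x')^o.
move: z; apply: tens_ext => [a b|a b|w b].
- exact: linearD.
- by rewrite aD pull_sf_resD.
move: w; apply: (tens_ext (f := fun w => Phi n (tpure (rs_res h) w b))
    (g := fun w => pull_sf_res (tassoc chi (tpure (rs_res h) w b)))).
- by move=> u v; rewrite tpureDl linearD.
- by move=> u v; rewrite tpureDl aD pull_sf_resD.
move=> m s; rewrite tassoc_pure // pull_sf_res_pure [LHS]bcmap_pure.
rewrite [om_res _ _]pull_res_pure [LHS]tens_scale_pure.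
by congr (tpure _ _ _); exact: mulrC.
Qed.

Lemma pull_bcm_inj n : injective (Phi n).
Proof.
have aK := @tassocK _ _ _ (mor_sharp f x) (rs_res h) chi (fun=> erefl) (F n (f x)) (rs_O x')^o.
move=> z w; rewrite [LHS]pull_sf_bcm [RHS]pull_sf_bcm => /pull_sf_res_inj.
exact: (can_inj aK).
Qed.

Lemma pull_over_bcm n w b : sf_over (f x) w ->
  exists z, Phi n z = tpure sh (w : F n (f x')) (b : (rs_O x')^o).
Proof.
move=> /(sf_over_bcm h')[y <-] {w}; elim/tens_ind: y => [m b0||u v [a ha] [c hc]].
- exists (tpure (rs_res h) (tpure (mor_sharp f x) m (1 : (rs_O x)^o) : C n x)
    (sh b0 * (b : rs_O x') : (rs_O x')^o)).
  rewrite [LHS]bcmap_pure [om_res _ _]pull_res_pure [LHS]tens_scale_pure.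
  rewrite [bcm _ _ _]bcmap_pure tpureZ; congr (tpure _ _ _).
  by rewrite rmorph1; exact: (mulr1 (_ : rs_O x')).
- by exists 0; rewrite !linear0 tpure0l.
- by exists (a + c); rewrite !linearD tpureDl ha hc.
Qed.

(** The contraction tensored with the identity, [H], vanishes on the image of [Phi]. For a cocycle
    (z, z') of the cone, z' - d (H z') thus lies in that image, and injectivity of [Phi] shows that
    its preimage has differential z. *)
Lemma pull_semifree_qis (Q : @qis (fun i => tens (rs_res h') (F i (f x)) (rs_O (f x'))^o)
    (fun i => F i (f x')) (fun i j => bcx_d F h' i j) (fun i j => cx_d F i j (f x'))
    (fun i => bcm (F i) h')) :
  @qis (fun i => tens (rs_res h) (C i x) (rs_O x')^o) (fun i => C i x')
    (fun i j => bcx_d C h i j) (fun i j => cx_d C i j x') (fun i => bcm (C i) h).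
Proof.
have [hh [hh0 hhc]] := sf_contraction Q.
pose H i j : {linear C i x' -> C j x'} := tmapl sh (hh i j) idX.
have H0 j l z : l = j + 1 -> H l j (Phi l z) = 0.
  move=> lj; move: z; apply: (tens_ext (g := fun=> 0)) => [a b|a b|w b].
  - by rewrite !linearD.
  - by rewrite addr0.
  rewrite [bcm _ _ _]bcmap_pure linearZ_LR (_ : H l j _ = 0) ?scaler0 //.
  move: w; apply: (tens_ext (g := fun=> 0) (f := fun w => H l j (om_res (o := C l) h w))).
  - by move=> u v; rewrite (semilinD (om_res_lin h)) linearD.
  - by move=> u v; rewrite addr0.
  move=> m s; rewrite [om_res _ _]pull_res_pure [LHS]tmapl_pure.
  by rewrite (hh0 j l) // tpure0l.
have Hc j l m z : l = j + 1 -> m = l + 1 ->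
    exists y, Phi l y = z - cx_d C j l x' (H l j z) - H m l (cx_d C l m x' z).
  move=> lj ml; elim/tens_ind: z => [w b||u v [a ha] [c hc]].
  - have [y hy] := pull_over_bcm b (hhc j l m w lj ml); exists y; rewrite hy.
    have dE i1 j1 u : cx_d C i1 j1 x' (tpure sh u b) =
        tpure sh (cx_d F i1 j1 (f x') u : F j1 (f x')) b by exact: pull_map_pure.
    have HE i1 j1 u : H i1 j1 (tpure sh u b) = tpure sh (hh i1 j1 u : F j1 (f x')) b.
      exact: tmapl_pure.
    by rewrite HE !dE HE !tpureDl !tpureNl.
  - by exists 0; rewrite !linear0 ?subr0 ?addr0.
  - exists (a + c); rewrite linearD ha hc -addr_sub3.
    by congr (_ - _ - _); rewrite !linearD.
move=> i j l m ij jl lm z z' dz dz'.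
have [y hy] := Hc i j l z' ij jl.
exists y, (- H j i z'); split; last first.
  by rewrite hy dz' H0 // subr0 linearN.
apply: (@pull_bcm_inj l).
rewrite -(bcm_nat (v := cx_d C j l x')) => [|t]; last exact: oh_nat.
rewrite hy dz' H0 // subr0 linearB dz' (_ : cx_d C j l x' _ = 0) ?subr0 //.
exact: cx_dd.
Qed.
End Restriction.

Lemma pull_semifree_qc : finite_space X -> finite_space Y ->
  qc_cohomology F -> qc_cohomology C.
Proof.
move=> fX fY /(qc_cohomologyP _ fY) qc; apply/(qc_cohomologyP _ fX) => x x' h.
exact/pull_semifree_qis/qc.
Qed.
End PullbackSemifree.

(** * Quasi-coherence of a tensor product with a semifree complex *)

Section TensorSemifree.
Variables (k : comPzRingType) (X : ringed_finite_space k) (N M : complex X).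
Local Notation F := (semifree N).
Local Notation C := (tensor_complex F M).

Section Restriction.
Variables (p q : X) (h : spec p q).
Local Notation idr := (idfun : {rmorphism rs_O q -> rs_O q}).
Variable hh : forall i j, {linear F i q -> F j q}.
Arguments hh : clear implicits.
Hypothesis hh0 : forall j l t, l = j + 1 -> hh l j (om_res (o := F l) h t) = 0.
Hypothesis hhc : forall j l m x, l = j + 1 -> m = l + 1 ->
  sf_over p (x - cx_d F j l q (hh l j x) - hh m l (cx_d F l m q x)).

Definition th i j b : {linear tc_bi F M (i, b) q -> tc_bi F M (j, b) q} :=
  tmapl idr (hh i j) (idfun : {linear M b q -> M b q}).
(** This is hh (x) 1 on the total complex. It carries no sign, as hh acts on the left factor. *)
Definition tH_fam (m : int) (t : prodm (fun ij => tc_bi F M ij q)) :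
    prodm (fun ij => tc_bi F M ij q) :=
  fun ij => if ij.1 + ij.2 == m then th (ij.1 + 1) ij.1 ij.2 (t (ij.1 + 1, ij.2)) else 0.
Fact tH_supp n m (t : C n q) : finsupp_mem (fun ij => ij.1 + ij.2 = m) (tH_fam m (subm_val t)).
Proof.
have [ft Pt] := submP t; split; last by move=> ij; rewrite /tH_fam; case: eqP.
apply: (@sub_finite_set _ _ ((fun ij : int * int => (ij.1 - 1, ij.2)) @`
    [set ij | subm_val t ij <> 0])); last exact: finite_image.
move=> [i j] /=; rewrite /tH_fam /=; case: eqP => // _ ne.
exists (i + 1, j); last by rewrite /= addrK.
by move=> /= e; apply: ne; rewrite e linear0.
Qed.
Definition tH n m (t : C n q) : C m q := mksubm (W := dsum_submod _ _) (tH_supp m t).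

Fact tH_bcm n m x : tH m (bcm (C n) h x) = 0.
Proof.
apply: odsum_inj => -[i j].
rewrite -[LHS]/(tH_fam m (subm_val (bcm (C n) h x)) (i, j)) -[RHS]/(0 : tc_bi F M (i, j) q).
rewrite /tH_fam; case: eqP => // _; rewrite [_.1]/= [_.2]/=.
pose G (t : C n q) := th (i + 1) i j (subm_val t (i + 1, j)).
have GD : {morph G : a b / a + b} by move=> a b; rewrite /G -linearD.
have GZ a t : G (a *: t) = a *: G t by rewrite /G -linearZ.
rewrite -/(G _); move: x; apply: (tens_ext (g := fun=> 0)) => [a b|a b|t b].
- by rewrite linearD GD.
- by rewrite addr0.
rewrite [bcm _ _ _]bcmap_pure GZ (_ : G _ = 0) ?scaler0 //.
rewrite -[G _]/(th (i + 1) i j (om_res (o := tc_bi F M (i + 1, j)) h (subm_val t (i + 1, j)))).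
elim/ot_ind: (subm_val t (i + 1, j)) => [a c||a c ha hc].
- by rewrite [om_res _ _]ot_res_pure [LHS]tmapl_pure hh0 // tpure0l.
- by rewrite (semilin0 (om_res_lin h)) linear0.
- by rewrite (semilinD (om_res_lin h)) linearD ha hc addr0.
Qed.

(** The mixed terms in hh and the differential of M cancel by the sign convention. What remains is
    (1 - d hh - hh d) (x) 1, whose coordinates at cells not over p are 0. *)
Fact tH_supported i j l t : j = i + 1 -> l = j + 1 ->
  cell_supported p (t - cx_d C i j q (tH i t) - tH j (cx_d C j l q t)).
Proof.
move=> ij jl s vs sp.
pose a := cdeg s; pose b := j - cdeg s.
have ab : a + b = j by rewrite /a /b addrC subrK.
pose t' := subm_val t.
have -> : tc_c M q j s (t - cx_d C i j q (tH i t) - tH j (cx_d C j l q t)) =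
  fcot (sfP a q) idr (M b q) s (t' (a, b) - tc_d_fam j (tH_fam i t') (a, b)
     - tH_fam j (tc_d_fam l t') (a, b)) by [].
have e1 : a - 1 + b = i by rewrite addrAC ab ij addrK.
have e2 : a + (b - 1) = i by rewrite addrA ab ij addrK.
have e3 : a + 1 + b = l by rewrite addrAC ab jl.
have K1 a' : a' = a -> ot_map (cx_d F (a - 1) a) (ohom_id (M b)) q (th a' (a - 1) b (t' (a', b))) =
    tmapl idr (cx_d F (a - 1) a q \o hh a (a - 1)) (idfun : {linear M b q -> M b q}) (t' (a, b)).
  by move=> ->; apply: tmapl_comp.
have K2 a' : a' = a -> th (a + 1) a b (ot_map (cx_d F a' (a + 1)) (ohom_id (M b)) q (t' (a', b))) =
    tmapl idr (hh (a + 1) a \o cx_d F a (a + 1) q) (idfun : {linear M b q -> M b q}) (t' (a, b)).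
  by move=> ->; apply: tmapl_comp.
have K3 w : ot_map (ohom_id (F a)) (cx_d M (b - 1) b) q (th (a + 1) a (b - 1) w) =
    th (a + 1) a b (ot_map (ohom_id (F (a + 1))) (cx_d M (b - 1) b) q w).
  rewrite [LHS](tmapl_comp (u'' := hh (a + 1) a) (v'' := cx_d M (b - 1) b q)) //.
  by rewrite [RHS](tmapl_comp (u'' := hh (a + 1) a) (v'' := cx_d M (b - 1) b q)).
have K4 : (-1) ^+ `|(a + 1)%R|%N = - (-1) ^+ `|a|%N :> rs_O q.
  by rewrite -[in RHS](addrK 1 a) sign_pred opprK.
have -> : tc_d_fam j (tH_fam i t') (a, b) =
    ot_map (cx_d F (a - 1) a) (ohom_id (M b)) q (th (a - 1 + 1) (a - 1) b (t' (a - 1 + 1, b))) +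
    (-1) ^+ `|a|%N *: ot_map (ohom_id (F a)) (cx_d M (b - 1) b) q
      (th (a + 1) a (b - 1) (t' (a + 1, b - 1))).
  by rewrite /tc_d_fam /tc_d1 /tc_d2 /tH_fam /= ab eqxx e1 e2 eqxx.
have -> : tH_fam j (tc_d_fam l t') (a, b) = th (a + 1) a b
    (ot_map (cx_d F (a + 1 - 1) (a + 1)) (ohom_id (M b)) q (t' (a + 1 - 1, b)) +
    (-1) ^+ `|(a + 1)%R|%N *: ot_map (ohom_id (F (a + 1))) (cx_d M (b - 1) b) q
      (t' (a + 1, b - 1))).
  by rewrite /tH_fam /= ab eqxx /tc_d_fam /= e3 eqxx.
rewrite [th (a + 1) a b (_ + _)]linearD [th (a + 1) a b (_ *: _)]linearZ_LR
  K1 ?subrK // K2 ?addrK // K3 K4 scaleNr.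
have E (V : zmodType) (x1 x2 x3 x4 : V) : x1 - (x2 + x3) - (x4 - x3) = x1 - x2 - x4.
  by rewrite opprB opprD (addrA x1) -(addrA (x1 - x2)) addKr.
rewrite E {E}.
move: (t' (a, b)) => w {e1 e2 e3 K1 K2 K3 K4 t'}.
pose T1 := tmapl idr (cx_d F (a - 1) a q \o hh a (a - 1)) (idfun : {linear M b q -> M b q}).
pose T2 := tmapl idr (hh (a + 1) a \o cx_d F a (a + 1) q) (idfun : {linear M b q -> M b q}).
move: w; apply: (tens_ext (g := fun=> 0)
  (f := fun w => fcot (sfP a q) idr (M b q) s (w - T1 w - T2 w))).
- move=> u v; rewrite -linearD -addr_sub3; congr (fcot _ _ _ _ _); congr (_ - _ - _).
    exact: linearD.
  exact: linearD.
- by move=> u v; rewrite addr0.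
move=> w n; rewrite !tmapl_pure -!tpureNl -!tpureDl fcot_pure.
rewrite (hhc (j := a - 1) (l := a) (m := a + 1)) ?scale0r ?subrK //; exact: sfvP.
Qed.
End Restriction.

(** The homotopy moves x' into the span of the cells over p without changing its differential, after
    which [tensor_bc_qis] applies. *)
Lemma tensor_semifree_qc : finite_space X ->
  qc_cohomology F -> qc_cohomology M -> qc_cohomology C.
Proof.
move=> fX /(qc_cohomologyP _ fX) qF /(qc_cohomologyP _ fX) qM.
apply/(qc_cohomologyP _ fX) => p q h.
have [hh [hh0 hhc]] := sf_contraction (qF p q h).
move=> i j l m ij jl lm x x' dx dx'.
pose H n n' := @tH q hh n n'.
have H0 n n' y : H n n' (bcm (C n) h y) = 0 by exact: tH_bcm.
pose x2 := x' - cx_d C i j q (H j i x') - H l j (cx_d C j l q x').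
have dx2 : cx_d C j l q x2 = bcm (C l) h x.
  by rewrite /x2 dx' H0 subr0 linearB cx_dd subr0.
have sx2 : cell_supported p x2 by exact: tH_supported.
have rl j' : semilinear (rs_res h) (om_res (o := M j') h) by exact: om_res_lin.
have rd i' j' (z : M i' p) : cx_d M i' j' q (om_res h z) = om_res h (cx_d M i' j' p z).
  by rewrite oh_nat.
have E n z : trB N rl n z = bcm (C n) h z.
  move: z; apply: tens_ext => [u v|u v|t c]; try exact: linearD.
  by rewrite [LHS]bcmap_pure [RHS]bcmap_pure; congr (_ *: _); apply: odsum_inj.
rewrite -E in dx2.
have [y [y' [hy hy']]] := @tensor_bc_qis _ _ N M M p q h (fun j => om_res h) rl rd
  (qM p q h) i j l m x x2 ij jl lm dx dx2 sx2.
exists y, (y' - H j i x'); split=> //.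
by rewrite -E hy' /x2 dx' H0 subr0 linearB -addrA [- _ + _]addrC.
Qed.
End TensorSemifree.

(** * Characters with values in Q/Z *)

Definition rat_int (x : zmodule rat) : Prop := exists n : int, x = n%:~R :> rat.
Fact rat_int0 : rat_int 0. Proof. by exists 0. Qed.
Fact rat_intP (a : int) u v : rat_int u -> rat_int v -> rat_int (a *: u + v).
Proof. move=> [m ->] [n ->]; exists (a * m + n).
rewrite -[LHS]/((m%:~R : rat) *~ a + n%:~R); by rewrite intrD intrM mulrzl. Qed.
Definition rat_int_mod : submodule (zmodule rat) := Submodule rat_int0 rat_intP.
Definition QZ : zmodType := quotm rat_int_mod.
Definition toQZ (x : rat) : QZ := \pi_(quotm rat_int_mod) (x : zmodule rat).
Lemma toQZD : {morph toQZ : x y / x + y}. Proof. by move=> x y; exact: pi_quotm_add. Qed.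
Lemma toQZ_eq0 x : toQZ x = 0 <-> rat_int x.
Proof.
by have := quotmP rat_int_mod (x : zmodule rat) 0; rewrite subr0; apply.
Qed.
Lemma toQZMn x n : toQZ (x *+ n) = toQZ x *+ n.
Proof.
elim: n => [|n IH]; first by rewrite !mulr0n; apply: (morphD0 toQZD).
by rewrite !mulrS toQZD IH.
Qed.

Lemma QZ_divisible (n : nat) (y : QZ) : (0 < n)%N -> exists z : QZ, z *+ n = y.
Proof.
move=> n0; elim/quotm_ind: y => x; exists (toQZ ((x : rat) / n%:R)).
rewrite -toQZMn -(mulr_natr (_ / _)) divfK //.
by rewrite Num.Theory.pnatr_eq0 -lt0n.
Qed.

Lemma QZ_torsion (n : nat) : (1 < n)%N ->
  exists d : QZ, d <> 0 /\ forall k : int, (n %| `|k|)%N -> d *~ k = 0.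
Proof.
move=> n1; have n0 : (n%:R : rat) != 0 by rewrite Num.Theory.pnatr_eq0 -lt0n ltnW.
exists (toQZ n%:R^-1); split.
  move=> /toQZ_eq0[m hm].
  have : (m * n%:Z)%:~R = (1 : int)%:~R :> rat by rewrite intrM -hm mulVf.
  move=> /eqP; rewrite eqr_int => /eqP /(congr1 (fun z => `|z|%N)).
  rewrite abszM /= => /eqP; rewrite muln_eq1 => /andP[_ /eqP e].
  by rewrite e in n1.
have h (k : nat) : (n %| k)%N -> toQZ n%:R^-1 *+ k = 0.
  move=> /dvdnP[r ->]; rewrite -toQZMn; apply/toQZ_eq0; exists r.
  by rewrite mulnC mulrnA -[_^-1 *+ n]mulr_natr mulVf.
move=> [k|k] hk; first by rewrite -pmulrn; apply: h.
by rewrite NegzE mulrNz -pmulrn h ?oppr0 //; rewrite NegzE abszN in hk.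
Qed.

Section CharacterExtension.
Variables (G : zmodType) (Gam : G -> QZ -> Prop).
(** A partial homomorphism is encoded as its graph, an additive and single-valued relation: its
    domain need not be made into a group, and chains are bounded by unions. *)
Record partial_char (D : G -> QZ -> Prop) : Prop := PartialChar {
  pc0 : D 0 0;
  pcB : forall a u b v, D a u -> D b v -> D (a - b) (u - v);
  pcF : forall u, D 0 u -> u = 0 }.
Hypothesis hG : partial_char Gam.

Fact pcN D a u : partial_char D -> D a u -> D (- a) (- u).
Proof. by move=> h hu; have := pcB h (pc0 h) hu; rewrite !sub0r. Qed.
Fact pcD D a u b v : partial_char D -> D a u -> D b v -> D (a + b) (u + v).
Proof. by move=> h hu hv; have := pcB h hu (pcN h hv); rewrite !opprK. Qed.
Fact pcMn D a u (n : nat) : partial_char D -> D a u -> D (a *+ n) (u *+ n).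
Proof.
move=> h hu; elim: n => [|n IH]; first by rewrite !mulr0n; apply: pc0.
by rewrite !mulrS; apply: pcD.
Qed.
Fact pc_fun D a u v : partial_char D -> D a u -> D a v -> u = v.
Proof.
by move=> h hu hv; apply: subr0_eq; apply: (pcF h); have := pcB h hu hv; rewrite subrr.
Qed.

Lemma partial_char_extend1 D g : partial_char D -> exists D', [/\ partial_char D',
  forall a u, D a u -> D' a u & exists u, D' g u].
Proof.
move=> h.
(* [d] is the value to be given at g. If n is the least positive integer such that n g is in the
   domain, it is an n-th part of the value there; otherwise 0 will do. *)
have [d hd] : exists d : QZ, forall k u, D (g *~ k) u -> u = d *~ k.
  have [ex|nex] := pselect (exists n : nat, `[< (0 < n)%N /\ exists u, D (g *+ n) u >]); last first.
    exists 0 => -[[|k]|k] u hu; first by rewrite mul0rz; apply: (pcF h); rewrite mulr0z in hu.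
      by case: nex; exists k.+1; apply/asboolP; split=> //; exists u.
    case: nex; exists k.+1; apply/asboolP; split=> //; exists (- u).
    by have := pcN h hu; rewrite NegzE mulrNz opprK.
  case: (ex_minnP ex) => n /asboolP[n0 [u0 hu0]] nmin.
  have [d hd] := QZ_divisible u0 n0; exists d => k u hu.
  have key (m : nat) v : D (g *+ m) v -> v = d *+ m.
    move=> hv; rewrite {1}(divn_eq m n) in hv.
    have hq := pcMn (m %/ n) h hu0.
    have := pcB h hv hq; rewrite -mulrnA mulnC mulrnDr addrAC subrr add0r => hr.
    have r0 : (m %% n)%N = 0%N.
      apply/eqP; apply: contraT; rewrite -lt0n => r0.
      have := nmin (m %% n)%N; rewrite asboolT; last by split=> //; eexists; exact: hr.
      by move=> /(_ isT); rewrite leqNgt ltn_mod n0.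
    rewrite r0 mulr0n in hr; have /eqP := pcF h hr; rewrite subr_eq0 => /eqP ->.
    by rewrite -hd -mulrnA [in RHS](divn_eq m n) r0 addn0 mulnC.
  case: k hu => m hu; first exact: key hu.
  rewrite NegzE mulrNz -[u]opprK; congr (- _); apply: key.
  by have := pcN h hu; rewrite NegzE mulrNz opprK.
exists (fun a u => exists b v k, [/\ D b v, a = b + g *~ k & u = v + d *~ k]); split.
- split=> [|a u b v|u].
  + by exists 0, 0, 0; rewrite !mulr0z !addr0; split=> //; apply: pc0.
  + move=> [a1 [u1 [k [h1 -> ->]]]] [b1 [v1 [k' [h2 -> ->]]]].
    exists (a1 - b1), (u1 - v1), (k - k'); split; first exact: pcB.
      by rewrite mulrzBr opprD addrACA.
    by rewrite mulrzBr opprD addrACA.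
  + move=> [b [v [k [hb e ->]]]].
    have eb : - b = g *~ k by apply/eqP; rewrite eq_sym -addr_eq0 addrC -e.
    by have := pcN h hb; rewrite eb => /hd <-; rewrite subrr.
- by move=> a u hu; exists a, u, 0; rewrite !mulr0z !addr0.
- by exists d, 0, 0, 1; rewrite !mulr1z !add0r; split=> //; apply: pc0.
Qed.

Lemma character_extension : exists psi : G -> QZ, {morph psi : x y / x + y} /\
  forall a u, Gam a u -> psi a = u.
Proof.
pose T := {D : G -> QZ -> Prop | partial_char D /\ forall a u, Gam a u -> D a u}.
pose R : rel T := fun s t => `[< forall a u, sval s a u -> sval t a u >].
have t0 : T by exists Gam.
have [||A tA|t tmax] := @ZL_preorder T t0 R.
- by move=> t; apply/asboolP.
- by move=> r s t /asboolP h1 /asboolP h2; apply/asboolP => a u /h1/h2.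
(* Including [Gam] covers the empty chain. *)
- pose U a u := Gam a u \/ exists2 s : T, A s & sval s a u.
  have up (s : T) a u : Gam a u -> sval s a u by case: s => D [h1 h2] /=; apply: h2.
  have pairU a u b v : U a u -> U b v -> (Gam a u /\ Gam b v) \/
      exists2 s : T, A s & sval s a u /\ sval s b v.
    move=> [h1|[s As h1]] [h2|[s' As' h2]].
    + by left.
    + by right; exists s' => //; split=> //; apply: up.
    + by right; exists s => //; split=> //; apply: up.
    + right; case: (tA s s' As As') => /asboolP h.
        by exists s' => //; split=> //; apply: h.
      by exists s => //; split=> //; apply: h.
  have hU : partial_char U /\ forall a u, Gam a u -> U a u.
    split; last by left.
    split=> [|a u b v h1 h2|u [hu|[s As hu]]].
    + by left; apply: pc0.
    + have [[h3 h4]|[s As [h3 h4]]] := pairU _ _ _ _ h1 h2.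
        by left; apply: pcB.
      by right; exists s => //; apply: (pcB (proj1 (svalP s))).
    + exact: (pcF hG).
    + exact: (pcF (proj1 (svalP s))).
  exists (exist _ U hU) => s As; apply/asboolP => a u hu; right; by exists s.
have [ht tG] := svalP t.
have tot g : exists u, sval t g u.
  have [D' [hD' sub [u hu]]] := partial_char_extend1 g ht.
  have h' : partial_char D' /\ forall a u, Gam a u -> D' a u.
    by split=> // a v /tG/sub.
  have /asboolP le : R (exist _ D' h') t.
    by apply: tmax; apply/asboolP.
  by exists u; apply: le.
have [psi hpsi] := choice tot.
exists psi; split=> [x y|a u hu].
  exact: (pc_fun ht (hpsi _) (pcD ht (hpsi x) (hpsi y))).
exact: (pc_fun ht (hpsi a) (tG _ _ hu)).
Qed.
End CharacterExtension.

(** The cyclic group generated by x modulo B has a character that is nonzero at x, and it extends to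
    G because Q/Z is divisible. *)
Lemma character_separates (G : zmodType) (B : G -> Prop) (x : G) : B 0 ->
  (forall a b, B a -> B b -> B (a - b)) -> ~ B x ->
  exists psi : G -> QZ, [/\ {morph psi : x y / x + y}, forall b, B b -> psi b = 0 & psi x <> 0].
Proof.
move=> B0 BB nBx.
have BN a : B a -> B (- a) by move=> /(BB _ _ B0); rewrite sub0r.
have BD a b : B a -> B b -> B (a + b) by move=> ha /BN/(BB _ _ ha); rewrite opprK.
have BMn a (n : nat) : B a -> B (a *+ n).
  by move=> ha; elim: n => [|n IH]; rewrite ?mulr0n // mulrS; apply: BD.
have Babs (k : int) : B (x *~ k) -> B (x *+ `|k|%N).
  by case: k => k //; rewrite NegzE mulrNz abszN => /BN; rewrite opprK.
have [n n1 hn] : exists2 n : nat, (1 < n)%N & forall k : int, B (x *~ k) -> (n %| `|k|)%N.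
  have [ex|nex] := pselect (exists n : nat, `[< (0 < n)%N /\ B (x *+ n) >]); last first.
    (* If no positive multiple of x lies in B, any n > 1 would do; 2 is chosen. *)
    exists 2%N => // k /Babs hk; have [->//|k0] := eqVneq `|k|%N 0%N.
    by case: nex; exists `|k|%N; apply/asboolP; rewrite lt0n.
  case: (ex_minnP ex) => n /asboolP[n0 hn] nmin; exists n.
    rewrite ltn_neqAle n0 andbT; apply/eqP => n1; apply: nBx.
    by move: hn; rewrite -n1 mulr1n.
  move=> k /Babs hk; apply: contraT; rewrite /dvdn -lt0n => r0.
  have hr : B (x *+ (`|k| %% n)%N).
    rewrite {1}(divn_eq `|k|%N n) mulrnDr in hk.
    have := BB _ _ hk (BMn _ (`|k| %/ n)%N hn).
    by rewrite -mulrnA mulnC addrAC subrr add0r.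
  have := nmin (`|k| %% n)%N; rewrite asboolT //.
  by move=> /(_ isT); rewrite leqNgt ltn_mod n0.
have [d [d0 hd]] := QZ_torsion n1.
have [|psi [psiD hpsi]] := @character_extension G
    (fun a u => exists b k, [/\ B b, a = b + x *~ k & u = d *~ k]).
  split=> [|a u b v|u].
  - by exists 0, 0; rewrite !mulr0z addr0.
  - move=> [a1 [k [h1 -> ->]]] [b1 [k' [h2 -> ->]]].
    exists (a1 - b1), (k - k'); split; first exact: BB.
      by rewrite mulrzBr opprD addrACA.
    by rewrite mulrzBr.
  - move=> [b [k [hb e ->]]]; apply/hd/hn.
    have <- : - b = x *~ k by apply/eqP; rewrite eq_sym -addr_eq0 addrC -e.
    exact: BN.
exists psi; split=> // [b Bb|].
  by apply: hpsi; exists b, 0; rewrite !mulr0z addr0.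
rewrite (hpsi x d) //; exists 0, 1; rewrite !mulr1z add0r.
by split.
Qed.

(** * K-injective resolutions *)

Section Coinduced.
Variable R : comPzRingType.
Definition coind_mem (f : prodm (fun _ : R => QZ)) : Prop := {morph f : a b / a + b}.
Fact coind_mem0 : coind_mem 0. Proof. by move=> a b; rewrite addr0. Qed.
Fact coind_memP (n : int) u v : coind_mem u -> coind_mem v -> coind_mem (n *: u + v).
Proof.
move=> hu hv a b; rewrite -[LHS]/(n *: u (a + b) + v (a + b)).
by rewrite hu hv scalerDr addrACA.
Qed.
Definition coind_mod : submodule (prodm (fun _ : R => QZ)) := Submodule coind_mem0 coind_memP.
(** The alias forgets the integer module structure of [subm], so that an R-module structure can be
    declared on the same group. *)
Definition coind : Type := subm coind_mod.
HB.instance Definition _ := GRing.Zmodule.on coind.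
Definition coev (f : coind) (a : R) : QZ := subm_val f a.
Lemma coevD f : {morph coev f : a b / a + b}.
Proof. exact: (submP f). Qed.
Lemma coev_inj (f g : coind) : (forall a, coev f a = coev g a) -> f = g.
Proof. by move=> h; apply: val_inj; apply: functional_extensionality_dep. Qed.
Definition mkcoind (f : R -> QZ) (fD : {morph f : a b / a + b}) : coind :=
  mksubm (W := coind_mod) (fD : coind_mem f).
Lemma coevE f (fD : {morph f : a b / a + b}) a : coev (mkcoind fD) a = f a.
Proof. by []. Qed.
Lemma coev_addl (f g : coind) a : coev (f + g) a = coev f a + coev g a.
Proof. by []. Qed.
Fact coind_scale_add (c : R) (f : coind) : {morph (fun a => coev f (a * c)) : a b / a + b}.
Proof. by move=> a b; rewrite mulrDl coevD. Qed.
Definition coind_scale (c : R) (f : coind) : coind := mkcoind (coind_scale_add c f).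
Fact coind_scaleA a b v : coind_scale a (coind_scale b v) = coind_scale (a * b) v.
Proof. by apply: coev_inj => c; rewrite !coevE mulrA. Qed.
Fact coind_scale1 : left_id 1 coind_scale.
Proof. by move=> v; apply: coev_inj => c; rewrite coevE mulr1. Qed.
Fact coind_scaleDr : right_distributive coind_scale +%R.
Proof. by move=> a u v; apply: coev_inj => c. Qed.
Fact coind_scaleDl v : {morph coind_scale^~ v : a b / a + b}.
Proof.
by move=> a b; apply: coev_inj => c; rewrite coev_addl !coevE mulrDr coevD.
Qed.
HB.instance Definition _ := GRing.Zmodule_isLmodule.Build R coind
  coind_scaleA coind_scale1 coind_scaleDr coind_scaleDl.
Lemma coevZ c (f : coind) a : coev (c *: f) a = coev f (a * c).
Proof. by []. Qed.
End Coinduced.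

(* The product over the indices c of the sheaves i_* (Hom_Z (O_(pt c), Q/Z)),
   i being the inclusion of pt c. *)
Section Cofree.
Variables (k : comPzRingType) (X : ringed_finite_space k) (C : Type) (pt : C -> X).

Section Sections.
Variables (W : X -> Prop) (R : comPzRingType) (rho : forall p, W p -> {rmorphism R -> rs_O p}).
Definition cofW : lmodType R := prodm (fun i : {c | W (pt c)} =>
  rscal (rho (proj2_sig i)) (coind (rs_O (pt (sval i))))).
Definition cev (t : cofW) c (Wc : W (pt c)) : coind (rs_O (pt c)) := t (exist _ c Wc).
Lemma cofW_inj (s t : cofW) : (forall c Wc, @cev s c Wc = @cev t c Wc) -> s = t.
Proof. by move=> h; apply: functional_extensionality_dep => -[c Wc]; apply: h. Qed.
Definition mkcofW (f : forall c, W (pt c) -> coind (rs_O (pt c))) : cofW :=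
  fun i => f (sval i) (proj2_sig i).
Arguments mkcofW : clear implicits.
Lemma cev_mk f c Wc : @cev (mkcofW f) c Wc = f c Wc.
Proof. by []. Qed.
Lemma cevD s t c Wc : @cev (s + t) c Wc = cev s Wc + cev t Wc.
Proof. by []. Qed.
Lemma cevN s c Wc : @cev (- s) c Wc = - cev s Wc.
Proof. by []. Qed.
Lemma cev0 c Wc : @cev 0 c Wc = 0.
Proof. by []. Qed.
Lemma cevZ a s c Wc : @cev (a *: s) c Wc = rho Wc a *: cev s Wc.
Proof. by []. Qed.
End Sections.
Arguments mkcofW {W R rho} f.

Definition cof_st (q : X) : lmodType (rs_O q) := cofW (W := spec q) (fun p h => rs_res h).
Definition cof_res (p q : X) (h : spec p q) (t : cof_st p) : cof_st q :=
  mkcofW (fun c qc => cev t (spec_trans h qc)).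
Fact cof_res_lin (p q : X) (h : spec p q) : semilinear (rs_res h) (cof_res h).
Proof.
move=> a u v; apply: cofW_inj => c qc.
rewrite [LHS]cev_mk [RHS]cevD [cev (_ *: _) _ in RHS]cevZ !cev_mk cevD cevZ.
by rewrite (rs_res_comp h qc (spec_trans h qc)).
Qed.
Fact cof_res_id (p : X) (h : spec p p) t : cof_res h t = t.
Proof.
apply: cofW_inj => c pc; rewrite cev_mk.
by rewrite (Prop_irrelevance (spec_trans h pc) pc).
Qed.
Fact cof_res_comp (p q r : X) (h : spec p q) (h' : spec q r) (h'' : spec p r) t :
  cof_res h' (cof_res h t) = cof_res h'' t.
Proof.
apply: cofW_inj => c pc; rewrite !cev_mk.
by rewrite (Prop_irrelevance (spec_trans h (spec_trans h' pc)) (spec_trans h'' pc)).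
Qed.
Definition cofree : omodule X := OModule cof_res_lin cof_res_id cof_res_comp.
Lemma cev_res (p q : X) (h : spec p q) (t : cofree p) c qc pc :
  cev (om_res h t : cof_st q) qc = @cev _ _ _ (t : cof_st p) c pc.
Proof. by rewrite cev_mk (Prop_irrelevance (spec_trans h qc) pc). Qed.

Variable A : omodule X.
Section Map.
Variable chi : forall c, A (pt c) -> QZ.
Arguments chi : clear implicits.
Hypothesis chiD : forall c, {morph chi c : x y / x + y}.
Fact cof_map_add (q : X) (x : A q) c (qc : spec q (pt c)) :
  {morph (fun b : rs_O (pt c) => chi c (b *: om_res qc x)) : a b / a + b}.
Proof. by move=> a b; rewrite scalerDl chiD. Qed.
Definition cof_map_fun (q : X) (x : A q) : cof_st q :=
  mkcofW (fun c qc => mkcoind (@cof_map_add q x c qc)).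
Fact cof_map_lin (q : X) : linear (@cof_map_fun q).
Proof.
move=> a x y; apply: cofW_inj => c qc; apply: coev_inj => b.
rewrite cevD coev_addl [in RHS]cevZ coevZ !cev_mk !coevE.
by rewrite om_res_lin scalerDr chiD /= scalerA.
Qed.
Fact cof_map_nat (p q : X) (h : spec p q) x :
  om_res (o := cofree) h (mklin (@cof_map_lin p) x) = mklin (@cof_map_lin q) (om_res h x).
Proof.
apply: cofW_inj => c qc; apply: coev_inj => b.
rewrite (cev_res h _ _ (spec_trans h qc)) !cev_mk !coevE.
by rewrite (om_res_comp h qc (spec_trans h qc)).
Qed.
(** One direction of the adjunction: a morphism to [cofree] amounts to a character of the stalk of A
    at each [pt c]. The converse is [cchar] with [cof_ohomE]. *)
Definition cof_map : ohom A cofree := @OHom _ _ A cofree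
  (fun q => mklin (@cof_map_lin q)) (@cof_map_nat).
Lemma cof_mapE (q : X) (x : A q) c (qc : spec q (pt c)) b :
  coev (cev (cof_map q x : cof_st q) qc) b = chi c (b *: om_res qc x).
Proof. by []. Qed.
End Map.

Definition cchar (f : ohom A cofree) c (x : A (pt c)) : QZ :=
  coev (cev (f (pt c) x : cof_st (pt c)) (@spec_refl X (pt c))) 1.
Fact ccharD f c : {morph @cchar f c : x y / x + y}.
Proof. by move=> x y; rewrite /cchar linearD cevD coev_addl. Qed.
Lemma cof_ohomE (f : ohom A cofree) (q : X) (x : A q) c (qc : spec q (pt c)) b :
  coev (cev (f q x : cof_st q) qc) b = cchar f (b *: om_res qc x).
Proof.
rewrite /cchar linearZ cevZ coevZ mul1r rs_res_id -oh_nat.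
by rewrite (cev_res qc (f q x) _ qc).
Qed.
End Cofree.
Arguments cofree {k X C} pt.
Arguments cev {k X C pt W R rho} t c Wc.
Arguments mkcofW {k X C pt W R rho} f.

Section KInjective.
Variables (k : comPzRingType) (X : ringed_finite_space k).
Variables (C : int -> Type) (pt : forall n, C n -> X) (lev : forall n, C n -> nat).
Arguments pt : clear implicits.
Arguments lev : clear implicits.
Local Notation I n := (cofree (pt n)).
Variable d : forall i j, ohom (I i) (I j).
Hypothesis d0 : forall i j, j != i + 1 -> forall p m, d i j p m = 0.
Hypothesis dd : forall i j l p m, d j l p (d i j p m) = 0.
Hypothesis d_lev : forall i j (c : C j) (w w' : I i (pt j c)),
  (forall c' (h : spec (pt j c) (pt i c')), (lev i c' < lev j c)%N ->
    cev (w : cof_st (pt i) _) c' h = cev (w' : cof_st (pt i) _) c' h) ->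
  cev (d i j _ w : cof_st (pt j) _) c (@spec_refl X (pt j c)) =
  cev (d i j _ w' : cof_st (pt j) _) c (@spec_refl X (pt j c)).

(** The component at c of the homotopy is a character of A with prescribed values [g] on boundaries.
    It extends to the stalk of A because Q/Z is divisible, once [g] is known to kill cycles; [g]
    uses components of lower level only, by [d_lev]. *)
Lemma cofree_K_injective : K_injective (Complex d0 dd).
Proof.
move=> A /acyclicP aA f.
pose S := {i : int & {j : int & C j}}.
pose si (s : S) := projT1 s.
pose sj (s : S) := projT1 (projT2 s).
pose sc (s : S) : C (sj s) := projT2 (projT2 s).
pose mkS i j (c : C j) : S := existT _ i (existT _ j c).
pose D (s : S) : Type := {psi : A (si s) (pt _ (sc s)) -> QZ | {morph psi : x y / x + y}}.
pose hs (H : forall s, D s) i j : ohom (A i) (I j) :=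
  @cof_map _ _ (C j) (pt j) (A i) (fun c => sval (H (mkS i j c))) (fun c => svalP (H (mkS i j c))).
pose fc j (c : C j) (x : A j (pt j c)) : QZ := cchar (f j : ohom (A j) (I j)) x.
pose dc i j (c : C j) (w : I i (pt j c)) : QZ :=
  coev (cev (d i j _ w : cof_st (pt j) _) c (@spec_refl X (pt j c))) 1.
have dcD i j c : {morph @dc i j c : x y / x + y}.
  by move=> x y; rewrite /dc linearD cevD coev_addl.
pose Q (H : forall s, D s) (s : S) (psi : D s) := si s = sj s + 1 ->
  forall x : A (sj s) (pt _ (sc s)), sval psi (cx_d A (sj s) (si s) _ x) =
    fc _ (sc s) x - dc (sj s - 1) (sj s) (sc s) (hs H (sj s) (sj s - 1) _ x).
have D0 s : D s by exists (fun=> 0) => x y; rewrite addr0.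
have [||H hH] := @level_recursion S (fun s => lev _ (sc s)) D Q D0.
- move=> H H' s psi hh hQ e x; rewrite hQ //; congr (_ - _).
  rewrite /dc; congr (coev _ _); apply: d_lev => c' h' lc'.
  apply: coev_inj => b; rewrite !cof_mapE.
  by rewrite (hh (mkS (sj s) (sj s - 1) c')).
- move=> H [i [j c]] IH.
  have [e|ne] := pselect (i = j + 1); last first.
    by exists (D0 (mkS i j c)) => e; case: ne.
  pose g (x : A j (pt j c)) := fc j c x - dc (j - 1) j c (hs H j (j - 1) _ x).
  have gD : {morph g : x y / x + y}.
    move=> x y; rewrite /g /fc ccharD linearD dcD opprD addrACA.
    by [].
  have ej : j = j - 1 + 1 by rewrite subrK.
  (* A cycle is some d a. By induction f a - hs (d a) agrees with d (hs a) in the lower levels, the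
     only ones that [dc] sees, and d d = 0. *)
  have g0 x : cx_d A j i _ x = 0 -> g x = 0.
    move=> dx; have [a <-] := aA _ _ _ _ ej e x dx.
    pose w := f (j - 1) _ a - hs H j (j - 1) _ (cx_d A (j - 1) j _ a).
    have -> : g (cx_d A (j - 1) j _ a) = dc (j - 1) j c w.
      rewrite /w (morphDB (dcD _ _ _)); congr (_ - _).
      by rewrite /fc /cchar -(cm_d f).
    rewrite /dc; rewrite (d_lev (w' := d (j - 1 - 1) (j - 1) _ (hs H (j - 1) (j - 1 - 1) _ a))).
      by rewrite dd cev0.
    move=> c' h' lc'; apply: coev_inj => b.
    have hc := IH (mkS j (j - 1) c') lc' ej (b *: om_res h' a).
    rewrite /w cevD cevN coev_addl -[coev (- _) b]/(- coev _ b).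
    rewrite cof_mapE [coev (cev (f (j - 1) _ a : cof_st _ _) _ _) b](cof_ohomE (f (j - 1))).
    rewrite oh_nat -linearZ [sval _ _]hc opprB addrCA subrr addr0.
    exact/esym/(cof_ohomE (ohom_comp (d (j - 1 - 1) (j - 1)) (hs H (j - 1) (j - 1 - 1)))).
  have [|psi [psiD hpsi]] := @character_extension (A i (pt j c))
      (fun a u => exists x, a = cx_d A j i _ x /\ u = g x).
    split=> [|a u b v [x [-> ->]] [y [-> ->]]|u [x [/esym e0 ->]]]; last exact: g0.
      by exists 0; rewrite linear0 (morphD0 gD).
    by exists (x - y); rewrite linearB (morphDB gD).
  exists (exist _ psi psiD : D (mkS i j c)) => _ x /=.
  by apply: hpsi; exists x.
exists (hs H) => i p m; apply: cofW_inj => c pc; apply: coev_inj => b.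
rewrite cevD coev_addl cof_mapE.
rewrite [coev (cev (f i p m : cof_st _ _) _ _) b](cof_ohomE (f i)).
rewrite oh_nat -linearZ (hH (mkS (i + 1) i c) erefl).
rewrite (cof_ohomE (ohom_comp (d (i - 1) i) (hs H i (i - 1)))).
by rewrite [RHS]addrC subrK.
Qed.
End KInjective.

Section ModuleProduct.
Variables (k : comPzRingType) (X : ringed_finite_space k).
Section Object.
Variables (M N : omodule X).
Definition oprod_st (p : X) : lmodType (rs_O p) := (M p * N p)%type.
Definition oprod_res (p q : X) (h : spec p q) (x : oprod_st p) : oprod_st q :=
  (om_res h x.1, om_res h x.2).
Fact oprod_res_lin (p q : X) (h : spec p q) : semilinear (rs_res h) (oprod_res h).
Proof. by move=> a x y; congr pair; apply: om_res_lin. Qed.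
Fact oprod_res_id (p : X) (h : spec p p) x : oprod_res h x = x.
Proof. by case: x => x y; congr pair; apply: om_res_id. Qed.
Fact oprod_res_comp (p q r : X) (h : spec p q) (h' : spec q r) (h'' : spec p r) x :
  oprod_res h' (oprod_res h x) = oprod_res h'' x.
Proof. by congr pair; apply: om_res_comp. Qed.
Definition oprod : omodule X := OModule oprod_res_lin oprod_res_id oprod_res_comp.
End Object.
Section Pair.
Variables (L M N : omodule X) (u : ohom L M) (v : ohom L N).
Definition opair_fun (p : X) (x : L p) : oprod M N p := (u p x, v p x).
Fact opair_lin p : linear (@opair_fun p).
Proof. by move=> a x y; rewrite /opair_fun !linearP. Qed.
Fact opair_nat (p q : X) (h : spec p q) m :
  om_res h (mklin (@opair_lin p) m) = mklin (@opair_lin q) (om_res h m).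
Proof. by congr pair; apply: oh_nat. Qed.
Definition opair : ohom L (oprod M N) := @OHom _ _ L (oprod M N)
  (fun p => mklin (@opair_lin p)) opair_nat.
End Pair.
Section Projection.
Variables (M N : omodule X).
Fact ofst_lin (p : X) : linear (fun x : oprod M N p => x.1). Proof. by []. Qed.
Definition ofst : ohom (oprod M N) M := @OHom _ _ (oprod M N) M
  (fun p => mklin (@ofst_lin p)) (fun p q h x => erefl).
Fact ozero_lin (p : X) : linear (fun x : M p => 0 : N p).
Proof. by move=> a x y; rewrite scaler0 addr0. Qed.
Fact ozero_nat (p q : X) (h : spec p q) m :
  om_res h (mklin (@ozero_lin p) m) = mklin (@ozero_lin q) (om_res h m).
Proof. exact: (semilin0 (om_res_lin h)). Qed.
Definition ozero : ohom M N := @OHom _ _ M N (fun p => mklin (@ozero_lin p)) ozero_nat.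
End Projection.
End ModuleProduct.

(** * The tower of fibres and its limit *)

Section Fiber.
Variables (k : comPzRingType) (X : ringed_finite_space k) (K : complex X).

(* The characters of K in degree n - 1 that kill the boundaries *)
Record bchar (n : int) := BChar {
  bc_pt : X;
  bc_fun : forall n', K n' bc_pt -> QZ;
  bc_add : forall n', {morph @bc_fun n' : x y / x + y};
  bc_deg : forall n', n != n' + 1 -> forall x, @bc_fun n' x = 0;
  bc_bd : forall a b x, @bc_fun b (cx_d K a b bc_pt x) = 0 }.
Arguments bc_fun {n} _ n' _.
Arguments bc_add {n} _ n' _ _.

Definition bcof (n : int) : omodule X := cofree (@bc_pt n).
Definition biota (n l : int) : ohom (K n) (bcof l) :=
  @cof_map _ _ (bchar l) (@bc_pt l) (K n) (fun c => bc_fun c n) (fun c => bc_add c n).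

Lemma biota_d n m l p x : biota m l p (cx_d K n m p x) = 0.
Proof.
apply: cofW_inj => c pc; apply: coev_inj => b.
by rewrite cof_mapE oh_nat -linearZ bc_bd.
Qed.
Lemma biota_deg n l p x : l != n + 1 -> biota n l p x = 0.
Proof.
move=> h; apply: cofW_inj => c pc; apply: coev_inj => b.
by rewrite cof_mapE bc_deg.
Qed.

(** An element that is not a boundary is detected by a character killing the boundaries, and every
    such character indexes a factor of [bcof]. *)
Lemma biota_eq0 (i j : int) p (x : K j p) : j = i + 1 -> biota j (j + 1) p x = 0 ->
  exists y, cx_d K i j p y = x.
Proof.
move=> ij x0; apply: contrapT => nb.
have [||psi [psiD psiB psix]] := @character_separates (K j p)
    (fun z => exists y, cx_d K i j p y = z) x _ _ nb.
- by exists 0; rewrite linear0.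
- by move=> a b [y <-] [z <-]; exists (y - z); rewrite linearB.
(* The character lives in degree j; it is 0 in the other degrees, as [bc_deg] requires. *)
pose chi n' (z : K n' p) : QZ :=
  if pselect (n' = j) is left e then psi (ecast n (K n p) e z) else 0.
have chij z : chi j z = psi z.
  by rewrite /chi; case: pselect => // e; rewrite (eq_irrelevance e erefl).
have chi0 n' z : n' <> j -> chi n' z = 0 by rewrite /chi; case: pselect.
have chiD n' : {morph chi n' : a b / a + b}.
  have [->|ne] := pselect (n' = j); first by move=> a b; rewrite !chij psiD.
  by move=> a b; rewrite !chi0 ?addr0.
have chi_deg n' : j + 1 != n' + 1 -> forall z, chi n' z = 0.
  by move=> /eqP ne z; apply: chi0 => e; apply: ne; rewrite e.
have chi_bd a b z : chi b (cx_d K a b p z) = 0.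
  have [e|ne] := pselect (b = j); last exact: chi0.
  case: _ / (esym e).
  rewrite chij; have [ai|ne] := eqVneq a i.
    by case: _ / (esym ai) z => z; apply: psiB; exists z.
  rewrite cx_d0 ?(morphD0 psiD) //; apply: contraNneq ne => ja.
  by rewrite ij in ja; apply/eqP/(addIr 1).
pose c : bchar (j + 1) := @BChar (j + 1) p chi chiD chi_deg chi_bd.
have := congr1 (fun t : cof_st (@bc_pt (j + 1)) p =>
  coev (cev t c (@spec_refl X p)) 1) x0.
by rewrite cof_mapE scale1r om_res_id => e; apply: psix; rewrite -chij; exact: e.
Qed.

Definition fib_ob (n : int) : omodule X := oprod (K n) (bcof n).
Definition fib_d (n l : int) : ohom (fib_ob n) (fib_ob l) :=
  ohom_comp (opair (cx_d K n l) (biota n l)) (ofst (K n) (bcof n)).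
Fact fib_d0 n l : l != n + 1 -> forall p x, fib_d n l p x = 0.
Proof. by move=> h p x; congr pair; [apply: cx_d0|apply: biota_deg]. Qed.
Fact fib_dd n m l p x : fib_d m l p (fib_d n m p x) = 0.
Proof. by congr pair; [apply: cx_dd|apply: biota_d]. Qed.
Definition fib : complex X := Complex fib_d0 fib_dd.
End Fiber.
Arguments bc_fun {k X K n} _ n' _.
Arguments bc_add {k X K n} _ n' _ _.

(* tower j.+1 is the fibre of tower j -> bcof (tower j), so a cycle of tower j
   that lifts to a cycle of tower j.+1 is a boundary; teta, ttr are the components of the
   map to tower j from (a shift of) the cone of M -> tinj M, where tinj M is the
   product of all the bcof (tower j). *)
Section Tower.
Variables (k : comPzRingType) (X : ringed_finite_space k) (M : complex X).

Fixpoint tower (j : nat) : complex X := if j is j'.+1 then fib (tower j') else M.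
Definition cocell (n : int) : Type := {j : nat & bchar (tower j) n}.
Definition ccpt n (c : cocell n) : X := bc_pt (projT2 c).
Definition tJ (n : int) : omodule X := cofree (@ccpt n).

Section Level.
Variables (j : nat) (n : int).
Definition tlev_fun (p : X) (w : tJ n p) : bcof (tower j) n p :=
  mkcofW (fun (c : bchar (tower j) n) pc =>
    cev (w : cof_st (@ccpt n) p) (existT _ j c : cocell n) pc).
Fact tlev_lin p : linear (@tlev_fun p). Proof. by []. Qed.
Fact tlev_nat (p q : X) (h : spec p q) w :
  om_res h (mklin (@tlev_lin p) w) = mklin (@tlev_lin q) (om_res h w).
Proof. by []. Qed.
Definition tlev : ohom (tJ n) (bcof (tower j) n) := @OHom _ _ (tJ n) (bcof (tower j) n)
  (fun p => mklin (@tlev_lin p)) tlev_nat.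
End Level.

Fixpoint ttr (j : nat) (n : int) : ohom (tJ n) (tower j n) :=
  match j return ohom (tJ n) (tower j n) with
  | 0 => ozero (tJ n) (M n)
  | j'.+1 => opair (ttr j' n) (tlev j' n)
  end.
Fixpoint teta (j : nat) (n : int) : ohom (M n) (tower j n) :=
  match j return ohom (M n) (tower j n) with
  | 0 => ohom_id (M n)
  | j'.+1 => opair (teta j' n) (ozero (M n) (bcof (tower j') n))
  end.

(** The sign is that of a shifted cone: with it [ttr] anticommutes with the differentials, see
    [ttr_d]. *)
Definition tJ_chi n l (c : cocell l) (w : tJ n (ccpt c)) : QZ :=
  - bc_fun (projT2 c) n (ttr (projT1 c) n _ w).
Fact tJ_chiD n l c : {morph @tJ_chi n l c : x y / x + y}.
Proof. by move=> x y; rewrite /tJ_chi linearD bc_add opprD. Qed.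
Definition tJ_d n l : ohom (tJ n) (tJ l) := cof_map (@tJ_chiD n l).

Definition teps_chi n l (c : cocell l) (m : M n (ccpt c)) : QZ :=
  bc_fun (projT2 c) n (teta (projT1 c) n _ m).
Fact teps_chiD n l c : {morph @teps_chi n l c : x y / x + y}.
Proof. by move=> x y; rewrite /teps_chi linearD bc_add. Qed.
Definition teps n l : ohom (M n) (tJ l) := cof_map (@teps_chiD n l).

Lemma cof_oppE C (pt : C -> X) p (t : cofree pt p) c (pc : spec p (pt c)) b :
  coev (cev (- t : cof_st pt p) c pc) b = - coev (cev (t : cof_st pt p) c pc) b.
Proof. by []. Qed.

Lemma tlev_tJ_d j n l p w : tlev j l p (tJ_d n l p w) = - biota (tower j) n l p (ttr j n p w).
Proof.
apply: cofW_inj => c pc; apply: coev_inj => b.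
rewrite [RHS]cof_oppE cof_mapE.
rewrite -[LHS]/(@tJ_chi n l (existT _ j c) (b *: om_res pc w)) /tJ_chi /= linearZ /=.
by rewrite oh_nat.
Qed.
Lemma tlev_teps j n l p m : tlev j l p (teps n l p m) = biota (tower j) n l p (teta j n p m).
Proof.
apply: cofW_inj => c pc; apply: coev_inj => b.
rewrite [RHS]cof_mapE.
rewrite -[LHS]/(@teps_chi n l (existT _ j c) (b *: om_res pc m)) /teps_chi /= linearZ /=.
by rewrite oh_nat.
Qed.

Lemma ttr_d j n l p w : cx_d (tower j) n l p (ttr j n p w) = - ttr j l p (tJ_d n l p w).
Proof.
elim: j => [|j IH]; first by rewrite /= linear0 oppr0.
by congr pair; [exact: IH|rewrite -[RHS]/(- tlev j l p (tJ_d n l p w)) tlev_tJ_d opprK].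
Qed.
Lemma teta_d j n l p m : cx_d (tower j) n l p (teta j n p m) =
  teta j l p (cx_d M n l p m) + ttr j l p (teps n l p m).
Proof.
elim: j => [|j IH]; first by rewrite /= addr0.
congr pair; first exact: IH.
by rewrite -[RHS]/(0 + tlev j l p (teps n l p m)) add0r tlev_teps.
Qed.

Lemma tJ_ext n p (w w' : tJ n p) : (forall j, tlev j n p w = tlev j n p w') -> w = w'.
Proof.
move=> h; apply: cofW_inj => -[j c] pc.
exact: (congr1 (fun t : cof_st (@bc_pt _ _ (tower j) n) p => cev t c pc) (h j)).
Qed.

Fact tJ_d0 n l : l != n + 1 -> forall p w, tJ_d n l p w = 0.
Proof.
move=> h p w; apply: tJ_ext => j; rewrite tlev_tJ_d biota_deg // oppr0.
by rewrite linear0.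
Qed.
Fact tJ_dd n m l p w : tJ_d m l p (tJ_d n m p w) = 0.
Proof.
apply: tJ_ext => j; rewrite tlev_tJ_d linear0 -[ttr j m p _]opprK -ttr_d.
by rewrite linearN biota_d !oppr0.
Qed.

(** Characters of index n + 1 are evaluated in degree n, so the shift by 1 makes [tres] a map of
    degree 0. *)
Definition tinj : complex X := @Complex k X (fun n => tJ (n + 1))
  (fun i j => tJ_d (i + 1) (j + 1))
  (fun i j ij => @tJ_d0 (i + 1) (j + 1) (contraNneq (fun e => introT eqP (addIr 1 e)) ij))
  (fun i j l p m => @tJ_dd (i + 1) (j + 1) (l + 1) p m).
End Tower.

Section TowerResolution.
Variables (k : comPzRingType) (X : ringed_finite_space k) (M : complex X).
Local Notation tower := (tower M).

Lemma ttr_agree j n p (w w' : tJ M n p) :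
  (forall (c : cocell M n) pc, (projT1 c < j)%N ->
    cev (w : cof_st (@ccpt _ _ M n) p) c pc = cev (w' : cof_st (@ccpt _ _ M n) p) c pc) ->
  ttr M j n p w = ttr M j n p w'.
Proof.
elim: j => // j IH h; congr pair.
  by apply: IH => c pc cj; apply: h; apply: ltnW.
by apply: cofW_inj => c pc; apply: (h (existT _ j c : cocell M n)).
Qed.

(** At a character of stage j the differential passes through [ttr j], which involves earlier stages
    only; hence the stage is a valid level. *)
Lemma tinj_K_injective : K_injective (tinj M).
Proof.
apply: (@cofree_K_injective k X (fun n => cocell M (n + 1)) (fun n => @ccpt _ _ M (n + 1))
  (fun n c => projT1 c)) => i j c w w' h.
apply: coev_inj => b; rewrite !cof_mapE /tJ_chi !om_res_id !linearZ; congr (- bc_fun _ _ (_ *: _)).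
exact: ttr_agree.
Qed.

Fact teps_d i j p m : cx_d (tinj M) i j p (teps M i (i + 1) p m) =
  teps M j (j + 1) p (cx_d M i j p m).
Proof.
apply: tJ_ext => a; rewrite tlev_tJ_d tlev_teps.
have [->|ij] := eqVneq j (i + 1); last first.
  by rewrite cx_d0 // !linear0 biota_deg ?oppr0 // (inj_eq (addIr 1)).
have := @teta_d _ _ M a i (i + 1) p m.
move=> /(congr1 (fun z => biota (tower a) (i + 1) (i + 1 + 1) p z)).
by rewrite biota_d linearD => /esym/eqP; rewrite addr_eq0 => /eqP ->.
Qed.
Definition tres : chain_map M (tinj M) := 
  @ChainMap _ _ M (tinj M) (fun n => teps M n (n + 1)) teps_d.

Section Lifting.
Variables (n : int) (p : X) (P : forall j, tower j (n + 1) p).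
Hypothesis dP : forall j, cx_d (tower j) (n + 1) (n + 1 + 1) p (P j) = 0.
Hypothesis P1 : forall j, (P j.+1 : fib_ob (tower j) (n + 1) p).1 = P j.
Local Notation dn j := (cx_d (tower j) n (n + 1) p).
Local Notation pr j t := ((t : fib_ob (tower j) n p).1).

Let bound j : exists z, dn j z = P j.
Proof.
apply: biota_eq0 => //.
by rewrite -P1; exact: (congr1 (fun z => (z : fib_ob (tower j) (n + 1 + 1) p).2) (dP j.+1)).
Qed.

(** A partial lift is kept only if it extends one stage further, since [step] compares this
    extension with a lift two stages up. *)
Let S j (t : tower j n p) :=
  dn j t = P j /\ exists y : tower j.+1 n p, dn j.+1 y = P j.+1 /\ pr j y = t.

Let pr_d j (y : tower j.+1 n p) : dn j.+1 y = P j.+1 -> dn j (pr j y) = P j.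
Proof. by move=> h; rewrite -P1 -h. Qed.

Let start : exists t, S (j := 0) t.
Proof.
have [y hy] := bound 1; exists (pr 0%N y); split; first exact: pr_d.
by exists y.
Qed.

(** Mittag-Leffler step: two lifts differ in stage j + 1 by a cycle c, whose image in stage j is a
    boundary d u. Correcting [y2] by the differential of (u, 0, 0) makes it project to t. *)
Let step j t : S (j := j) t -> exists t', S (j := j.+1) t' /\ pr j t' = t.
Proof.
move=> [ht [y [hy yt]]]; have [y2 hy2] := bound j.+2.
pose c : tower j.+1 n p := pr j.+1 y2 - y.
have dc : dn j.+1 c = 0 by rewrite /c linearB (pr_d hy2) hy subrr.
have ns : n = n - 1 + 1 by rewrite subrK.
have [u hu] : exists u, cx_d (tower j) (n - 1) n p u = pr j c.
  apply: biota_eq0 => //.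
  exact: (congr1 (fun z => (z : fib_ob (tower j) (n + 1) p).2) dc).
pose U1 : tower j.+1 (n - 1) p := (u, 0 : bcof (tower j) (n - 1) p).
pose U2 : tower j.+2 (n - 1) p := (U1, 0 : bcof (tower j.+1) (n - 1) p).
pose y' := y2 - cx_d (tower j.+2) (n - 1) n p U2.
have hy' : dn j.+2 y' = P j.+2 by rewrite /y' linearB hy2 cx_dd subr0.
exists (pr j.+1 y'); split.
  split; first exact: pr_d.
  by exists y'.
rewrite -yt -[LHS]/(pr j (pr j.+1 y2) - cx_d (tower j) (n - 1) n p u) hu.
by rewrite -[pr j c]/(pr j (pr j.+1 y2) - pr j y) opprB addrC subrK.
Qed.

Let S0 : {t : tower 0 n p | S t} := cid start.
Let next j (t : {t : tower j n p | S t}) : {t : tower j.+1 n p | S t} :=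
  let c := cid (step (svalP t)) in exist _ (sval c) (proj1 (svalP c)).
Let next_pr j t : pr j (sval (@next j t)) = sval t.
Proof. by rewrite /next /=; case: cid => t' [? ?]. Qed.
Let lift j : {t : tower j n p | S t} := nat_rect (fun j => {t : tower j n p | S t}) S0 next j.

Lemma tower_lift : exists t : forall j, tower j n p,
  (forall j, dn j (t j) = P j) /\ forall j, pr j (t j.+1) = t j.
Proof.
exists (fun j => sval (lift j)); split=> j; first by have [] := svalP (lift j).
exact: next_pr.
Qed.
End Lifting.

(** A cone cocycle (x, x') yields compatible cycles [P j] in the tower. Each lifts to a cycle of the
    next stage, hence bounds, and [tower_lift] bounds them compatibly; the resulting element of the
    limit is the pair (y, y'). *)
Lemma tres_quasi_iso : quasi_iso tres.
Proof.
apply/quasi_isoP => p i j l m ij jl lm; subst j l m => x x' dx dx'.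
set n := i + 1 in x x' dx dx' *.
pose P j : tower j (n + 1) p := teta M j (n + 1) p x + ttr M j (n + 1) p x'.
have dP j : cx_d (tower j) (n + 1) (n + 1 + 1) p (P j) = 0.
  by rewrite /P linearD teta_d ttr_d dx linear0 add0r [tJ_d _ _ _ _ _]dx' subrr.
have [t [dt pt]] := tower_lift dP (fun j => erefl).
(* The component at a character of stage j is the one that stage j + 1 adds, namely the second half
   of [t j.+1]. *)
pose y' : tJ M n p := mkcofW (fun (c : cocell M n) pc =>
  cev ((t (projT1 c).+1 : fib_ob (tower (projT1 c)) n p).2 : cof_st (@bc_pt _ _ _ n) p)
    (projT2 c) pc).
have ty j : t j = teta M j n p (t 0%N) + ttr M j n p y'.
  elim: j => [|j IH]; first by rewrite /= addr0.
  rewrite [t j.+1]surjective_pairing; congr pair; first by rewrite -IH; exact: pt.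
  rewrite -[RHS]/(0 + tlev M j n p y') add0r.
  by apply: cofW_inj => c pc.
have key j : teta M j (n + 1) p (cx_d M n (n + 1) p (t 0%N)) +
    ttr M j (n + 1) p (teps M n (n + 1) p (t 0%N) - tJ_d M n (n + 1) p y') =
    teta M j (n + 1) p x + ttr M j (n + 1) p x'.
  rewrite -[RHS]/(P j) -dt (ty j) [RHS]linearD [X in _ = X + _]teta_d [X in _ = _ + X]ttr_d.
  by rewrite linearB addrA.
have k0 : cx_d M n (n + 1) p (t 0%N) = x by have := key 0%N; rewrite /= !addr0.
exists (t 0%N), y'; split=> //.
suff <- : teps M n (n + 1) p (t 0%N) - tJ_d M n (n + 1) p y' = x' by rewrite [RHS]subrK.
apply: tJ_ext => a; have := key a.+1; rewrite k0 => /addrI.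
exact: (congr1 (fun z => (z : fib_ob (tower a) (n + 1) p).2)).
Qed.
End TowerResolution.

(** * Direct images *)

Lemma qis_transfer (A A2 B B2 : int -> zmodType)
    (dA : forall i j, A i -> A j) (dA2 : forall i j, A2 i -> A2 j)
    (dB : forall i j, B i -> B j) (dB2 : forall i j, B2 i -> B2 j)
    (f : forall i, A i -> B i) (f2 : forall i, A2 i -> B2 i)
    (a : forall i, A i -> A2 i) (b : forall i, B i -> B2 i) :
  (forall i, {morph a i : x y / x + y}) -> (forall i, {morph b i : x y / x + y}) ->
  (forall i j x, a j (dA i j x) = dA2 i j (a i x)) ->
  (forall i j x, b j (dB i j x) = dB2 i j (b i x)) ->
  (forall i x, b i (f i x) = f2 i (a i x)) ->
  (forall i, injective (a i)) -> (forall i y, exists x, a i x = y) ->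
  (forall i, injective (b i)) -> (forall i y, exists x, b i x = y) ->
  @qis A2 B2 dA2 dB2 f2 -> @qis A B dA dB f.
Proof.
move=> aD bD ad bd fab ai asj bi bsj q i j l m ij jl lm x x' dx dx'.
have [||y2 [y2' [hy hy']]] := q i j l m ij jl lm (a l x) (b j x').
- by rewrite -ad dx (morphD0 (aD _)).
- by rewrite -bd dx' fab.
have [y ey] := asj j y2; have [y' ey'] := bsj i y2'.
exists y, y'; split; first by apply: ai; rewrite ad ey.
by apply: bi; rewrite fab ey hy' -ey' -bd bD.
Qed.

(** * Mayer-Vietoris and gluing *)

Section MayerVietoris.
Variable S : comPzRingType.
Variables (A A1 A2 A3 B B1 B2 B3 : int -> lmodType S).
Variables (dA : forall i j, {linear A i -> A j}) (dA1 : forall i j, {linear A1 i -> A1 j})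
  (dA2 : forall i j, {linear A2 i -> A2 j}) (dA3 : forall i j, {linear A3 i -> A3 j})
  (dB : forall i j, {linear B i -> B j}) (dB1 : forall i j, {linear B1 i -> B1 j})
  (dB2 : forall i j, {linear B2 i -> B2 j}) (dB3 : forall i j, {linear B3 i -> B3 j}).
Variables (f : forall i, {linear A i -> B i}) (f1 : forall i, {linear A1 i -> B1 i})
  (f2 : forall i, {linear A2 i -> B2 i}) (f3 : forall i, {linear A3 i -> B3 i}).
Variables (r1 : forall i, {linear A i -> A1 i}) (r2 : forall i, {linear A i -> A2 i})
  (s1 : forall i, {linear A1 i -> A3 i}) (s2 : forall i, {linear A2 i -> A3 i})
  (t1 : forall i, {linear B i -> B1 i}) (t2 : forall i, {linear B i -> B2 i})
  (u1 : forall i, {linear B1 i -> B3 i}) (u2 : forall i, {linear B2 i -> B3 i}).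
Hypotheses (r1d : forall i j x, r1 j (dA i j x) = dA1 i j (r1 i x))
  (r2d : forall i j x, r2 j (dA i j x) = dA2 i j (r2 i x))
  (s1d : forall i j x, s1 j (dA1 i j x) = dA3 i j (s1 i x))
  (s2d : forall i j x, s2 j (dA2 i j x) = dA3 i j (s2 i x))
  (t1d : forall i j x, t1 j (dB i j x) = dB1 i j (t1 i x))
  (t2d : forall i j x, t2 j (dB i j x) = dB2 i j (t2 i x))
  (u1d : forall i j x, u1 j (dB1 i j x) = dB3 i j (u1 i x))
  (u2d : forall i j x, u2 j (dB2 i j x) = dB3 i j (u2 i x)).
Hypotheses (f1d : forall i j x, f1 j (dA1 i j x) = dB1 i j (f1 i x))
  (dd1 : forall i j l x, dA1 j l (dA1 i j x) = 0) (dd1' : forall i j l x, dB1 j l (dB1 i j x) = 0).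
Hypotheses (fr1 : forall i x, f1 i (r1 i x) = t1 i (f i x)) 
  (fr2 : forall i x, f2 i (r2 i x) = t2 i (f i x))
  (fs1 : forall i x, f3 i (s1 i x) = u1 i (f1 i x)) 
  (fs2 : forall i x, f3 i (s2 i x) = u2 i (f2 i x)).
Hypotheses (sr : forall i x, s1 i (r1 i x) = s2 i (r2 i x))
  (ut : forall i x, u1 i (t1 i x) = u2 i (t2 i x)).
Hypotheses (rI : forall i x x', r1 i x = r1 i x' -> r2 i x = r2 i x' -> x = x')
  (tI : forall i x x', t1 i x = t1 i x' -> t2 i x = t2 i x' -> x = x').
Hypotheses (rG : forall i x1 x2, s1 i x1 = s2 i x2 -> exists x, r1 i x = x1 /\ r2 i x = x2)
  (tG : forall i x1 x2, u1 i x1 = u2 i x2 -> exists x, t1 i x = x1 /\ t2 i x = x2).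
Hypotheses (sS : forall i z, exists x, s1 i x = z) (uS : forall i z, exists x, u1 i x = z).

(** Solutions on the two pieces differ on the intersection by a cone cocycle of one degree less,
    bounded by [q3]. The bounding pair lifts to the first piece and corrects the solution there, so
    that both solutions glue. *)
Lemma mayer_vietoris :
  @qis A1 B1 (fun i j => dA1 i j) (fun i j => dB1 i j) (fun i => f1 i) ->
  @qis A2 B2 (fun i j => dA2 i j) (fun i j => dB2 i j) (fun i => f2 i) ->
  @qis A3 B3 (fun i j => dA3 i j) (fun i j => dB3 i j) (fun i => f3 i) ->
  @qis A B (fun i j => dA i j) (fun i j => dB i j) (fun i => f i).
Proof.
move=> q1 q2 q3 i j l m ij jl lm x x' dx dx'.
have [||y1 [y1' [dy1 fy1]]] := q1 i j l m ij jl lm (r1 l x) (t1 j x').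
- by rewrite -r1d dx linear0.
- by rewrite -t1d dx' fr1.
have [||y2 [y2' [dy2 fy2]]] := q2 i j l m ij jl lm (r2 l x) (t2 j x').
- by rewrite -r2d dx linear0.
- by rewrite -t2d dx' fr2.
have hi : i = i - 1 + 1 by rewrite subrK.
have [||w [w' [dw fw]]] := q3 (i - 1) i j l hi ij jl (s1 j y1 - s2 j y2) (u1 i y1' - u2 i y2').
- by rewrite linearB -s1d -s2d dy1 dy2 sr subrr.
- rewrite !linearB -u1d -u2d fs1 fs2 fy1 fy2 (linearD (u1 j)) (linearD (u2 j)) ut.
  by rewrite opprD addrACA subrr add0r.
have [v ev] := sS w; have [v' ev'] := uS w'.
have [|y [ry1 ry2]] := rG (x1 := y1 - dA1 i j v) (x2 := y2).
  by rewrite linearB s1d ev dw opprB addrC subrK.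
have [|y' [ty1 ty2]] := tG (x1 := y1' + dB1 (i - 1) i v' - f1 i v) (x2 := y2').
  rewrite linearB linearD u1d ev' -fs1 ev fw opprD opprB addrACA subrr addr0.
  by rewrite addrC subrK.
exists y, y'; split.
  apply: rI; first by rewrite r1d ry1 linearB dd1 subr0.
  by rewrite r2d ry2.
apply: tI; last by rewrite -fr2 ry2 fy2 linearD t2d ty2.
rewrite -fr1 ry1 linearB fy1 linearD t1d ty1 linearB linearD dd1' addr0 addrA.
by rewrite f1d.
Qed.
End MayerVietoris.

Section Gluing.
Variables (X : Type) (S : comPzRingType) (T : set X -> lmodType S).
Variable t : forall V V', {linear T V -> T V'}.
Arguments t : clear implicits.
Hypothesis t_comp : forall V V' V'' w, V `&` V'' `<=` V' -> t V' V'' (t V V' w) = t V V'' w.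
Hypothesis t_id : forall V w, t V V w = w.
Variables U V1 V2 V3 : set X.
Hypotheses (UE : U = V1 `|` V2) (V3E : V3 = V1 `&` V2).
Hypothesis t_cover : forall w, w = t V1 U (t U V1 w) + t V2 U (t U V2 w) - t V3 U (t U V3 w).

(** [t V V'] stands for restriction to the intersection followed by extension by 0. The hypotheses
    on [t] are linear identities, so they hold for sections and for tensored sections alike. *)
Lemma glue_restr w : t V1 V3 (t U V1 w) = t V2 V3 (t U V2 w).
Proof. by rewrite !t_comp // V3E => p [_ []]. Qed.
Lemma glue_inj w w' : t U V1 w = t U V1 w' -> t U V2 w = t U V2 w' -> w = w'.
Proof.
move=> e1 e2.
have E w0 : t U V3 w0 = t V1 V3 (t U V1 w0) by rewrite t_comp // V3E => p [_ []].
by rewrite (t_cover w) (t_cover w') !E e1 e2.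
Qed.
Lemma glue_exists w1 w2 : t V1 V3 w1 = t V2 V3 w2 ->
  exists w, t U V1 w = w1 /\ t U V2 w = w2.
Proof.
move=> e.
have V1U : V1 `<=` U by rewrite UE => p; left.
have V2U : V2 `<=` U by rewrite UE => p; right.
have V31 : V3 `<=` V1 by rewrite V3E => p [].
have V32 : V3 `<=` V2 by rewrite V3E => p [].
exists (t V1 U w1 + t V2 U w2 - t V3 U (t V1 V3 w1)); split.
  rewrite linearB linearD (t_comp (V' := U)) ?t_id; last by move=> p [/V1U].
  rewrite (t_comp (V' := U)); last by move=> p [/V2U].
  rewrite (t_comp (V' := U)); last by move=> p [/V31/V1U].
  by rewrite e (t_comp (V' := V3)) ?addrK // V3E => p [].
rewrite linearB linearD [X in X + _ - _](t_comp (V' := U)); last by move=> p [/V1U].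
rewrite (t_comp (V' := U)) ?t_id; last by move=> p [/V2U].
rewrite (t_comp (V' := U)); last by move=> p [/V31/V1U].
by rewrite (t_comp (V' := V3)) 1?addrC ?addKr // V3E => p [].
Qed.
Lemma glue_surj w3 : exists w, t V1 V3 w = w3.
Proof. by exists (t V3 V1 w3); rewrite t_comp ?t_id // V3E => p [[]]. Qed.
End Gluing.

Lemma count_lt (T : eqType) (s : seq T) (a b : pred T) p :
  p \in s -> b p -> ~~ a p -> subpred a b -> (count a s < count b s)%N.
Proof.
move=> ps bp nap ab.
have h0 : predI a (pred1 p) =1 pred0.
  by move=> q /=; apply/andP => -[aq /eqP qp]; rewrite -qp aq in nap.
have e := count_predUI a (pred1 p) s; rewrite (eq_count h0) count_pred0 addn0 in e.
apply: (@leq_trans (count (predU a (pred1 p)) s)).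
  by rewrite e -addn1 leq_add2l -has_count has_pred1.
by apply: sub_count => q /= /orP[/ab|/eqP ->].
Qed.

Lemma tens_bij (R S : comPzRingType) (phi : {rmorphism R -> S}) (M N : lmodType R)
    (u : {linear M -> N}) : injective u -> (forall n, exists m, u m = n) ->
  bijective (tmapl phi u (idfun : {linear S^o -> S^o})).
Proof.
move=> ui us; apply: inj_surj_bij; last exact: tens_surj.
have [v vK] := choice us.
have vl : linear v by move=> a x z; apply: ui; rewrite linearP !vK.
apply: (can_inj (g := tmapl phi (mklin vl) idfun)).
apply: tens_ext => [x z|//|m b]; first by rewrite !linearD.
by rewrite !tmapl_pure; congr (tpure _ _ _); apply: ui; rewrite [u _]vK.
Qed.

Lemma prod_spec (X Y : topologicalType) (p q : X * Y) :
  spec p.1 q.1 -> spec p.2 q.2 -> spec p q.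
Proof.
move=> h1 h2 U oU Up.
have [[A B] /= [nA nB] AB] : nbhs p U by apply: open_nbhs_nbhs.
by apply: AB; split; apply: interior_subset;
  [apply: (h1 A°)|apply: (h2 B°)]; try exact: open_interior.
Qed.

(* strip_mod V y n is the module of sections over V x U_y of the n-th term of a
   complex of cofree sheaves; strip_claim V is base change along y <= y' for the
   complex of sections. Sections extend by 0, hence Mayer-Vietoris sequences. *)
Section Strips.
Variables (k : comPzRingType) (X Y : ringed_finite_space k).
Local Notation Z := (prod_space X Y).
Variables (C : int -> Type) (pt : forall n, C n -> Z).
Arguments pt : clear implicits.
Local Notation I n := (cofree (pt n)).
Variable d : forall i j, ohom (I i) (I j).
Hypothesis dd : forall i j l p m, d j l p (d i j p m) = 0.

Definition strip (V : set X) (y : Y) (z : Z) : Prop := V z.1 /\ spec y z.2.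
Definition strip_rho V y z (h : strip V y z) : {rmorphism rs_O y -> rs_O z} :=
  push_rho (f := prod_proj2 X Y) (y := y) (x := z) (proj2 h).
Definition strip_mod V y n : lmodType (rs_O y) := cofW (pt n) (@strip_rho V y).
Definition up_closed (V : set X) := forall p q, spec p q -> V p -> V q.

Section Differential.
Variables (V : set X) (uV : up_closed V).
Lemma strip_up y z z' : spec z z' -> strip V y z -> strip V y z'.
Proof.
by move=> h [Vz yz]; split; [apply: uV (spec_fst h) Vz|apply: spec_trans yz (spec_snd h)].
Qed.
Definition strip_loc y n z (Wz : strip V y z) (w : strip_mod V y n) : I n z :=
  mkcofW (fun c h => cev w c (strip_up h Wz)).
Lemma strip_loc_lin y n z (Wz : strip V y z) : semilinear (strip_rho Wz) (@strip_loc y n z Wz).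
Proof.
move=> a s t; apply: cofW_inj => c h; rewrite [LHS]cev_mk cevD cevZ.
rewrite [RHS]cevD [cev (_ *: _) _ _ in RHS]cevZ !cev_mk; congr (_ *: _ + _).
exact/esym/(push_rho_res (f := prod_proj2 X Y)).
Qed.
Lemma strip_loc_res y n z z' (h : spec z z') Wz Wz' w :
  om_res h (@strip_loc y n z Wz w) = @strip_loc y n z' Wz' w.
Proof.
apply: cofW_inj => c hc; rewrite (cev_res h _ _ (spec_trans h hc)) !cev_mk.
by congr (cev _ _ _); apply: Prop_irrelevance.
Qed.
Lemma cev_strip_loc y n (w : strip_mod V y n) c Wc :
  cev (strip_loc Wc w : cof_st (pt n) (pt n c)) c (@spec_refl Z (pt n c)) = cev w c Wc.
Proof. by rewrite cev_mk; congr (cev _ _ _); apply: Prop_irrelevance. Qed.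

Definition strip_d_fun y i j (w : strip_mod V y i) : strip_mod V y j :=
  mkcofW (fun c Wc => cev (d i j (pt j c) (strip_loc Wc w) : cof_st (pt j) (pt j c)) c
    (@spec_refl Z (pt j c))).
Fact strip_d_lin y i j : linear (@strip_d_fun y i j).
Proof.
move=> a s t; apply: cofW_inj => c Wc.
rewrite [LHS]cev_mk [RHS]cevD [cev (_ *: _) _ _ in RHS]cevZ !cev_mk.
by rewrite strip_loc_lin linearD linearZ cevD cevZ rs_res_id.
Qed.
Definition strip_d y i j : {linear strip_mod V y i -> strip_mod V y j} :=
  mklin (@strip_d_lin y i j).
Lemma strip_loc_d y i j z (Wz : strip V y z) w :
  strip_loc Wz (strip_d y i j w) = d i j z (strip_loc Wz w).
Proof.
apply: cofW_inj => c h; rewrite cev_mk [LHS]cev_mk -(strip_loc_res h Wz) -oh_nat.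
exact: cev_res.
Qed.
Lemma strip_dd y i j l w : strip_d y j l (strip_d y i j w) = 0.
Proof. by apply: cofW_inj => c Wc; rewrite cev_mk strip_loc_d dd. Qed.
End Differential.

Section Restriction.
Variables (V : set X) (y y' : Y) (h : spec y y').
Lemma strip_shrink z : strip V y' z -> strip V y z.
Proof. by move=> [Vz yz]; split=> //; apply: spec_trans h yz. Qed.
Definition strip_res n (w : strip_mod V y n) : strip_mod V y' n :=
  mkcofW (fun c Wc => cev w c (strip_shrink Wc)).
Fact strip_res_lin n : semilinear (rs_res h) (@strip_res n).
Proof.
move=> a s t; apply: cofW_inj => c Wc; rewrite [LHS]cev_mk cevD cevZ.
rewrite [RHS]cevD [cev (_ *: _) _ _ in RHS]cevZ !cev_mk; congr (_ *: _ + _).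
by rewrite /strip_rho /= -(rs_res_comp h (proj2 Wc) (proj2 (strip_shrink Wc))).
Qed.
Definition strip_bc n := bcmap (@strip_res_lin n).
Definition strip_dt (uV : up_closed V) i j :=
  tmapl (rs_res h) (strip_d uV y i j) (idfun : {linear (rs_O y')^o -> (rs_O y')^o}).
Lemma strip_loc_strip_res (uV : up_closed V) n z (Wz : strip V y z) (Wz' : strip V y' z) w :
  strip_loc uV Wz' (@strip_res n w) = strip_loc uV Wz w.
Proof.
apply: cofW_inj => c hc; rewrite !cev_mk; congr (cev _ _ _).
exact: Prop_irrelevance.
Qed.
Lemma strip_bc_d (uV : up_closed V) i j x :
  strip_d uV y' i j (strip_bc i x) = strip_bc j (strip_dt uV i j x).
Proof.
apply: bc_sq => w; apply: cofW_inj => c Wc; rewrite !cev_mk.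
by rewrite (strip_loc_strip_res _ (strip_shrink Wc)).
Qed.
Definition strip_claim (uV : up_closed V) :=
  @qis (fun n => tens (rs_res h) (strip_mod V y n) (rs_O y')^o) (strip_mod V y')
    (strip_dt uV) (strip_d uV y') strip_bc.
End Restriction.

Section Extension.
Variables (V V' : set X) (y : Y).
Definition strip_ext_fun n (w : strip_mod V y n) : strip_mod V' y n :=
  mkcofW (fun c _ => if pselect (strip V y (pt n c)) is left Wc then cev w c Wc else 0).
Lemma strip_ext_in n (w : strip_mod V y n) c Wc Wc' :
  cev (strip_ext_fun w) c Wc' = cev w c Wc.
Proof.
rewrite cev_mk; case: pselect => // Wc2; congr (cev _ _ _); exact: Prop_irrelevance.
Qed.
Lemma strip_ext_out n (w : strip_mod V y n) c Wc' :
  ~ V (pt n c).1 -> cev (strip_ext_fun w) c Wc' = 0.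
Proof. by move=> nV; rewrite cev_mk; case: pselect => // Wc; case: (nV (proj1 Wc)). Qed.
Fact strip_ext_lin n : linear (@strip_ext_fun n).
Proof.
move=> a s t; apply: cofW_inj => c Wc'.
rewrite [RHS]cevD [cev (_ *: _) _ _ in RHS]cevZ !cev_mk; case: pselect => [Wc|_].
  by rewrite cevD cevZ /strip_rho (Prop_irrelevance (proj2 Wc) (proj2 Wc')).
by rewrite scaler0 addr0.
Qed.
Definition strip_ext n : {linear strip_mod V y n -> strip_mod V' y n} := mklin (@strip_ext_lin n).
End Extension.
Arguments strip_ext : clear implicits.

(** Only coordinates at points of both V and V'' survive on the right, and by hypothesis the detour
    through V' loses none of them. *)
Lemma strip_ext_comp y n (V V' V'' : set X) w : V `&` V'' `<=` V' ->
  strip_ext V' V'' y n (strip_ext V V' y n w) = strip_ext V V'' y n w.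
Proof.
move=> h; apply: cofW_inj => c Wc''.
have [Vc|nVc] := pselect (V (pt n c).1).
  pose Wc : strip V y (pt n c) := conj Vc (proj2 Wc'').
  pose Wc' : strip V' y (pt n c) := conj (h _ (conj Vc (proj1 Wc''))) (proj2 Wc'').
  by rewrite (strip_ext_in _ Wc') !(strip_ext_in _ Wc).
rewrite [RHS]strip_ext_out //.
have [Vc'|nVc'] := pselect (V' (pt n c).1); last by rewrite strip_ext_out.
by rewrite (strip_ext_in _ (conj Vc' (proj2 Wc''))) strip_ext_out.
Qed.
Lemma strip_ext_id y n V w : strip_ext V V y n w = w.
Proof. by apply: cofW_inj => c Wc; rewrite (strip_ext_in _ Wc). Qed.
Lemma strip_ext_cover y n (U V1 V2 V3 : set X) : U = V1 `|` V2 -> V3 = V1 `&` V2 ->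
  forall w, w = strip_ext V1 U y n (strip_ext U V1 y n w) +
    strip_ext V2 U y n (strip_ext U V2 y n w) -
    strip_ext V3 U y n (strip_ext U V3 y n w).
Proof.
move=> -> -> w; apply: cofW_inj => c Wc; rewrite cevD cevN cevD.
have E V : cev (strip_ext V (V1 `|` V2) y n (strip_ext (V1 `|` V2) V y n w)) c Wc =
    if pselect (V (pt n c).1) is left _ then cev w c Wc else 0.
  case: pselect => [Vc|nVc]; last by rewrite strip_ext_out.
  by rewrite (strip_ext_in _ (conj Vc (proj2 Wc))) (strip_ext_in _ Wc).
rewrite !E; case: pselect => h1; case: pselect => h2; case: pselect => h3;
  rewrite ?addrK ?addr0 ?add0r ?subr0 //; try by case: h3.
by case: (proj1 Wc).
Qed.
Lemma strip_loc_ext V V' (uV : up_closed V) (uV' : up_closed V') y n z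
    (Wz : strip V y z) (Wz' : strip V' y z) w :
  strip_loc uV' Wz' (strip_ext V V' y n w) = strip_loc uV Wz w.
Proof. by apply: cofW_inj => c h; rewrite cev_mk (strip_ext_in _ (strip_up uV h Wz)). Qed.
Lemma strip_ext_d V V' (uV : up_closed V) (uV' : up_closed V') y i j w : V' `<=` V ->
  strip_ext V V' y j (strip_d uV y i j w) = strip_d uV' y i j (strip_ext V V' y i w).
Proof.
move=> h; apply: cofW_inj => c Wc'; have Wc : strip V y (pt j c) by case: Wc' => /h.
by rewrite (strip_ext_in _ Wc) !cev_mk (strip_loc_ext uV _ Wc).
Qed.

Section Tensored.
Variables (y y' : Y) (h : spec y y').
Definition strip_extt n V V' := tmapl (rs_res h) (strip_ext V V' y n)
  (idfun : {linear (rs_O y')^o -> (rs_O y')^o}).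
Lemma strip_extt_comp n (V V' V'' : set X) w : V `&` V'' `<=` V' ->
  strip_extt n V' V'' (strip_extt n V V' w) = strip_extt n V V'' w.
Proof. by move=> hV; apply: tmapl_comp => // m; rewrite strip_ext_comp. Qed.
Lemma strip_extt_id n V w : strip_extt n V V w = w.
Proof.
by move: w; apply: tens_ext => [a b||m b]; rewrite ?linearD // tmapl_pure strip_ext_id.
Qed.
Lemma strip_extt_cover n (U V1 V2 V3 : set X) : U = V1 `|` V2 -> V3 = V1 `&` V2 ->
  forall w, w = strip_extt n V1 U (strip_extt n U V1 w) + strip_extt n V2 U (strip_extt n U V2 w) -
    strip_extt n V3 U (strip_extt n U V3 w).
Proof.
move=> hU h3; apply: tens_ext => [//|a b|m b].
  rewrite ![strip_extt n U _ (a + b)]linearD ![strip_extt n _ U (_ + _)]linearD.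
  by rewrite [RHS]addrACA [X in _ = X + _]addrACA -opprD.
by rewrite !tmapl_pure -tpureNl -!tpureDl -strip_ext_cover.
Qed.
Lemma strip_extt_d n j V V' (uV : up_closed V) (uV' : up_closed V') w : V' `<=` V ->
  strip_extt j V V' (strip_dt h uV n j w) = strip_dt h uV' n j (strip_extt n V V' w).
Proof.
move=> hV; move: w; apply: tens_ext => [a b|a b|m b]; rewrite ?linearD //.
by rewrite !tmapl_pure strip_ext_d.
Qed.
Lemma strip_bc_ext n V V' w : V' `<=` V ->
  strip_bc V' h n (strip_extt n V V' w) = strip_ext V V' y' n (strip_bc V h n w).
Proof.
move=> hV; apply/esym/bc_sq => m; apply: cofW_inj => c Wc'.
have Wc : strip V y' (pt n c) by case: Wc' => /hV.
by rewrite (strip_ext_in _ Wc) [RHS]cev_mk [RHS](strip_ext_in _ (strip_shrink h Wc)).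
Qed.

Lemma strip_claim_cover (U V1 V2 V3 : set X) (uU : up_closed U) (u1 : up_closed V1)
    (u2 : up_closed V2) (u3 : up_closed V3) : U = V1 `|` V2 -> V3 = V1 `&` V2 ->
  strip_claim h u1 -> strip_claim h u2 -> strip_claim h u3 -> strip_claim h uU.
Proof.
move=> hU h3 q1 q2 q3.
have s1 : V1 `<=` U by rewrite hU => p; left.
have s2 : V2 `<=` U by rewrite hU => p; right.
have s31 : V3 `<=` V1 by rewrite h3 => p [].
have s32 : V3 `<=` V2 by rewrite h3 => p [].
apply: (@mayer_vietoris (rs_O y') _ _ _ _ _ _ _ _ _ _ _ (strip_dt h u3) _ _ _ (strip_d u3 y')
  (strip_bc U h) _ _ (strip_bc V3 h)
  (fun n => strip_extt n U V1) (fun n => strip_extt n U V2) (fun n => strip_extt n V1 V3)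
  (fun n => strip_extt n V2 V3) (fun n => strip_ext U V1 y' n) (fun n => strip_ext U V2 y' n)
  (fun n => strip_ext V1 V3 y' n) (fun n => strip_ext V2 V3 y' n)
  _ _ _ _ _ _ _ _ _ _ _ _ _ _ _ _ _ _ _ _ _ _ _ q1 q2 q3).
1-4: by move=> *; apply: strip_extt_d.
1-4: by move=> *; apply: strip_ext_d.
- by move=> *; apply/esym/strip_bc_d.
- move=> i j l w; rewrite /strip_dt.
  rewrite (tmapl_comp (u'' := strip_d u1 y j l \o strip_d u1 y i j) (v'' := idfun)) // tmapl0l //.
  by move=> m; apply: strip_dd.
- exact: strip_dd.
1-4: by move=> *; apply: strip_bc_ext.
- by move=> n; apply: (glue_restr (@strip_extt_comp n) h3).
- by move=> n; apply: (glue_restr (@strip_ext_comp y' n) h3).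
- by move=> n; apply: (glue_inj (@strip_extt_comp n) h3 (strip_extt_cover hU h3)).
- by move=> n; apply: (glue_inj (@strip_ext_comp y' n) h3 (strip_ext_cover hU h3)).
- by move=> n; apply: (glue_exists (@strip_extt_comp n) (@strip_extt_id n) hU h3).
- by move=> n; apply: (glue_exists (@strip_ext_comp y' n) (@strip_ext_id y' n) hU h3).
- by move=> n; apply: (glue_surj (@strip_extt_comp n) (@strip_extt_id n) h3).
- by move=> n; apply: (glue_surj (@strip_ext_comp y' n) (@strip_ext_id y' n) h3).
Qed.
End Tensored.

Lemma strip_claim_empty (V : set X) (uV : up_closed V) y y' (h : spec y y') :
  (forall p, ~ V p) -> strip_claim h uV.
Proof.
move=> V0 i j l m _ _ _ x x' _ _.
have G0 yy n (w : strip_mod V yy n) : w = 0.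
  by apply: cofW_inj => c Wc; case: (V0 _ (proj1 Wc)).
have T0 n (w : tens (rs_res h) (strip_mod V y n) (rs_O y')^o) : w = 0.
  move: w; apply: (tens_ext (f := id) (g := fun=> 0)) => [//|a b|w b]; first by rewrite addr0.
  by rewrite (G0 _ _ w) tpure0l.
by exists 0, 0; split; rewrite ?linear0 ?addr0 ?(T0 _ x) ?(G0 _ _ x').
Qed.

Definition stalk_claim (z z' : Z) (hz : spec z z') :=
  @qis (fun n => tens (rs_res hz) (I n z) (rs_O z')^o) (fun n => I n z')
    (fun i j => tmapl (rs_res hz) (d i j z) idfun) (fun i j => d i j z') (fun n => bcm (I n) hz).

Section Stalk.
Variables (x : X) (y y' : Y) (h : spec y y') (hz : spec ((x, y) : Z) ((x, y') : Z)).
Variables (V : set X) (uV : up_closed V).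
Hypothesis VE : forall p, V p <-> spec x p.
Hypothesis qK : stalk_claim hz.

Fact strip_apex yy : strip V yy ((x, yy) : Z). Proof. by split; [apply/VE|]. Qed.
Fact strip_stalk yy z : strip V yy z -> spec ((x, yy) : Z) z.
Proof. by move=> [/VE h1 h2]; apply: prod_spec. Qed.
Definition strip_stalk_map yy n (w : strip_mod V yy n) :
  rscal (tainr (rs_str x) (rs_str yy)) (I n (x, yy)) := strip_loc uV (strip_apex yy) w.
Fact strip_stalk_lin yy n : linear (@strip_stalk_map yy n).
Proof.
move=> a s t.
have E : strip_rho (strip_apex yy) a = tainr (rs_str x) (rs_str yy) a.
  by rewrite /strip_rho /= rs_res_id.
by rewrite [LHS]strip_loc_lin
  -[LHS]/(strip_rho (strip_apex yy) a *: strip_loc uV (strip_apex yy) s + _) E.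
Qed.
Lemma strip_stalk_inj yy n : injective (@strip_stalk_map yy n).
Proof.
move=> w w' e; apply: cofW_inj => c Wc.
have := congr1 (fun t : cof_st (pt n) (x, yy) => cev t c (strip_stalk Wc)) e.
by rewrite !cev_mk (Prop_irrelevance (strip_up _ _ _) Wc).
Qed.
Lemma strip_stalk_surj yy n t : exists w, @strip_stalk_map yy n w = t.
Proof.
exists (mkcofW (fun c Wc => cev (t : cof_st (pt n) (x, yy)) c (strip_stalk Wc))).
by apply: cofW_inj => c hc; rewrite !cev_mk (Prop_irrelevance (strip_stalk _) hc).
Qed.

(** The ring at (x, y') is the pushout of the rings at (x, y) and y' over the ring at y. Tensoring
    the stalk at (x, y) along y <= y' is therefore base change along (x, y) <= (x, y'). *)
Lemma strip_claim_stalk : strip_claim h uV.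
Proof.
have psiE a b : rs_res hz (tapure (rs_str x) (rs_str y) a b) =
    tapure (rs_str x) (rs_str y') a (rs_res h b).
  by rewrite [LHS]tamapE rs_res_id (Prop_irrelevance (spec_snd hz) h).
pose pm n := @pushout_map _ _ _ _ (rs_res h) (rs_res hz) (tainr (rs_str x) (rs_str y))
  (tainr (rs_str x) (rs_str y')) (I n (x, y)).
have sq := sigma_r_sq psiE.
pose tm n := tmapl (rs_res h) (mklin (@strip_stalk_lin y n))
  (idfun : {linear (rs_O y')^o -> (rs_O y')^o}).
have tb n : bijective (tm n).
  by apply: tens_bij; [apply: strip_stalk_inj|apply: strip_stalk_surj].
have pmD n : {morph pm n : a b / a + b} by exact: pushout_mapD sq _.
have pmE n (a : I n (x, y)) b :
    pm n (tpure _ (a : rscal (tainr (rs_str x) (rs_str y)) (I n (x, y))) (b : (rs_O y')^o)) =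
    tpure (rs_res hz) a (tainr (rs_str x) (rs_str y') b : (rs_O ((x, y') : Z))^o).
  exact: pushout_map_pure sq _ _ _.
apply: (qis_transfer (A2 := fun n => tens (rs_res hz) (I n (x, y)) (rs_O ((x, y') : Z))^o)
  (B2 := fun n => I n (x, y')) (a := fun n t => pm n (tm n t)) (b := @strip_stalk_map y')) qK.
- by move=> n a b; rewrite linearD pmD.
- by move=> n a b; exact: (linearD (mklin (@strip_stalk_lin y' n))).
- move=> i j; apply: tens_ext => [a b|a b|w b]; rewrite ?linearD ?pmD ?linearD //.
  rewrite /tm !tmapl_pure [LHS]pmE pmE [RHS]tmapl_pure; congr (tpure _ _ _).
  exact: strip_loc_d.
- by move=> i j w; exact: strip_loc_d.
- move=> n; apply: tens_ext => [a b|a b|w b].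
  + rewrite linearD; exact: (linearD (mklin (@strip_stalk_lin y' n))).
  + by rewrite linearD pmD linearD.
  rewrite /tm tmapl_pure [in RHS]pmE [RHS]bcmap_pure [strip_bc _ _ _ _]bcmap_pure.
  rewrite [LHS](linearZ_LR (mklin (@strip_stalk_lin y' n))).
  congr (_ *: _); transitivity (strip_loc uV (strip_up uV hz (strip_apex y)) w).
    exact: strip_loc_strip_res.
  exact/esym/strip_loc_res.
- move=> n a b /(tensr_map_inj (rs_str_res h) psiE) /(bij_inj (tb n)); exact.
- move=> n z; have [t <-] := tensr_map_surj psiE z.
  by have [w <-] := bij_surj (tb n) t; exists w.
- exact: strip_stalk_inj.
- exact: strip_stalk_surj.
Qed.
End Stalk.

Section AllStrips.
Variables (y y' : Y) (h : spec y y').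
Hypothesis qK : forall (x : X) (hz : spec ((x, y) : Z) ((x, y') : Z)), stalk_claim hz.

(** Strong induction on the number of points of V. For a minimal point p, V is covered by U_p, where
    the stalk decides, and by V without the class of p; this part and its intersection with U_p have
    fewer points. *)
Lemma strip_claimT (V : set X) (uV : up_closed V) : strip_claim h uV.
Proof.
have [s sE] := proj1 (@finite_seqP X [set: X]) (rs_finite X).
have sT p : p \in s by have : [set: X] p by []; rewrite sE.
pose cnt (U : set X) := count (fun p => `[< U p >]) s.
have cnt_lt U U' p : U `<=` U' -> U' p -> ~ U p -> (cnt U < cnt U')%N.
  move=> UU' Up nUp; apply: (count_lt (sT p)); [exact/asboolP|exact/asboolPn|].
  by move=> q /asboolP Uq; apply/asboolP/UU'.
have [n] := ubnP (cnt V); elim: n => // n IH in V uV *.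
rewrite ltnS => Vn.
have [[p0 Vp0]|V0] := pselect (exists p, V p); last first.
  by apply: strip_claim_empty => p Vp; apply: V0; exists p.
(* Specialization is only a preorder, so minimality is up to equivalence; p is found by descent on
   the number of points below [p0]. *)
have [p [Vp pmin]] : exists p, V p /\ forall q, V q -> spec q p -> spec p q.
  have [m] := ubnP (cnt [set q | spec q p0]).
  elim: m => // m IHm in p0 Vp0 *; rewrite ltnS => hm.
  have [hp|] := pselect (forall q, V q -> spec q p0 -> spec p0 q); first by exists p0.
  move=> /existsNP[q /not_implyP[Vq /not_implyP[qp npq]]]; apply: (IHm q) => //.
  apply: leq_trans hm; apply: (cnt_lt _ _ p0) => // r rq; exact: spec_trans rq qp.
(* The points of V below p are equivalent to p, so [V2] is still open and covers V together with
   U_p. *)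
pose V2 := V `\` [set q | spec q p].
have u1 : up_closed (minopen p) by move=> q r qr pq; apply: spec_trans pq qr.
have u2 : up_closed V2.
  move=> q r qr [Vq nqp]; split; first exact: uV qr Vq.
  by move=> rp; apply: nqp; apply: spec_trans qr rp.
have u3 : up_closed (minopen p `&` V2).
  by move=> q r qr [h1 h2]; split; [apply: u1 qr h1|apply: u2 qr h2].
have lt2 : (cnt V2 < n)%N.
  by apply: leq_trans Vn; apply: (cnt_lt _ _ p) => // [q []|[_]]; last apply.
have VE : V = minopen p `|` V2.
  apply/seteqP; split=> [q Vq|q [pq|[]]//]; last exact: uV pq Vp.
  by have [qp|] := pselect (spec q p); [left; apply: pmin|right].
apply: (@strip_claim_cover _ _ h _ _ _ _ uV u1 u2 u3 VE erefl); last 2 first.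
- exact: IH.
- apply: IH; apply: leq_ltn_trans lt2; apply: sub_count => q /asboolP[_ h2].
  exact/asboolP.
have hz : spec ((p, y) : Z) ((p, y') : Z) by apply: prod_spec; first exact: spec_refl.
exact: (@strip_claim_stalk p y y' h hz (minopen p) u1 (fun q => conj id id) (@qK p hz)).
Qed.
End AllStrips.

Hypothesis d0 : forall i j, j != i + 1 -> forall p m, d i j p m = 0.
Local Notation K := (Complex d0 dd).
Let uT : up_closed [set: X]. Proof. by []. Qed.

Section PushSections.
Variables (y : Y) (n : int).
(** A compatible family is determined by its coordinate at each index c, taken in the stalk at the
    point of c itself. *)
Definition push_strip (t : pushforward (prod_proj2 X Y) (K n) y) : strip_mod [set: X] y n :=
  mkcofW (fun c Wc => cev (subm_val t (exist _ (pt n c) (proj2 Wc)) : cof_st (pt n) _) c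
    (@spec_refl Z (pt n c))).
Fact push_strip_lin : linear push_strip.
Proof.
move=> a s t; apply: cofW_inj => c Wc; rewrite [RHS]cevD [cev (_ *: _) _ _ in RHS]cevZ !cev_mk.
pose ev (r : pushforward (prod_proj2 X Y) (K n) y) : I n (pt n c) :=
  subm_val r (exist _ (pt n c) (proj2 Wc)).
transitivity (cev (strip_rho Wc a *: ev s + ev t : cof_st (pt n) _) c
  (@spec_refl Z (pt n c))) => //.
by rewrite cevD cevZ rs_res_id.
Qed.
Lemma push_strip_loc (t : pushforward (prod_proj2 X Y) (K n) y) z (Wz : strip [set: X] y z) :
  strip_loc uT Wz (push_strip t) = subm_val t (exist _ z (proj2 Wz)).
Proof.
apply: cofW_inj => c hc; rewrite [LHS]cev_mk [LHS]cev_mk.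
rewrite -(@submP _ _ (compatible_submod _ _) t (exist _ z (proj2 Wz))
  (exist _ (pt n c) (proj2 (strip_up uT hc Wz))) hc).
exact: cev_res.
Qed.
Lemma push_strip_inj : injective push_strip.
Proof.
move=> t t' e; apply: push_val_inj => -[z yz].
have Wz : strip [set: X] y z := conj Logic.I yz.
by rewrite (Prop_irrelevance yz (proj2 Wz)) -!push_strip_loc e.
Qed.
Lemma push_strip_surj w : exists t, push_strip t = w.
Proof.
pose fam : sections_fam (K n) (@push_rho _ _ _ (prod_proj2 X Y) y) :=
  fun i => strip_loc uT (conj Logic.I (proj2_sig i) : strip [set: X] y (sval i)) w.
have hf : compatible (K n) _ _ fam by move=> i j h; exact: strip_loc_res.
exists (mksubm (W := compatible_submod (K n) (@push_rho_res _ _ _ (prod_proj2 X Y) y)) hf).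
apply: cofW_inj => c Wc; rewrite [LHS]cev_mk -[RHS](cev_strip_loc uT).
by rewrite [in RHS](Prop_irrelevance Wc (conj Logic.I (proj2 Wc))).
Qed.
End PushSections.

Lemma push_cofree_qc : finite_space X -> finite_space Y -> qc_cohomology K ->
  qc_cohomology (push_cx (prod_proj2 X Y) K).
Proof.
move=> fX fY /(qc_cohomologyP _ (prod_space_finite fX fY)) qK.
apply/(qc_cohomologyP _ fY) => y y' h.
pose tm n := tmapl (rs_res h) (mklin (@push_strip_lin y n))
  (idfun : {linear (rs_O y')^o -> (rs_O y')^o}).
have tb n : bijective (tm n).
  by apply: tens_bij; [apply: push_strip_inj|apply: push_strip_surj].
have sd yy i j t : push_strip (push_map (prod_proj2 X Y) (d i j) yy t) =
    strip_d uT yy i j (push_strip t).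
  by apply: cofW_inj => c Wc; rewrite !cev_mk push_strip_loc.
have := @strip_claimT y y' h (fun x hz => qK _ _ hz) [set: X] uT.
apply: (qis_transfer (A2 := fun n => tens (rs_res h) (strip_mod [set: X] y n) (rs_O y')^o)
  (B2 := strip_mod [set: X] y') (a := tm) (b := @push_strip y')).
- by move=> n a b; rewrite linearD.
- by [].
- move=> i j; apply: tens_ext => [a b|a b|w b]; rewrite ?linearD //.
  by rewrite !tmapl_pure; congr (tpure _ _ _); exact: sd.
- by move=> i j w; exact: sd.
- move=> n; apply: tens_ext => [a b|a b|w b].
  + by rewrite linearD.
  + by rewrite !linearD.
  rewrite /tm tmapl_pure [RHS]bcmap_pure [bcm _ _ _]bcmap_pure.
  rewrite [LHS](linearZ_LR (mklin (@push_strip_lin y' n))); congr (_ *: _).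
  apply: cofW_inj => c Wc; rewrite !cev_mk.
  by rewrite (Prop_irrelevance (proj2 (strip_shrink h Wc)) (spec_trans h (proj2 Wc))).
- by move=> n; exact: bij_inj (tb n).
- by move=> n; exact: bij_surj (tb n).
- exact: push_strip_inj.
- exact: push_strip_surj.
Qed.
End Strips.

(** * Derived functors *)

Section Derived.
Variable k : comPzRingType.

Lemma derived_pullback_qc (X Y : ringed_finite_space k) (f : morphism X Y)
    (Lf : derived_pullback f) (M : complex Y) :
  finite_space X -> finite_space Y -> qc_cohomology M -> qc_cohomology (Lf M).
Proof.
move=> fX fY qM.
have [g gi] := @left_derived_resolution _ _ _ _ _ _ Lf (semifree M) M (sf_eps M)
  (@semifree_K_flat _ _ M) (quasi_iso_loc (@sf_eps_quasi_iso _ _ M)).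
apply: (qc_cohomology_iso gi); apply: pull_semifree_qc => //.
exact/(qc_cohomology_qis (@sf_eps_quasi_iso _ _ M)).
Qed.

Lemma derived_tensor_qc (X : ringed_finite_space k) (T : derived_tensor X) (M N : complex X) :
  finite_space X -> qc_cohomology M -> qc_cohomology N -> qc_cohomology (T (M, N)).
Proof.
move=> fX qM qN.
(* Only the first factor is resolved: [derived_tensor] is computed by pairs whose first member is
   K-flat. *)
have hi : is_iso (fmap (prodfun (Qfun X) (Qfun X)) (a := (semifree M, N)) (b := (M, N))
    (sf_eps M, chain_id N)).
  have [g [h1 h2]] := quasi_iso_loc (@sf_eps_quasi_iso _ _ M).
  have e := fmap_id (Qfun X) N.
  exists (g, idc (Qfun X N)); split; split => //=.
    exact: Heq_trans (comp1c _) e.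
  exact: Heq_trans (compc1 _) e.
have [g gi] := @left_derived_resolution _ _ _ _ _ _ T (semifree M, N) (M, N)
  (sf_eps M, chain_id N) (@semifree_K_flat _ _ M) hi.
apply: (qc_cohomology_iso gi); apply: tensor_semifree_qc => //.
exact/(qc_cohomology_qis (@sf_eps_quasi_iso _ _ M)).
Qed.

Lemma derived_pushforward_qc (X Y : ringed_finite_space k)
    (Rpi : derived_pushforward (prod_proj2 X Y)) (M : complex (prod_space X Y)) :
  finite_space X -> finite_space Y -> qc_cohomology M -> qc_cohomology (Rpi M).
Proof.
move=> fX fY qM.
have [g gi] := @right_derived_resolution _ _ _ _ _ _ Rpi (tinj M) M (tres M)
  (@tinj_K_injective _ _ M) (quasi_iso_loc (@tres_quasi_iso _ _ M)).
apply: (qc_cohomology_iso gi); apply: push_cofree_qc => //.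
exact/(qc_cohomology_qis (@tres_quasi_iso _ _ M)).
Qed.
End Derived.

Theorem corollary3p18 (k : comPzRingType) :
  (forall (X Y : ringed_finite_space k) (f : morphism X Y),
     finite_space X -> finite_space Y ->
     forall Lf : derived_pullback f,
       (forall M : complex Y, qc_cohomology M -> qc_cohomology (Lf M)) /\
       restricts (Dqc_incl Y) (Dqc_incl X) Lf)
  /\
  (forall X : ringed_finite_space k,
     finite_space X ->
     forall T : derived_tensor X,
       (forall M N : complex X,
          qc_cohomology M -> qc_cohomology N -> qc_cohomology (T (M, N))) /\
       restricts (prodfun (Dqc_incl X) (Dqc_incl X)) (Dqc_incl X) T)
  /\
  (forall X Y : ringed_finite_space k,
     finite_space X -> finite_space Y ->
     forall (Lpi : derived_pullback (prod_proj1 X Y))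
            (T : derived_tensor (prod_space X Y))
            (Rpi : derived_pushforward (prod_proj2 X Y))
            (K : complex (prod_space X Y)),
       qc_cohomology K ->
       (forall M : complex X,
          qc_cohomology M -> qc_cohomology (integral_functor Lpi T Rpi K M)) /\
       restricts (Dqc_incl X) (Dqc_incl Y) (integral_functor Lpi T Rpi K)).
Proof.
split=> [X Y f fX fY Lf|].
  have h M : qc_cohomology M -> qc_cohomology (Lf M) by exact: derived_pullback_qc.
  by split=> //; apply: restricts_full => a; exact: h (svalP a).
split=> [X fX T|X Y fX fY Lpi T Rpi K qK].
  have h M N : qc_cohomology M -> qc_cohomology N -> qc_cohomology (T (M, N)).
    exact: derived_tensor_qc.
  by split=> //; apply: restricts_full => a; exact: h (svalP a.1) (svalP a.2).
have fZ := prod_space_finite fX fY.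
have h M : qc_cohomology M -> qc_cohomology (integral_functor Lpi T Rpi K M).
  move=> qM; apply: derived_pushforward_qc => //; apply: derived_tensor_qc => //.
  exact: derived_pullback_qc.
by split=> //; apply: restricts_full => a; exact: h (svalP a).
Qed.
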